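(* Let $n\ge 2$ and let $\widetilde{\omega}$ be a smooth, closed, bounded differential $2$-form on $\mathbb{H}^n$ such that $$\int_T\widetilde{\omega}=0$$ for every ideal triangle $T\subseteq\mathbb{H}^n$. Then $\widetilde{\omega}=0$.
   Context: A $2$-form $\widetilde\omega$ on $\mathbb{H}^n$ is bounded if $\sup|\widetilde\omega_p(e_1,e_2)|<\infty$, the supremum being over all $p\in\mathbb{H}^n$ and all orthonormal $2$-frames $(e_1,e_2)$ in $T_p\mathbb{H}^n$. An ideal triangle is the (two-dimensional) geodesic triangle in $\mathbb{H}^n$ whose vertices are three pairwise distinct points of the boundary at infinity $\partial\mathbb{H}^n$, i.e. the hyperbolic convex hull of these three points. It has area $\pi$, so the integral of a bounded form over it (with either orientation) converges absolutely. *)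

(* Defs.v *)
From HB Require Import structures.
From mathcomp Require Import all_boot all_order all_algebra.
From mathcomp Require Import all_classical all_reals all_analysis.
Set Implicit Arguments.
Unset Strict Implicit.
Unset Printing Implicit Defensive.
Import Order.TTheory GRing.Theory Num.Theory.
Import numFieldNormedType.Exports.
Local Open Scope classical_set_scope.
Local Open Scope ring_scope.

(* Hyperbolic n-space is taken in the Beltrami-Klein model: the Euclidean unit
   ball, with boundary at infinity the unit sphere, in which the geodesics are
   the straight chords. The tangent space at each point is identified with
   R^n. *)

(* The norm [`|u|] on ['rV[R]_n] is the sup norm, so the Euclidean structure is
   introduced separately. *)
Definition dot (R : realType) (n : nat) (u v : 'rV[R]_n) : R :=
  \sum_(i < n) u 0 i * v 0 i.

Definition hyp_space (R : realType) (n : nat) : set 'rV[R]_n :=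
  [set p | dot p p < 1].

Definition ideal_boundary (R : realType) (n : nat) : set 'rV[R]_n :=
  [set a | dot a a = 1].

(* The Riemannian metric of constant curvature -1 in the Klein model. *)
Definition klein_metric (R : realType) (n : nat) (p u v : 'rV[R]_n) : R :=
  dot u v / (1 - dot p p) + dot p u * dot p v / (1 - dot p p) ^+ 2.

Definition orthonormal_frame (R : realType) (n : nat) (p u v : 'rV[R]_n) : Prop :=
  [/\ klein_metric p u u = 1, klein_metric p v v = 1 & klein_metric p u v = 0].

(* C^infinity on an open set [U]: all iterated directional derivatives along
   constant vectors exist and are (Frechet) differentiable, hence continuous,
   at every point of [U]. *)
Definition smooth_on (R : realType) (n : nat) (U : set 'rV[R]_n)
    (f : 'rV[R]_n -> R) : Prop :=
  forall (s : seq 'rV[R]_n) (p : 'rV[R]_n), U p ->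
    differentiable (foldr (fun v (g : 'rV[R]_n -> R) => 'D_v g) f s) p.

(* A differential 2-form is represented by a field [w] of bilinear forms on
   R^n, of which only the values at the points of [hyp_space] are
   meaningful. *)
Definition is_two_form (R : realType) (n : nat)
    (w : 'rV[R]_n -> {biscalar 'rV[R]_n}) : Prop :=
  forall p u, hyp_space p -> w p u u = 0.

Definition smooth_form (R : realType) (n : nat)
    (w : 'rV[R]_n -> {biscalar 'rV[R]_n}) : Prop :=
  forall u v, smooth_on (@hyp_space R n) (fun p => w p u v).

(* dw evaluated on constant vector fields, whose Lie brackets vanish. *)
Definition exterior_derivative (R : realType) (n : nat)
    (w : 'rV[R]_n -> {biscalar 'rV[R]_n}) (p x y z : 'rV[R]_n) : R :=
  'D_x (fun q => w q y z : R) p - 'D_y (fun q => w q x z : R) p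
  + 'D_z (fun q => w q x y : R) p.

Definition closed_form (R : realType) (n : nat)
    (w : 'rV[R]_n -> {biscalar 'rV[R]_n}) : Prop :=
  forall p x y z, hyp_space p -> exterior_derivative w p x y z = 0.

Definition bounded_form (R : realType) (n : nat)
    (w : 'rV[R]_n -> {biscalar 'rV[R]_n}) : Prop :=
  has_ubound [set r | exists p u v,
    [/\ hyp_space p, orthonormal_frame p u v & r = `|w p u v : R|]].

(* Geodesics being chords, the hyperbolic convex hull of ideal points is the
   part inside the ball of their Euclidean convex hull. *)
Definition ideal_triangle (R : realType) (n : nat) (a b c : 'rV[R]_n) :
    set 'rV[R]_n :=
  smallest (@convex_set R 'rV[R]_n) [set a; b; c] `&` @hyp_space R n.

Definition triangle_param (R : realType) (n : nat) (a b c : 'rV[R]_n)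
    (z : R * R) : 'rV[R]_n :=
  a + z.1 *: (b - a) + z.2 *: (c - a).

(* The integral of [w] over the ideal triangle oriented by the ordering
   [a, b, c] of its vertices: three distinct points of the sphere are affinely
   independent, so [triangle_param a b c] is an affine parametrisation of the
   triangle, with coordinate vector fields [b - a] and [c - a], along which [w]
   is pulled back. *)
Definition triangle_integral (R : realType) (n : nat)
    (w : 'rV[R]_n -> {biscalar 'rV[R]_n}) (a b c : 'rV[R]_n) : \bar R :=
  (\int[lebesgue_measure \x lebesgue_measure]_(z in
      triangle_param a b c @^-1` ideal_triangle a b c)
    (w (triangle_param a b c z) (b - a)%R (c - a)%R)%:E)%E.

(* Main.v *)
Require Import Defs.
From HB Require Import structures.
From mathcomp Require Import all_boot all_order all_algebra.
From mathcomp Require Import all_classical all_reals all_analysis.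
From mathcomp Require Import measurable_realfun ring lra.
Import Order.TTheory GRing.Theory Num.Theory.
Import numFieldNormedType.Exports.
Local Open Scope classical_set_scope.
Local Open Scope ring_scope.
Set Implicit Arguments.
Unset Strict Implicit.
Unset Printing Implicit Defensive.

(** Let (e1, e2) be an orthonormal frame at a point p. By Gram-Schmidt
    ([gram_schmidt]) the claim reduces to w p e1 e2 = 0, so only the totally
    geodesic plane through p tangent to e1 and e2 matters. In the Klein model
    this plane is a section of the ball by an affine plane, and a projective
    chart [plane_section] maps the unit disc onto it, the centre to p, and
    inscribed triangles to ideal triangles. In this chart the form has the
    density h(y) = w(e1, e2) / d(y)^3, d being the weight of the projective
    map. Boundedness becomes |h(y)| <= C (1 - |y|^2)^(-3/2), because the
    right-hand side without C is the hyperbolic area density of the Klein disc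
    ([section_density_bound]), and the hypothesis becomes that the integral of
    h over every triangle inscribed in the unit circle vanishes
    ([section_density_ideal]). What has to be shown is h(0) = 0
    ([planar_vanishing]).

    Rotations permute the inscribed triangles and fix the centre, so h may be
    replaced by its mean over rotations: h(y) = k(|y|^2). It is then enough
    that k vanishes on ]0, 1[ ([radial_vanishing]), since the mean is
    continuous at 0.

    For u in ]0, 1[ put M(u) = (1 / 2u) times the integral of k over [0, u].
    Then M(|y|^2) (y1 dy2 - y2 dy1) is a primitive of k(|y|^2) dy1 dy2 away from 0, and
    Green's formula ([green_ideal_triangle]) turns the integral over a triangle
    into three edge terms. On the edge PQ, |y|^2 = 1 - t (1 - t) |Q - P|^2 and
    y1 dy2 - y2 dy1 = (P x Q) dt, so the term is (P x Q) J(|Q - P|^2) with J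
    an integral of M ([edge_integral]). For the vertices at angles 0, a, a + b
    the vanishing of the sum says that E(t) = sin t J(2 - 2 cos t) is additive
    on ]0, pi[ ([sector_additive]). The bound on k makes E bounded and makes it
    tend to 0 at pi, and such an additive function is 0
    ([bounded_additive_eq0]).

    Hence the integral of M(|y|^2) along every chord is zero. As a function of
    the distance of the chord to the centre this is Abel's integral equation,
    which has the unique solution M = 0 ([abel_injective]). Differentiating
    u M(u) gives k = 0.

    The triangles reach the circle, where k may blow up like the power -3/2 of
    1 - |y|^2. All the integrals above converge absolutely because of an
    explicit majorant on the simplex ([integrable_bary_e2_powR]). *)

(** * Affine changes of variable *)

Section Affine.
Context {R : realType}.
Notation mu := (@lebesgue_measure R).
Local Open Scope ereal_scope.

Lemma measurable_affine (c d : R) :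
  measurable_fun [set: R] (fun x : R => c * x + d)%R.
Proof. by apply: measurable_funD => //; exact: mulrl_measurable. Qed.

Lemma preimage_affine_itv (c d : R) (i : interval R) : (0 < c)%R ->
  (fun x : R => c * x + d)%R @^-1` [set` i] =
  [set` (let: Interval a b := i in
    let g e := match e with BSide s t => BSide s ((t - d) / c)%R
                          | BInfty s => BInfty _ s end in
    Interval (g a) (g b))].
Proof.
move=> c0; apply/seteqP; split=> x /=; case: i => -[[] a|[]] [[] b|[]] //=;
 by rewrite !in_itv/= ?andbT ?ler_pdivlMr ?ltr_pdivlMr ?ler_pdivrMr ?ltr_pdivrMr // 
  ?lerBlDr ?ltrBlDr ?lerBrDr ?ltrBrDr// ![(c * x)%R]mulrC.
Qed.

Let T := measurableTypeR R.

Let affine_measure (c d : R) (c0 : (0 < c)%R) : {measure set T -> \bar R} :=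
  mscale (NngNum (ltW c0))
    (measure_function_pushforward__canonical__measure_function_Measure mu
      (measurable_affine c d : measurable_fun [set: T] (_ : T -> T))).

(** Both sides are measures which agree on intervals, and Lebesgue measure is
    determined by its values there. *)
Lemma lebesgue_affine_measure (c d : R) (c0 : (0 < c)%R) (A : set T) :
  measurable A -> mu A = affine_measure d c0 A.
Proof.
apply: lebesgue_measure_unique => _ [[x y] xy <-].
rewrite -[RHS]/(c%:E * mu ((fun x : R => c * x + d)%R @^-1` `]x, y])).
rewrite (preimage_affine_itv d (Interval (BRight x) (BRight y)) c0) /=.
rewrite !lebesgue_measure_itv/= !lte_fin ltr_pM2r ?invr_gt0// ltrD2r.
case: ifPn => _; last by rewrite mule0.
by rewrite -!EFinB -EFinM -mulrBl; congr EFin; field; exact: lt0r_neq0.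
Qed.

Lemma ge0_integral_affine (c d : R) (f : R -> \bar R) : (0 < c)%R ->
  measurable_fun [set: R] f -> (forall x, 0 <= f x) ->
  \int[mu]_x f x = c%:E * \int[mu]_x f (c * x + d)%R.
Proof.
move=> c0 mf f0.
transitivity (\int[affine_measure d c0]_x f x).
  by apply: eq_measure_integral => A mA _; exact: lebesgue_affine_measure.
rewrite ge0_integral_mscale//= ge0_integral_pushforward//=.
exact: measurable_affine.
Qed.

End Affine.

Section Tools.
Context {R : realType}.
Notation mu := (@lebesgue_measure R).
Local Open Scope ereal_scope.

(** Writing the domain as a guard inside the integrand keeps the measure
    spaces fixed, so that Tonelli's theorem and the changes of variable apply
    to integrals over moving domains. *)
Lemma integral_guard d (T : measurableType d) (m : {measure set T -> \bar R})
    (P : pred T) (f : T -> \bar R) :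
  \int[m]_(x in [set x | P x]) f x = \int[m]_x (if P x then f x else 0).
Proof.
rewrite integral_mkcond; apply: eq_integral => x _.
by rewrite patchE /=; congr (if _ then _ else _); apply/idP/idP; rewrite inE.
Qed.

Lemma measurable_invr : measurable_fun [set: R] (@GRing.inv R).
Proof.
rewrite -(setUv [set 0%R]); apply/measurable_funU => //.
  exact: measurableC.
split; first exact: measurable_fun_set1.
apply: open_continuous_measurable_fun.
  by apply: closed_openC; exact: closed_eq.
by move=> x; rewrite inE /= => /eqP x0; exact: inv_continuous.
Qed.

End Tools.

(** Measurability of functions built from arithmetic, comparisons, pairs and
    measurable hypotheses, by recursion on the body of the function. *)
(** * Polar coordinates and projective changes of variable on the line *)

Ltac meas := repeat first
  [ assumption
  | exact: measurable_cst
  | exact: measurable_id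
  | exact: measurable_fst
  | exact: measurable_snd
  | exact: measurable_invr
  | match goal with |- measurable_fun _ (fun z => if _ then _ else _) =>
      apply: measurable_fun_ifT end
  | match goal with
    | |- measurable_fun _ (fun z => _) => fail 1
    | |- measurable_fun ?D (@Order.lt ?d ?T ?a) =>
        change (measurable_fun D (fun z => @Order.lt d T a z))
    | |- measurable_fun ?D (+%R ?a) =>
        change (measurable_fun D (fun z => a + z)%R)
    | |- measurable_fun ?D ( *%R ?a) =>
        change (measurable_fun D (fun z => a * z)%R)
    | |- measurable_fun ?D (mule ?a) =>
        change (measurable_fun D (fun z => a * z)%E)
    | |- measurable_fun ?D (@pair ?T ?U ?a) =>
        change (measurable_fun D (fun z => @pair T U a z))
    end
  | match goal with |- measurable_fun _ (fun z => andb _ _) =>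
      apply: measurable_and end
  | match goal with |- measurable_fun _ (fun z => (_ < _)%R) =>
      apply: measurable_fun_ltr end
  | match goal with |- measurable_fun _ (fun z => ((_)%:E)%E) =>
      apply/measurable_EFinP end
  | match goal with |- measurable_fun _ (fun z => (_ * _)%E) =>
      apply: emeasurable_funM end
  | match goal with |- measurable_fun _ (fun z => (_ + _)%R) =>
      apply: measurable_funD end
  | match goal with |- measurable_fun _ (fun z => (- _)%R) =>
      apply: measurableT_comp => //= end
  | match goal with |- measurable_fun _ (fun z => `|_|%R) =>
      apply: measurableT_comp => //= end
  | match goal with |- measurable_fun _ (fun z => (_ * _)%R) =>
      apply: measurable_funM end
  | match goal with |- measurable_fun _ (fun z => (_ ^+ _)%R) =>
      apply: measurable_funX end
  | match goal with |- measurable_fun _ (fun z => (_ ^-1)%R) =>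
      apply: (measurableT_comp measurable_invr) end
  | match goal with |- measurable_fun _ (fun z => (_, _)) =>
      apply: measurable_fun_pair end
  | match goal with H : measurable_fun setT ?f |- measurable_fun _ (fun z => ?f _) =>
      apply: (measurableT_comp H) end ].

Section Projective.
Context {R : realType}.
Notation mu := (@lebesgue_measure R).
Local Open Scope ereal_scope.

Lemma ge0_integral_scale (c : R) (f : R -> \bar R) : (0 < c)%R ->
  measurable_fun [set: R] f -> (forall x, 0 <= f x) ->
  \int[mu]_x f x = c%:E * \int[mu]_x f (c * x)%R.
Proof.
move=> c0 mf f0; rewrite (ge0_integral_affine 0 c0)//; congr (_ * _).
by apply: eq_integral => x _; rewrite addr0.
Qed.

Lemma ge0_integral_translate (d : R) (f : R -> \bar R) :
  measurable_fun [set: R] f -> (forall x, 0 <= f x) ->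
  \int[mu]_x f x = \int[mu]_x f (x + d)%R.
Proof.
move=> mf f0; rewrite (ge0_integral_affine d ltr01)// mul1e.
by apply: eq_integral => x _; rewrite mul1r.
Qed.

Lemma ge0_integral_swap (F : R -> R -> \bar R) :
  measurable_fun setT (fun z : R * R => F z.1 z.2) ->
  (forall x y, 0 <= F x y) ->
  \int[mu]_x \int[mu]_y F x y = \int[mu]_y \int[mu]_x F x y.
Proof.
by move=> mF F0; apply: (@fubini_tonelli _ _ _ _ R mu mu (fun z : R * R => F z.1 z.2)).
Qed.

(** Polar coordinates for the l^1 norm: r = x + y is the radius and z = x / r
    the position on the segment from (0, 1) to (1, 0). They are reached by
    one-dimensional substitutions and Tonelli only, without a
    multi-dimensional change of variable. *)
Lemma ge0_integral_quadrant_polar (G : R * R -> \bar R) :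
  measurable_fun setT G -> (forall z, 0 <= G z) ->
  \int[mu]_x \int[mu]_y (if (0 < x)%R && (0 < y)%R then G (x, y) else 0) =
  \int[mu]_z \int[mu]_r (if [&& 0 < r, 0 < z & z < 1]%R
    then r%:E * G (r * z, r * (1 - z))%R else 0).
Proof.
move=> mG G0.
transitivity (\int[mu]_x \int[mu]_r
    (if (0 < x)%R && (x < r)%R then G (x, r - x)%R else 0)).
  apply: eq_integral => x _.
  rewrite (ge0_integral_translate (- x)%R); first last.
  - by move=> y; case: ifP.
  - by meas.
  by apply: eq_integral => r _; rewrite subr_gt0.
transitivity (\int[mu]_r \int[mu]_x
    (if (0 < x)%R && (x < r)%R then G (x, r - x)%R else 0)).
  apply: (ge0_integral_swap (F := fun x r =>
    if (0 < x)%R && (x < r)%R then G (x, r - x)%R else 0)).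
    by meas.
  by move=> x r; case: ifP.
transitivity (\int[mu]_r \int[mu]_z (if [&& 0 < r, 0 < z & z < 1]%R
    then r%:E * G (r * z, r * (1 - z))%R else 0)); last first.
  apply: (ge0_integral_swap (F := fun r z => if [&& 0 < r, 0 < z & z < 1]%R
    then r%:E * G (r * z, r * (1 - z))%R else 0)).
    by meas.
  by move=> r z; case: ifP => // /andP[r0 _]; rewrite mule_ge0// lee_fin ltW.
apply: eq_integral => r _; have [r0|r0] := ltP 0%R r; last first.
  rewrite !integral0_eq// => z _ /=.
  by case: ifP => // /andP[z0 /(lt_trans z0)]; rewrite ltNge r0.
rewrite (ge0_integral_scale r0); first last.
- by move=> z; case: ifP.
- by meas.
rewrite -ge0_integralZl_EFin//; first last.
- exact: ltW.
- by meas.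
- by move=> z _; case: ifP.
apply: eq_integral => z _ /=.
rewrite pmulr_rgt0// gtr_pMr//.
by case: ifP; rewrite ?mule0// mulrBr mulr1.
Qed.

Lemma integral_cst_oo (a b : R) : (a <= b)%R ->
  \int[mu]_r (if (a < r)%R && (r < b)%R then 1 else 0) = (b - a)%:E.
Proof.
move=> ab; rewrite -(integral_guard mu (fun r => (a < r)%R && (r < b)%R) (fun=> 1)).
rewrite (_ : [set _ | _] = `]a, b[%classic); last first.
  by apply/seteqP; split=> x /=; rewrite in_itv.
rewrite integral_cst//= mul1e.
by rewrite lebesgue_measure_itv/= lte_fin; case: ltgtP ab => //= ->; rewrite subrr.
Qed.

(** The map z |-> c z / (1 + (c - 1) z) is the action on the segment z = x / (x + y)
    of the linear map (x, y) |-> (c x, y) of the quadrant. Spread f over the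
    quadrant as a homogeneous function cut off at x + y < 1, rescale x by c
    there, and read the result in polar coordinates on both sides. *)
Lemma ge0_integral_projective (c : R) (f : R -> \bar R) : (0 < c)%R ->
  measurable_fun setT f -> (forall z, 0 <= f z) ->
  \int[mu]_z (if (0 < z)%R && (z < 1)%R then f z else 0) =
  \int[mu]_z (if (0 < z)%R && (z < 1)%R then
     (c / (1 + (c - 1) * z) ^+ 2)%:E * f (c * z / (1 + (c - 1) * z))%R else 0).
Proof.
move=> c0 mf f0.
pose G (z : R * R) : \bar R :=
  if (0 < z.1 + z.2)%R && (z.1 + z.2 < 1)%R then
    ((z.1 + z.2)^-1)%:E * f (z.1 / (z.1 + z.2))%R else 0.
have mG : measurable_fun setT G by rewrite /G; meas.
have G0 z : 0 <= G z.
  by rewrite /G; case: ifP => // /andP[z0 _]; rewrite mule_ge0// lee_fin invr_ge0 ltW.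
have D0 z : (0 < z)%R -> (z < 1)%R -> (0 < 1 + (c - 1) * z)%R.
  by move=> z0 z1; nra.
transitivity (\int[mu]_x \int[mu]_y
    (if (0 < x)%R && (0 < y)%R then G (x, y) else 0)).
  rewrite ge0_integral_quadrant_polar//; apply: eq_integral => z _.
  case: ifPn => [/andP[z0 z1]|_]; last first.
    by rewrite integral0_eq// => r _ /=; rewrite andbF.
  transitivity (\int[mu]_r (f z * (if (0 < r)%R && (r < 1)%R then 1 else 0))).
    rewrite ge0_integralZl//; first by rewrite integral_cst_oo// subr0 mule1.
    - by meas.
    - by move=> r _; case: ifP.
  apply: eq_integral => r _; rewrite andbT /G/=.
  rewrite (_ : r * z + r * (1 - z) = r)%R; last by ring.
  case: ltP => r0 /=; last by rewrite mule0.
  case: ifP => _; last by rewrite !mule0.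
  by rewrite muleA -EFinM divff ?gt_eqF// mul1e mulrAC divff ?gt_eqF// mul1r mule1.
transitivity (\int[mu]_x \int[mu]_y
    (if (0 < x)%R && (0 < y)%R then c%:E * G (c * x, y)%R else 0)).
  rewrite [LHS](ge0_integral_scale c0); first last.
  - by move=> x; apply: integral_ge0 => y _; case: ifP.
  - apply: (measurable_fun_fubini_tonelli_F (m2 := mu)
      (fun z : R * R => if (0 < z.1)%R && (0 < z.2)%R then G (z.1, z.2) else 0)).
    by meas.
    by move=> z; case: ifP.
  rewrite -ge0_integralZl_EFin//; first last.
  - exact: ltW.
  - apply: (measurable_fun_fubini_tonelli_F (m2 := mu)
      (fun z : R * R => if (0 < c * z.1)%R && (0 < z.2)%R then G (c * z.1, z.2)%R else 0)).
    by meas.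
    by move=> z; case: ifP.
  - by move=> x _; apply: integral_ge0 => y _; case: ifP.
  apply: eq_integral => x _; rewrite -ge0_integralZl_EFin//; first last.
  - exact: ltW.
  - by meas.
  - by move=> y _; case: ifP.
  by apply: eq_integral => y _; rewrite pmulr_rgt0//; case: ifP => //; rewrite mule0.
rewrite (ge0_integral_quadrant_polar (G := fun z => c%:E * G (c * z.1, z.2)%R)); first last.
- by move=> z; rewrite mule_ge0// lee_fin ltW.
- by meas.
apply: eq_integral => z _.
case: ifPn => [/andP[z0 z1]|_]; last first.
  by rewrite integral0_eq// => r _ /=; rewrite andbF.
have {D0} := D0 _ z0 z1; set D := (1 + _)%R => D0.
transitivity (\int[mu]_r ((c / D)%:E * f (c * z / D)%R *
    (if (0 < r)%R && (r < D^-1)%R then 1 else 0))).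
  apply: eq_integral => r _; rewrite andbT /G/=.
  rewrite (_ : c * (r * z) + r * (1 - z) = r * D)%R; last by rewrite /D; ring.
  case: ltP => r0 /=; last by rewrite mule0.
  rewrite mulr_gt0//= -[(D^-1)%R]mul1r ltr_pdivlMr//.
  case: ifP => _; last by rewrite !mule0.
  rewrite mule1 !muleA -!EFinM; congr (_%:E * f _); field;
    by rewrite ?gt_eqF ?r0 ?D0.
rewrite ge0_integralZl//; first last.
- by rewrite mule_ge0// lee_fin divr_ge0// ltW.
- by move=> r _; case: ifP.
- by meas.
rewrite integral_cst_oo ?invr_ge0 ?ltW// subr0 muleAC -EFinM.
by congr (_%:E * _); field; rewrite gt_eqF.
Qed.

End Projective.

(** * Changes of variable for signed functions *)

Section Reflection.
Context {R : realType}.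
Notation mu := (@lebesgue_measure R).

Lemma ge0_integral_onem (f : R -> \bar R) :
  measurable_fun [set: R] f -> (forall x, (0 <= f x)%E) ->
  (\int[mu]_x f x = \int[mu]_x f (1 - x)%R)%E.
Proof.
move=> mf f0; rewrite (ge0_integral_translate 1 mf f0).
have mg : measurable_fun [set: R] (fun x => f (x + 1)) by meas.
transitivity (\int[pushforward mu (-%R : _ -> measurableTypeR R)]_x f (x + 1)%R)%E.
  by apply: eq_measure_integral => A mA _; exact/esym/lebesgue_measureN.
rewrite ge0_integral_pushforward//=.
by apply: eq_integral => x _ /=; rewrite addrC.
Qed.

Lemma integral_onem (f : R -> R) : measurable_fun [set: R] f ->
  (\int[mu]_x (f x)%:E = \int[mu]_x (f (1 - x))%:E)%E.
Proof.
move=> mf; have mf' : measurable_fun setT (EFin \o f) by apply/measurable_EFinP.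
rewrite integralE [RHS]integralE; congr (_ - _)%E.
  rewrite ge0_integral_onem//; last exact: measurable_funepos.
  by apply: eq_integral => x _; rewrite !funeposE.
rewrite ge0_integral_onem//; last exact: measurable_funeneg.
by apply: eq_integral => x _; rewrite !funenegE.
Qed.

End Reflection.

Section SignedAffine.
Context {R : realType}.
Notation mu := (@lebesgue_measure R).

Lemma integral_affine_eq0 (c d : R) (f : R -> R) : 0 < c ->
  measurable_fun setT f ->
  mu.-integrable setT (fun x => (f (c * x + d))%:E) ->
  (\int[mu]_x (f (c * x + d))%:E = 0)%E ->
  mu.-integrable setT (EFin \o f) /\ (\int[mu]_x (f x)%:E = 0)%E.
Proof.
move=> c0 mf intf f0.
have mf' : measurable_fun setT (EFin \o f) by apply/measurable_EFinP.
split.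
  apply/integrableP; split => //.
  rewrite (ge0_integral_affine d c0); last 2 first.
  - exact: measurableT_comp.
  - by move=> x; exact: abse_ge0.
  by case/integrableP : intf => _ h; rewrite lte_mul_pinfty// lee_fin ltW.
have finp := integrable_fin_num measurableT (integrable_funepos measurableT intf).
have finn := integrable_fin_num measurableT (integrable_funeneg measurableT intf).
have e0 := f0; rewrite integralE -(fineK finp) -(fineK finn) -EFinB in e0.
have {e0} /= /subr0_eq e0 := congr1 fine e0.
have e := congr1 EFin e0; rewrite !fineK// in e.
rewrite integralE (ge0_integral_affine d c0); last 2 first.
- exact: measurable_funepos.
- by [].
rewrite [X in (_ - X)%E](ge0_integral_affine d c0); last 2 first.
- exact: measurable_funeneg.
- by [].
have -> : (\int[mu]_x (fun x => (f x)%:E)^\+ (c * x + d)%R =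
   \int[mu]_x (fun x => (f (c * x + d))%:E)^\+ x)%E.
  by apply: eq_integral => x _; rewrite !funeposE.
have -> : (\int[mu]_x (fun x => (f x)%:E)^\- (c * x + d)%R =
   \int[mu]_x (fun x => (f (c * x + d))%:E)^\- x)%E.
  by apply: eq_integral => x _; rewrite !funenegE.
rewrite e subee// fin_numM//; exact: finn.
Qed.

End SignedAffine.

(** * Projective changes of variable on the triangle *)

Section Simplex.
Context {R : realType}.
Notation mu := (@lebesgue_measure R).
Local Open Scope ereal_scope.

Lemma ge0_integral_prod (F : R * R -> \bar R) :
  measurable_fun setT F -> (forall z, 0 <= F z) ->
  \int[mu \x mu]_z F z = \int[mu]_x \int[mu]_y F (x, y).
Proof. by move=> mF F0; exact: (@fubini_tonelli1 _ _ _ _ R mu mu F mF F0). Qed.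

Definition simplex : set (R * R) :=
  [set z | [&& 0 < z.1, 0 < z.2 & z.1 + z.2 < 1]%R].

Lemma measurable_simplex : measurable simplex.
Proof.
rewrite -[simplex]setTI (_ : setT `&` simplex = setT `&` (fun z : R * R =>
  [&& 0 < z.1, 0 < z.2 & z.1 + z.2 < 1]%R) @^-1` [set true]); last first.
  by rewrite !setTI; apply/seteqP; split.
have : measurable_fun [set: R * R] (fun z : R * R =>
  [&& 0 < z.1, 0 < z.2 & z.1 + z.2 < 1]%R) by meas.
by move=> /(_ measurableT [set true]); apply.
Qed.

(** The simplex is the image of the open unit square under
    (x, t) |-> (x, (1 - x) t). *)
Lemma ge0_integral_simplex_square (f : R * R -> \bar R) :
  measurable_fun setT f -> (forall z, 0 <= f z) ->
  \int[mu \x mu]_(z in simplex) f z =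
  \int[mu]_x \int[mu]_t (if [&& 0 < x, x < 1, 0 < t & t < 1]%R
    then (1 - x)%:E * f (x, (1 - x) * t)%R else 0).
Proof.
move=> mf f0.
rewrite (integral_guard (mu \x mu)%E
  (fun z => [&& 0 < z.1, 0 < z.2 & z.1 + z.2 < 1]%R)) ge0_integral_prod; first last.
- by move=> z; case: ifP.
- by meas.
apply: eq_integral => x _ /=.
case: (ltP 0%R x) => x0 /=; last by rewrite !integral0_eq.
case: (ltP x 1%R) => x1 /=; last first.
  rewrite !integral0_eq// => y _; case: ifP => // /andP[y0].
  by rewrite ltNge (le_trans x1)// lerDl ltW.
have x1' : (0 < 1 - x)%R by rewrite subr_gt0.
rewrite (ge0_integral_scale x1'); first last.
- by move=> y; case: ifP.
- by meas.
rewrite -ge0_integralZl_EFin//; first last.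
- exact: ltW.
- by meas.
- by move=> y _; case: ifP.
apply: eq_integral => t _; rewrite pmulr_rgt0//.
rewrite (_ : (x + (1 - x) * t < 1)%R = (t < 1)%R); last first.
  by rewrite addrC -ltrBrDr gtr_pMr.
by case: ifP => _; rewrite ?mule0.
Qed.

(** The projective map multiplying the homogeneous coordinates
    [1 - z1 - z2 : z1 : z2] by (1, c1, c2). It fixes the three vertices of the
    simplex. *)
Definition simplex_rescale (c1 c2 : R) (z : R * R) : R * R :=
  let D := (1 + (c1 - 1) * z.1 + (c2 - 1) * z.2)%R in
  (c1 * z.1 / D, c2 * z.2 / D)%R.

Definition simplex_jacobian (c1 c2 : R) (z : R * R) : R :=
  (c1 * c2 / (1 + (c1 - 1) * z.1 + (c2 - 1) * z.2) ^+ 3)%R.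

(** In the coordinates (x, t) of the unit square the map is a composition of
    two projective maps of the line: one in t with factor c2, then, for each
    fixed t, one in x with factor c1 / (1 + (c2 - 1) t). *)
Lemma ge0_integral_simplex_rescale (c1 c2 : R) (f : R * R -> \bar R) :
  (0 < c1)%R -> (0 < c2)%R ->
  measurable_fun setT f -> (forall z, 0 <= f z) ->
  \int[mu \x mu]_(z in simplex) f z =
  \int[mu \x mu]_(z in simplex)
    (`|simplex_jacobian c1 c2 z|%:E * f (simplex_rescale c1 c2 z)).
Proof.
move=> c10 c20 mf f0.
have mr : measurable_fun setT (simplex_rescale c1 c2).
  by rewrite /simplex_rescale /=; meas.
have mj : measurable_fun setT (fun z => `|simplex_jacobian c1 c2 z|%R).
  by rewrite /simplex_jacobian; meas.
rewrite (ge0_integral_simplex_square mf f0) ge0_integral_simplex_square; first last.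
- by move=> z; rewrite mule_ge0.
- by meas.
(* The weight of the map in t; the factor of the map in x is c1 / e t. *)
pose q (t : R) := ((0 < t)%R && (t < 1)%R).
pose e (t : R) := (1 + (c2 - 1) * t)%R.
have e0 t : q t -> (0 < e t)%R by move=> /andP[? ?]; rewrite /e; nra.
transitivity (\int[mu]_x \int[mu]_t (if q t then (if q x then
  (c2 / e t ^+ 2)%:E * ((1 - x)%:E * f (x, (1 - x) * (c2 * t / e t))%R)
  else 0) else 0)).
  apply: eq_integral => x _.
  transitivity (\int[mu]_t (if q t then (if q x then
    `|(1 - x)|%:E * f (x, (1 - x) * t)%R else 0) else 0)).
    apply: eq_integral => t _; rewrite /q; case: (0 < x)%R => /=; case: ltP => //= x1;
    case: ifP => // _; by rewrite ger0_norm// subr_ge0 ltW.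
  rewrite (ge0_integral_projective c20); first last.
  - by move=> t; case: ifP => // _; rewrite mule_ge0.
  - by case: (q x); meas.
  apply: eq_integral => t _; rewrite -/(q t) -/(e t).
  case: ifP => // _; case: ifP; last by rewrite mule0.
  by move=> /andP[_ x1]; rewrite ger0_norm// subr_ge0 ltW.
rewrite ge0_integral_swap; first last.
- move=> x t; case: ifP => // qt; case: ifP => // /andP[_ x1].
  rewrite !mule_ge0// lee_fin ?subr_ge0 ?(ltW x1)//.
  by rewrite divr_ge0 ?exprn_ge0// ltW// e0.
- by rewrite /q /e; meas.
rewrite [RHS](ge0_integral_swap (F := fun x t => if [&& 0 < x, x < 1, 0 < t & t < 1]%R
    then (1 - x)%:E * (`|simplex_jacobian c1 c2 (x, (1 - x) * t)%R|%:E *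
      f (simplex_rescale c1 c2 (x, (1 - x) * t)%R)) else 0)); first last.
- move=> x t; case: ifP => // /and4P[_ x1 _ _].
  by rewrite !mule_ge0// lee_fin subr_ge0 ltW.
- by rewrite /simplex_rescale /simplex_jacobian /=; meas.
apply: eq_integral => t _.
have [qt|qt] := boolP (q t); last first.
  rewrite !integral0_eq// => x _; case: ifP => // /and4P[_ _ t0 t1].
  by move: qt; rewrite /q t0 t1.
have {}e0 := e0 _ qt.
pose k := (c1 / e t)%R.
have k0 : (0 < k)%R by rewrite divr_gt0.
transitivity (\int[mu]_x (if (0 < x)%R && (x < 1)%R then
  (c2 / e t ^+ 2)%:E * (`|(1 - x)|%:E * f (x, (1 - x) * (c2 * t / e t))%R)
  else 0)).
  apply: eq_integral => x _; rewrite /q; case: ifP => // /andP[_ x1].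
  by rewrite ger0_norm// subr_ge0 ltW.
rewrite (ge0_integral_projective k0); first last.
- by move=> x; rewrite !mule_ge0// lee_fin divr_ge0 ?exprn_ge0// ltW.
- by meas.
move: (qt) => /andP[t0 t1].
apply: eq_integral => x _; rewrite t0 t1 /= andbT.
case: ifP => // /andP[x0 x1].
have D0 : (0 < 1 + (c1 - 1) * x + (c2 - 1) * ((1 - x) * t))%R.
  by rewrite [X in (0 < X)%R](_ : _ = (1 - x) * e t + c1 * x)%R;
    [rewrite addr_gt0// mulr_gt0// subr_gt0|rewrite /e; ring].
set D := (1 + (c1 - 1) * x + (c2 - 1) * ((1 - x) * t))%R in D0 *.
have DE : (1 + (k - 1) * x = D / e t)%R.
  by rewrite /k /D /e; field; rewrite gt_eqF.
rewrite DE /simplex_jacobian /simplex_rescale /= -/D.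
have E1 : (k * x / (D / e t) = c1 * x / D)%R.
  by rewrite /k; field; rewrite !gt_eqF.
have E2 : (1 - c1 * x / D = (1 - x) * e t / D)%R.
  by rewrite /D /e; field; rewrite -/D gt_eqF.
rewrite E1 E2.
have -> : ((1 - x) * e t / D * (c2 * t / e t) = c2 * ((1 - x) * t) / D)%R.
  by field; rewrite !gt_eqF.
have x1' : (0 < 1 - x)%R by rewrite subr_gt0.
rewrite !ger0_norm; first last.
- by rewrite !mulr_ge0// ?invr_ge0 ltW.
- by rewrite !mulr_ge0// ?invr_ge0 ?exprn_ge0// ltW.
rewrite !muleA -!EFinM; congr (_%:E * _).
by rewrite /k; field; rewrite !gt_eqF.
Qed.

Lemma integral_simplex_rescale (c1 c2 : R) (f : R * R -> R) :
  (0 < c1)%R -> (0 < c2)%R -> measurable_fun setT f ->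
  \int[mu \x mu]_(z in simplex) (f z)%:E =
  \int[mu \x mu]_(z in simplex)
    (`|simplex_jacobian c1 c2 z| * f (simplex_rescale c1 c2 z))%:E.
Proof.
move=> c10 c20 mf; rewrite integralE [RHS]integralE.
have mf' : measurable_fun setT (EFin \o f) by apply/measurable_EFinP.
congr (_ - _).
  rewrite (ge0_integral_simplex_rescale c10 c20)//; last exact: measurable_funepos.
  apply: eq_integral => z _; rewrite !funeposE /= -!EFin_max -EFinM; congr EFin.
  by rewrite maxr_pMr// mulr0.
rewrite (ge0_integral_simplex_rescale c10 c20)//; last exact: measurable_funeneg.
apply: eq_integral => z _; rewrite !funenegE /= -!EFin_max -EFinM.
by congr EFin; rewrite maxr_pMr// mulr0 mulrN.
Qed.

End Simplex.

(** * Improper integrals and a majorant on the triangle *)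

Section ImproperFTC.
Context {R : realType}.
Notation mu := (@lebesgue_measure R).

Lemma is_derive_FTC2 (f F : R -> R) (a b : R) : a < b ->
  (forall x, a <= x <= b -> {for x, continuous f}) ->
  (forall x, a <= x <= b -> is_derive x 1 F (f x)) ->
  (\int[mu]_(x in `[a, b]) (f x)%:E = (F b - F a)%:E)%E.
Proof.
move=> ab cf dF.
have cF x : a <= x <= b -> {for x, continuous F}.
  by move=> /dF [df _]; exact/differentiable_continuous/derivable1_diffP.
rewrite (@continuous_FTC2 _ f F)//.
- apply: continuous_in_subspaceT => x; rewrite inE/= in_itv/=; exact: cf.
- split.
  + by move=> x; rewrite in_itv/= => /andP[ax xb]; have [] := dF x _;
      rewrite ?(ltW ax) ?(ltW xb).
  + by apply: cvg_at_right_filter; apply: cF; rewrite lexx ltW.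
  + by apply: cvg_at_left_filter; apply: cF; rewrite lexx ltW.
- move=> x; rewrite in_itv/= => /andP[ax xb].
  have Fx := dF x; rewrite derive1E; apply: derive_val.
  by apply: Fx; rewrite !ltW.
Qed.

(** Exhausting ]a, b[ by compact intervals; f may be unbounded at the
    endpoints. *)
Lemma ge0_FTC2_open (f F : R -> R) (a b : R) : a < b ->
  (forall x, a < x < b -> 0 <= f x) ->
  (forall x, a < x < b -> {for x, continuous f}) ->
  (forall x, a < x < b -> is_derive x 1 F (f x)) ->
  F x @[x --> a^'+] --> F a -> F x @[x --> b^'-] --> F b ->
  (\int[mu]_(x in `]a, b[) (f x)%:E = (F b - F a)%:E)%E.
Proof.
move=> ab f0 cf dF Fa Fb.
(* A third of the length at most, so that [a + d n, b - d n] is nonempty. *)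
pose d n : R := (b - a) / 3 * n.+1%:R^-1.
have d0 n : 0 < d n by rewrite mulr_gt0// divr_gt0// subr_gt0.
have d1 n : d n <= (b - a) / 3.
  by rewrite ler_piMr ?divr_ge0 ?subr_ge0 ?(ltW ab)// invf_le1// ler1n.
have dcvg : d @ \oo --> 0.
  rewrite -[X in _ --> X](mulr0 ((b - a) / 3)); apply: cvgMr.
  exact: cvg_harmonic.
pose I n := `[a + d n, b - d n]%classic.
have Iab n x : a + d n <= x <= b - d n -> a < x < b.
  by have := d0 n; move=> dn /andP[? ?]; lra.
have mI n : measurable (I n) by exact: measurable_itv.
have If n : (\int[mu]_(x in I n) (f x)%:E = (F (b - d n) - F (a + d n))%:E)%E.
  apply: is_derive_FTC2.
  - by have := d1 n; lra.
  - by move=> x /Iab; exact: cf.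
  - by move=> x /Iab; exact: dF.
have UI : \bigcup_n I n = `]a, b[%classic.
  apply/seteqP; split=> [x [n _] /=|x /=]; rewrite !in_itv/=; first exact: Iab.
  move=> /andP[ax xb].
  have m0 : 0 < Num.min (x - a) (b - x) by rewrite lt_min !subr_gt0 ax.
  have [N _ /(_ N (leqnn N))] := cvgr_lt _ dcvg _ m0.
  rewrite /= lt_min => /andP[h1 h2]; exists N => //.
  by rewrite /I /= in_itv/=; lra.
rewrite -UI.
apply: (@cvg_unique _ _ ((fun n => \int[mu]_(x in I n) (f x)%:E)%E @ \oo)).
- exact: ereal_hausdorff.
- apply: ge0_nondecreasing_set_cvg_integral => //.
  + move=> m n mn; rewrite subsetEset => x; rewrite /I /= !in_itv/=.
    have : d n <= d m.
      rewrite ler_pM2l ?divr_gt0 ?subr_gt0// lef_pV2 ?posrE ?ltr0n//.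
      by rewrite ler_nat.
    lra.
  + move=> n; apply/measurable_EFinP.
    apply: (measurable_funS (measurable_itv `]a, b[)).
      by move=> x; rewrite /I /= !in_itv/=; exact: Iab.
    apply: open_continuous_measurable_fun; first exact: interval_open.
    by move=> x; rewrite inE/= in_itv/= => /cf.
  + by move=> n x; rewrite /I /= in_itv/= => /Iab/f0; rewrite lee_fin.
- rewrite (_ : (fun n => _) = (fun n => (F (b - d n) - F (a + d n))%:E)); last first.
    by apply/funext.
  apply: cvg_EFin; first exact: nearW.
  apply: cvgB.
  + apply: (cvg_at_leftP _ _ _).1 Fb _ _; split; first by move=> n; rewrite gtrBl.
    by rewrite -[X in _ --> X]subr0; apply: cvgB => //; exact: cvg_cst.
  + apply: (cvg_at_rightP _ _ _).1 Fa _ _; split; first by move=> n; rewrite ltrDl.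
    by rewrite -[X in _ --> X]addr0; apply: cvgD => //; exact: cvg_cst.
Qed.

End ImproperFTC.

Section SimplexMajorant.
Context {R : realType}.
Notation mu := (@lebesgue_measure R).

Lemma ler_powR_opp (p x y : R) : 0 <= p -> 0 < x -> x <= y ->
  y `^ (- p) <= x `^ (- p).
Proof.
move=> p0 x0 xy; rewrite !powRN lef_pV2 ?posrE ?powR_gt0//; last first.
  exact: lt_le_trans xy.
by rewrite ge0_ler_powR// ?nnegrE ?ltW// (lt_le_trans x0).
Qed.

(** A one-variable majorant with integrable singularities at both ends, in
    which the majorant on the simplex separates. *)
Definition psi (x : R) : R := x `^ (- (3 / 4)) + (1 - x) `^ (- (3 / 4)).

Lemma psi_ge0 x : 0 <= psi x.
Proof. by rewrite addr_ge0// powR_ge0. Qed.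

Lemma measurable_psi : measurable_fun [set: R] psi.
Proof.
apply: measurable_funD; first exact: measurable_powR.
by apply: (measurableT_comp (measurable_powR (R := R) (- (3 / 4)))); meas.
Qed.

Let onem_at_left : (1 - x : R) @[x --> 1^'-] --> 0^'+.
Proof.
move=> A [e /= e0 eA]; exists e => //= x /=.
rewrite /ball_/= => xe x1; apply: eA; rewrite /= ?subr_gt0//.
by rewrite sub0r normrN.
Qed.

Lemma integral_psi : (\int[mu]_(x in `]0%R, 1%R[) (psi x)%:E = 8%:E)%E.
Proof.
pose G (x : R) : R := x `^ (1 / 4).
pose F (x : R) : R := 4 * (G x - G (1 - x)).
have d0 : 0 < 1 / 4 :> R by rewrite divr_gt0.
have c0 (p y : R) : 0 < y -> {for y, continuous (fun x : R => x `^ p : R)}.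
  move=> y0; apply/differentiable_continuous/derivable1_diffP.
  by apply: derivable_powR; rewrite in_itv/= y0.
have cN (x : R) : {for x, continuous (fun x : R => 1 - x)}.
  by apply: cvgB; [exact: cvg_cst|exact: cvg_id].
have cNp (p x : R) : x < 1 -> {for x, continuous (fun x : R => (1 - x) `^ p : R)}.
  move=> x1; apply: (@continuous_comp _ _ _ (fun x : R => 1 - x) (fun x => x `^ p)).
    exact: cN.
  by apply: c0; rewrite subr_gt0.
have G0 : G x @[x --> 0^'+] --> G 0.
  by rewrite /G powR0 ?gt_eqF//; exact: powR_cvg0.
rewrite (_ : 8%:E = (F 1 - F 0)%:E)%E; last first.
  by rewrite /F /G subrr subr0 powR1 powR0 ?gt_eqF//; congr EFin; ring.
apply: ge0_FTC2_open; first exact: ltr01.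
- by move=> x _; exact: psi_ge0.
- by move=> x /andP[x0 x1]; apply: cvgD; [exact: c0|exact: cNp].
- move=> x /andP[x0 x1].
  have h1 : is_derive x 1 G (1 / 4 * x `^ (1 / 4 - 1)) by exact: is_derive1_powR.
  have h2 : is_derive x 1 (G \o (fun x : R => 1 - x))
      (1 / 4 * (1 - x) `^ (1 / 4 - 1) * (0 - 1)).
    apply: is_derive1_comp.
    by apply: is_derive1_powR; rewrite subr_gt0.
  have -> : psi x = 4 *: (1 / 4 * x `^ (1 / 4 - 1) -
      (1 / 4 * (1 - x) `^ (1 / 4 - 1) * (0 - 1))) :> R.
    rewrite /psi (_ : 1 / 4 - 1 = - (3 / 4) :> R); last by lra.
    by rewrite -[4 *: _]/(4 * _); field.
  exact: is_deriveZ (is_deriveB h1 h2).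
- apply: cvgMr; apply: cvgB => //.
  by apply: cvg_at_right_filter; exact: cNp.
- apply: cvgMr; apply: cvgB; first exact/cvg_at_left_filter/c0.
  by rewrite subrr; apply: cvg_comp G0; exact: onem_at_left.
Qed.

Lemma integrable_psi : mu.-integrable `]0%R, 1%R[ (EFin \o psi).
Proof.
apply/integrableP; split; first by apply/measurable_EFinP; apply: measurable_funTS; exact: measurable_psi.
under eq_integral do rewrite /= ger0_norm ?psi_ge0//.
by rewrite integral_psi ltry.
Qed.

Lemma powR_le_psi (x : R) : 0 < x < 1 -> (x * (1 - x)) `^ (- (3 / 4)) <= 2 * psi x.
Proof.
move=> /andP[x0 x1]; have x1' : 0 < 1 - x by rewrite subr_gt0.
have h : (1 / 2 : R) `^ (- (3 / 4)) <= 2.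
  rewrite [leRHS](_ : _ = (1 / 2) `^ (- 1)); last by rewrite powR_inv1 ?div1r ?invrK// invr_ge0.
  by rewrite ger_powR//; lra.
rewrite (powRM _ (ltW x0) (ltW x1')) /psi mulrDr.
have [xh|xh] := leP (1 / 2) x.
  rewrite ler_wpDl//; first by rewrite mulr_ge0// powR_ge0.
  rewrite ler_wpM2r ?powR_ge0//; apply: le_trans h.
  by apply: ler_powR_opp.
rewrite ler_wpDr//; first by rewrite mulr_ge0// powR_ge0.
rewrite mulrC ler_wpM2r ?powR_ge0//; apply: le_trans h.
by apply: ler_powR_opp => //; lra.
Qed.

(** The second elementary symmetric polynomial of the barycentric coordinates
    z1, z2, 1 - z1 - z2. It is comparable to 1 - |y|^2 at the point y of an
    inscribed triangle with these coordinates. *)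
Definition bary_e2 (z : R * R) : R := z.1 * z.2 + (z.1 + z.2) * (1 - z.1 - z.2).

Lemma measurable_bary_e2 : measurable_fun setT bary_e2.
Proof. by rewrite /bary_e2; meas. Qed.

(** With y = (1 - x) t and q = t (1 - t), the polynomial is (1 - x) s where
    s = x + (1 - x) q, and x q <= s^2 because q <= 1/2. The power -3/2 of
    s is thus at most the power -3/4 of x q, which separates x from t. *)
Lemma bary_e2_powR_square (x t : R) : 0 < x < 1 -> 0 < t < 1 ->
  (1 - x) * bary_e2 (x, (1 - x) * t) `^ (- (3 / 2)) <= 4 * psi x * psi t.
Proof.
move=> x01 t01; move: (x01) (t01) => /andP[x0 x1] /andP[t0 t1].
have r0 : 0 < 1 - x by rewrite subr_gt0.
pose q := t * (1 - t).
have q0 : 0 < q by rewrite mulr_gt0// subr_gt0.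
have q2 : q <= 1 / 2 by rewrite /q; nra.
pose s := x + (1 - x) * q.
have s0 : 0 < s by rewrite addr_gt0// mulr_gt0.
have -> : bary_e2 (x, (1 - x) * t) = (1 - x) * s by rewrite /bary_e2 /s /q /=; ring.
have s2 : x * q <= s ^+ 2.
  rewrite /s; have h : 0 <= (1 - x) ^+ 2 * q ^+ 2 by rewrite mulr_ge0// sqr_ge0.
  have h' : 0 <= x ^+ 2 * (1 / 2 - q) by rewrite mulr_ge0 ?sqr_ge0// subr_ge0.
  have h2 : 0 <= x * q by rewrite mulr_ge0// ltW.
  rewrite -subr_ge0 [leRHS](_ : _ = 2 * (x ^+ 2 * (1 / 2 - q)) + x * q +
    (1 - x) ^+ 2 * q ^+ 2); last by field.
  by rewrite !addr_ge0// mulr_ge0.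
have s32 : s `^ (- (3 / 2)) <= (x * q) `^ (- (3 / 4)).
  rewrite (_ : s `^ (- (3 / 2)) = (s ^+ 2) `^ (- (3 / 4))).
    by apply: ler_powR_opp => //; rewrite mulr_gt0.
  rewrite -powR_mulrn ?ltW// -powRrM; congr (_ `^ _); lra.
have r32 : (1 - x) * (1 - x) `^ (- (3 / 2)) <= (1 - x) `^ (- (3 / 4)).
  rewrite -{1}(powRr1 (ltW r0)) -powRD; last by rewrite (gt_eqF r0) implybT.
  have h01 : 0 < 1 - x <= 1 by rewrite r0 /=; lra.
  by apply: (ger_powR h01); lra.
rewrite (powRM _ (ltW r0) (ltW s0)) mulrA.
apply: (@le_trans _ _ ((1 - x) `^ (- (3 / 4)) * (x * q) `^ (- (3 / 4)))).
  by rewrite ler_pM// ?mulr_ge0 ?powR_ge0// ltW.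
rewrite (powRM _ (ltW x0) (ltW q0)) mulrA.
rewrite [_ `^ _ * x `^ _]mulrC -(powRM _ (ltW x0) (ltW r0)).
rewrite (_ : 4 * _ * _ = (2 * psi x) * (2 * psi t)); last by ring.
by rewrite ler_pM ?powR_ge0// powR_le_psi.
Qed.

Lemma integrable_bary_e2_powR :
  (mu \x mu)%E.-integrable simplex (fun z => (bary_e2 z `^ (- (3 / 2)))%:E).
Proof.
have mf : measurable_fun setT (fun z : R * R => (bary_e2 z `^ (- (3 / 2)))%:E).
  apply/measurable_EFinP.
  exact: (measurableT_comp (measurable_powR (R := R) _) measurable_bary_e2).
have mf' : measurable_fun setT (fun z : R * R => bary_e2 z `^ (- (3 / 2))).
  exact/measurable_EFinP.
apply/integrableP; split; first exact: measurable_funTS.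
under eq_integral do rewrite /= ger0_norm ?powR_ge0//.
rewrite ge0_integral_simplex_square//; last by move=> z; rewrite lee_fin powR_ge0.
pose q (x : R) := (0 < x) && (x < 1).
have mq : measurable_fun setT q by rewrite /q; meas.
have mp := measurable_psi.
have Ipsi : (\int[mu]_x (if q x then (psi x)%:E else 0) = 8%:E)%E.
  rewrite -integral_guard (_ : [set x | q x] = `]0, 1[%classic) ?integral_psi//.
apply: (@le_lt_trans _ _ (\int[mu]_x (32%:E * (if q x then (psi x)%:E else 0)))%E);
  last first.
  rewrite ge0_integralZl_EFin//; first by rewrite Ipsi -EFinM ltry.
  - by move=> x _; case: ifP => // _; rewrite lee_fin psi_ge0.
  - by meas.
apply: ge0_le_integral => //.
- move=> x _; apply: integral_ge0 => t _; case: ifP => // /and4P[x0 x1 _ _].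
  by rewrite mule_ge0// lee_fin ?powR_ge0// subr_ge0 ltW.
- apply: (measurable_fun_fubini_tonelli_F (m2 := mu) (fun z : R * R =>
    if [&& 0 < z.1, z.1 < 1, 0 < z.2 & z.2 < 1] then
    ((1 - z.1)%:E * (bary_e2 (z.1, (1 - z.1) * z.2) `^ (- (3 / 2)))%:E)%E else 0%E)).
    by meas; apply: (measurableT_comp mf' ); meas.
  by move=> z; case: ifP => // /and4P[_ x1 _ _]; rewrite mule_ge0// lee_fin ?powR_ge0// subr_ge0 ltW.
- by meas.
- move=> x _; case: ifP => [x01|qx]; last first.
    by rewrite integral0_eq ?mule0// => t _; rewrite andbA -/(q x) qx.
  apply: (@le_trans _ _ (\int[mu]_t ((4 * psi x)%:E * (if q t then (psi t)%:E else 0)))%E).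
    apply: ge0_le_integral => //.
    - move=> t _; case: ifP => // _.
      by rewrite mule_ge0// lee_fin ?powR_ge0// subr_ge0 ltW//; case/andP: x01.
    - by meas; apply: (measurableT_comp mf'); meas.
    - by meas.
    - move=> t _; rewrite andbA -/(q x) -/(q t) x01 /=; case: ifP => t01; last by rewrite mule0.
      by rewrite -!EFinM lee_fin; exact: bary_e2_powR_square.
  rewrite ge0_integralZl_EFin//; first by rewrite Ipsi -!EFinM lee_fin; lra.
  - by move=> t _; case: ifP => // _; rewrite lee_fin psi_ge0.
  - by meas.
  - by rewrite mulr_ge0// psi_ge0.
Qed.

End SimplexMajorant.

(** * Abel's integral equation *)

Section Abel.
Context {R : realType}.
Notation mu := (@lebesgue_measure R).
Local Open Scope ereal_scope.

Lemma integral_oneDsqr_line :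
  \int[mu]_x ((1 + x ^+ 2)^-1)%:E = (pi : R)%:E.
Proof.
rewrite (ge0_symfun_integralT (f := fun x : R => (1 + x ^+ 2)^-1)%R); first last.
- by move=> x /=; rewrite sqrrN.
- exact: continuous_oneDsqrV.
- by move=> x; rewrite invr_ge0 addr_ge0// sqr_ge0.
rewrite -set_itvcy integral0y_oneDsqr -EFinM; congr EFin.
by rewrite mulrC divfK.
Qed.

(** Substituting s = x t and then scaling x by sqrt (1 + t^2) integrates the
    direction t = s / x against 1 / (1 + t^2), whose total mass is pi. This is
    integration in polar coordinates without angles. *)
Lemma ge0_integral_half_plane_polar (f : R -> \bar R) :
  measurable_fun setT f -> (forall x, 0 <= f x) ->
  \int[mu]_x \int[mu]_s (if (0 < x)%R then f (x ^+ 2 + s ^+ 2)%R else 0) =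
  (pi : R)%:E * \int[mu]_x (if (0 < x)%R then x%:E * f (x ^+ 2)%R else 0).
Proof.
move=> mf f0.
transitivity (\int[mu]_x \int[mu]_t (if (0 < x)%R then
    x%:E * f (x ^+ 2 * (1 + t ^+ 2))%R else 0)).
  apply: eq_integral => x _; have [x0|x0] := ltP 0%R x; last by rewrite !integral0_eq.
  rewrite (ge0_integral_scale x0)//; last by meas.
  rewrite -ge0_integralZl_EFin//; [|by meas|exact: ltW].
  by apply: eq_integral => t _; congr (_ * f _); ring.
rewrite ge0_integral_swap; first last.
- by move=> x t; case: ifP => // x0; rewrite mule_ge0// lee_fin ltW.
- by meas.
transitivity (\int[mu]_t (((1 + t ^+ 2)^-1)%:E *
    \int[mu]_x (if (0 < x)%R then x%:E * f (x ^+ 2)%R else 0))).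
  apply: eq_integral => t _.
  have t1 : (0 < 1 + t ^+ 2)%R by rewrite ltr_wpDr// sqr_ge0.
  pose q := Num.sqrt (1 + t ^+ 2)%R.
  have q0 : (0 < q)%R by rewrite sqrtr_gt0.
  have q2 : (q ^+ 2 = 1 + t ^+ 2)%R by rewrite sqr_sqrtr// ltW.
  rewrite [in RHS](ge0_integral_scale q0); last 2 first.
  - by meas.
  - by move=> x; case: ifP => // x0; rewrite mule_ge0// lee_fin ltW.
  rewrite muleA -EFinM -ge0_integralZl_EFin//; last 3 first.
  - by move=> x _; case: ifP => // x0; rewrite mule_ge0// lee_fin ltW.
  - by meas.
  - by rewrite mulr_ge0 ?invr_ge0 ?(ltW t1) ?(ltW q0).
  apply: eq_integral => x _; rewrite pmulr_rgt0//; case: ifP => _; last by rewrite mule0.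
  rewrite muleA -EFinM exprMn q2 [(x ^+ 2 * _)%R]mulrC; congr (_%:E * _).
  by rewrite mulrA -[(_ * q * q)%R]mulrA -expr2 q2 mulVf ?mul1r// gt_eqF.
rewrite ge0_integralZr//; first by rewrite integral_oneDsqr_line.
- by meas.
- by move=> t _; rewrite lee_fin invr_ge0 addr_ge0// sqr_ge0.
- by apply: integral_ge0 => x _; case: ifP => // x0; rewrite mule_ge0// lee_fin ltW.
Qed.

End Abel.

Section AbelInversion.
Context {R : realType}.
Notation mu := (@lebesgue_measure R).

Lemma is_derive_primitive (f : R -> R) (a b x : R) :
  mu.-integrable `[a, b] (EFin \o f) -> a < x < b -> {for x, continuous f} ->
  is_derive x 1 (fun x => \int[mu]_(t in `[a, x]) f t) (f x).
Proof.
move=> intf /andP[x0 xb] cf.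
have [dF F'] := @continuous_FTC1_closed R f a x b xb intf x0 cf.
by split; [exact: dF|rewrite -derive1E].
Qed.

Lemma integral_half_line_sqr (g : R -> R) (w : R) :
  mu.-integrable `[0, 1] (EFin \o g) ->
  (forall v : R, 0 < v < 1 -> {for v, continuous g}) ->
  (forall v, 0 <= g v) -> 0 < w < 1 ->
  (\int[mu]_x (if (0 < x)%R then
      x%:E * (if (x ^+ 2 < w)%R then g (w - x ^+ 2) else 0)%:E else 0) =
   (1 / 2 * \int[mu]_(t in `[0, w]) g t)%:E)%E.
Proof.
move=> intg cg g0 /andP[w0 w1].
pose W (x : R) : R := \int[mu]_(t in `[0, x]) g t.
pose q := Num.sqrt w.
have q0 : 0 < q by rewrite sqrtr_gt0.
have q2 : q ^+ 2 = w by rewrite sqr_sqrtr// ltW.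
have ltq (x : R) : 0 < x -> (x ^+ 2 < w) = (x < q).
  by move=> x0; rewrite -q2 ltr_pXn2r ?nnegrE// ltW.
pose F (x : R) : R := - (1 / 2) * W (w - x ^+ 2).
have W0 : W 0 = 0 by rewrite /W set_itv1 Rintegral_set1.
have cs (x : R) : {for x, continuous (fun x : R => w - x ^+ 2)}.
  by apply: cvgB; [exact: cvg_cst|exact: exprn_continuous].
have dW (y : R) : 0 < y < 1 -> is_derive y 1 W (g y).
  by move=> y01; apply: is_derive_primitive intg _ _ => //; exact: cg.
have cW (y : R) : 0 <= y < 1 -> {for y, continuous W}.
  move=> /andP[]; rewrite le_eqVlt => /predU1P[<- _|y0 y1].
    by rewrite /prop_for /continuous_at W0; apply: parameterized_integral_cvg_left intg.
  have [dWy _] := dW y (introT andP (conj y0 y1)).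
  exact/differentiable_continuous/derivable1_diffP.
have cF (x : R) : 0 <= x <= q -> {for x, continuous F}.
  move=> /andP[x0 xq].
  suff h : {for x, continuous (W \o (fun x : R => w - x ^+ 2))} by exact: cvgMr h.
  apply: continuous_comp; first exact: cs.
  apply: cW; rewrite subr_ge0 -q2 ler_pXn2r ?nnegrE ?(ltW q0)// xq /=.
  by rewrite q2 (le_lt_trans _ w1)// gerBl sqr_ge0.
transitivity (\int[mu]_(x in `]0%R, q[) (x * g (w - x ^+ 2))%R%:E)%E.
  rewrite (_ : `]0, q[%classic = [set x | (0 < x) && (x < q)]); last first.
    by apply/seteqP; split=> x /=; rewrite in_itv.
  rewrite integral_guard; apply: eq_integral => x _.
  have [x0|//] := ltP 0 x; rewrite ltq//.
  by case: ifP => _; rewrite ?mule0 ?EFinM.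
have -> : 1 / 2 * W w = F q - F 0.
  by rewrite /F q2 subrr W0 expr0n/= subr0; ring.
apply: ge0_FTC2_open; first exact: q0.
- by move=> x /andP[x0 xq]; rewrite mulr_ge0// ltW.
- move=> x /andP[x0 xq]; apply: cvgM; first exact: cvg_id.
  suff h : {for x, continuous (g \o (fun x : R => w - x ^+ 2))} by exact: h.
  apply: continuous_comp; first exact: cs.
  by apply: cg; rewrite subr_gt0 ltq// xq/= (le_lt_trans _ w1)// gerBl sqr_ge0.
- move=> x /andP[x0 xq].
  have xw : 0 < w - x ^+ 2 < 1.
    by rewrite subr_gt0 ltq// xq/= (le_lt_trans _ w1)// gerBl sqr_ge0.
  have dWx := dW _ xw.
  have d2 : is_derive x 1 (fun x : R => w - x ^+ 2) (0 - 2 * x).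
    apply: is_deriveB.
    by apply: is_derive_eq; rewrite -[_%:A]/(x * 1); ring.
  have -> : x * g (w - x ^+ 2) = - (1 / 2) *: (g (w - x ^+ 2) * (0 - 2 * x)) :> R.
    by rewrite -[_ *: _]/(_ * _); field.
  have h := @is_derive1_comp R W (fun x : R => w - x ^+ 2) x _ _ dWx d2.
  exact: (is_deriveZ (- (1 / 2) : R) h).
- by apply: cvg_at_right_filter; apply: cF; rewrite lexx ltW.
- by apply: cvg_at_left_filter; apply: cF; rewrite lexx ltW.
Qed.

(** Integrating once more the function s |-> g(c - s^2), with c = w - x^2, over
    x > 0 yields the integral over a half disc of the radial function
    g(w - x^2 - s^2). Thus an integral of Abel transforms of g is a plain
    primitive of g. *)
Lemma abel_half_plane (g : R -> R) (w : R) :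
  measurable_fun setT g ->
  mu.-integrable `[0, 1] (EFin \o g) ->
  (forall v : R, 0 < v < 1 -> {for v, continuous g}) ->
  (forall v, 0 <= g v) -> 0 < w < 1 ->
  (\int[mu]_x (if (0 < x)%R then (\int[mu]_s
      (if (s ^+ 2 < w - x ^+ 2)%R then g (w - x ^+ 2 - s ^+ 2) else 0)%:E) else 0) =
   (pi * (1 / 2 * \int[mu]_(t in `[0, w]) g t))%:E)%E.
Proof.
move=> mg intg cg g0 w01.
pose f (r : R) := (if (r < w)%R then g (w - r) else 0)%:E.
have mf : measurable_fun setT f by rewrite /f; meas.
have f0 r : (0 <= f r)%E by rewrite /f lee_fin; case: ifP.
rewrite EFinM -integral_half_line_sqr//.
rewrite -[RHS](ge0_integral_half_plane_polar mf f0).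
apply: eq_integral => x _; case: ifP => _; last by rewrite integral0_eq.
apply: eq_integral => s _; by rewrite /f ltrBrDl opprD addrA.
Qed.

(** The two sides of [abel_half_plane], for the positive and the negative part
    of m separately because that lemma concerns nonnegative functions, show
    that both parts have the same primitive, hence that they are equal. *)
Lemma abel_injective (m : R -> R) :
  measurable_fun setT m ->
  mu.-integrable `[0, 1] (EFin \o m) ->
  (forall v : R, 0 < v < 1 -> {for v, continuous m}) ->
  (forall c, 0 < c < 1 ->
     mu.-integrable setT (fun s => (if s ^+ 2 < c then m (c - s ^+ 2) else 0)%:E) /\
     (\int[mu]_s (if s ^+ 2 < c then m (c - s ^+ 2) else 0)%:E = 0)%E) ->
  forall v, 0 < v < 1 -> m v = 0.
Proof.
move=> mm intm cm Hc.
pose P (v : R) : R := Num.max (m v) 0.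
pose N (v : R) : R := Num.max (- m v) 0.
have mP : measurable_fun setT P by exact: measurable_funrpos.
have mN : measurable_fun setT N by exact: measurable_funrneg.
have P0 v : 0 <= P v by rewrite le_max lexx orbT.
have N0 v : 0 <= N v by rewrite le_max lexx orbT.
have intP : mu.-integrable `[0, 1] (EFin \o P).
  rewrite (_ : EFin \o P = (EFin \o m)^\+%E); first exact: integrable_funepos.
  by apply/funext => v; rewrite funeposE /= -EFin_max.
have intN : mu.-integrable `[0, 1] (EFin \o N).
  rewrite (_ : EFin \o N = (EFin \o m)^\-%E); first exact: integrable_funeneg.
  by apply/funext => v; rewrite funenegE /= -EFin_max.
have cP (v : R) : 0 < v < 1 -> {for v, continuous P}.
  by move=> /cm cmv; apply: continuous_max => //; exact: cvg_cst.
have cN (v : R) : 0 < v < 1 -> {for v, continuous N}.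
  by move=> /cm cmv; apply: continuous_max; [exact: cvgN|exact: cvg_cst].
have PN c : 0 < c < 1 ->
    (\int[mu]_s (if s ^+ 2 < c then P (c - s ^+ 2) else 0)%:E =
     \int[mu]_s (if s ^+ 2 < c then N (c - s ^+ 2) else 0)%:E)%E.
  move=> /Hc[intc e0].
  have finp := integrable_fin_num measurableT (integrable_funepos measurableT intc).
  have finn := integrable_fin_num measurableT (integrable_funeneg measurableT intc).
  move: e0; rewrite integralE -(fineK finp) -(fineK finn) -EFinB.
  move=> e0; have {e0} /= /subr0_eq e0 := congr1 fine e0.
  have e := congr1 EFin e0; rewrite !fineK// in e.
  transitivity (\int[mu]_s (fun s => (if s ^+ 2 < c then m (c - s ^+ 2) else 0)%:E)^\+ s)%E.
    apply: eq_integral => s _; rewrite funeposE -EFin_max; congr EFin.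
    by case: ifP => //; rewrite maxxx.
  rewrite e; apply: eq_integral => s _; rewrite funenegE -EFinN -EFin_max; congr EFin.
  by case: ifP => //; rewrite oppr0 maxxx.
have WPN w : 0 < w < 1 ->
    \int[mu]_(t in `[0, w]) P t = \int[mu]_(t in `[0, w]) N t.
  move=> w01; have pi0 : pi != 0 :> R by rewrite gt_eqF ?pi_gt0.
  have : (pi * (1 / 2 * \int[mu]_(t in `[0, w]) P t))%:E =
         (pi * (1 / 2 * \int[mu]_(t in `[0, w]) N t))%:E.
    rewrite -(abel_half_plane mP intP cP P0 w01) -(abel_half_plane mN intN cN N0 w01).
    apply: eq_integral => x _.
    case: ifP => // x0; have [xw|xw] := ltP 0 (w - x ^+ 2).
      apply: PN; rewrite xw/=; case/andP: w01 => _ w1.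
      by rewrite (le_lt_trans _ w1)// gerBl sqr_ge0.
    have F s : (s ^+ 2 < w - x ^+ 2) = false.
      by apply/negbTE; rewrite -leNgt (le_trans xw)// sqr_ge0.
    by apply: eq_integral => s _; rewrite !F.
  move=> [/(mulfI pi0)/mulfI]; apply.
  by rewrite gt_eqF// divr_gt0.
move=> v v01; suff e : P v = N v.
  have : P v - N v = m v.
    rewrite /P /N; have [h|h] := leP (m v) 0.
      by rewrite (max_l (y := 0)) ?oppr_ge0// sub0r opprK.
    by rewrite (max_r (y := 0)) ?subr0// oppr_le0 ltW.
  by rewrite e subrr.
have dP := is_derive_primitive intP v01 (cP _ v01).
have dN := is_derive_primitive intN v01 (cN _ v01).
rewrite -[LHS](@derive_val _ _ _ _ _ _ _ dP) -[RHS](@derive_val _ _ _ _ _ _ _ dN).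
apply: near_eq_derive.
near=> x; apply: WPN; near: x.
by have := @near_in_itvoo R 0 1 v; rewrite in_itv/= v01; exact.
Unshelve. all: by end_near. Qed.

End AbelInversion.

(** * The primitive of a radial density *)

Section RadialPrimitive.
Context {R : realType}.
Notation mu := (@lebesgue_measure R).
Context (k : R -> R) (C : R).
Hypothesis mk : measurable_fun setT k.
Hypothesis ck : forall u : R, 0 < u < 1 -> {for u, continuous k}.
Hypothesis bk : forall u : R, 0 <= u < 1 -> `|k u| <= C * (1 - u) `^ (- (3 / 2)).

(** The function M of u = |y|^2 such that the 1-form M(|y|^2) (y1 dy2 - y2 dy1)
    has exterior derivative k(|y|^2) dy1 dy2: the equation is
    2 (M + u M') = k. *)
Definition mean_primitive (u : R) : R :=
  if (0 < u) && (u < 1) then (\int[mu]_(t in `[0, u]) k t) / (2 * u) else 0.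
Let M := mean_primitive.

Lemma mean_bound_ge0 : 0 <= C.
Proof.
have := bk (u := 0); rewrite lexx ltr01 subr0 powR1 mulr1 => /(_ isT).
exact: le_trans.
Qed.

Lemma integrable_k (r : R) : r < 1 -> mu.-integrable `[0, r] (EFin \o k).
Proof.
move=> r1; apply: measurable_bounded_integrable => //.
- exact: compact_finite_measure (@segment_compact _ _ _).
- exact: measurable_funTS.
- exists (C * (1 - r) `^ (- (3 / 2))); split; first by rewrite num_real.
  move=> x rx u /=; rewrite in_itv/= => /andP[u0 ur]; apply: le_trans (ltW rx).
  apply: (le_trans (bk _)); first by rewrite u0 (le_lt_trans ur).
  rewrite ler_wpM2l ?mean_bound_ge0// ler_powR_opp ?subr_gt0//.
  by rewrite lerD2l lerN2.
Qed.

Lemma integral_powR32 (u : R) : 0 < u < 1 ->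
  (\int[mu]_(t in `[0%R, u]) (C * (1 - t) `^ (- (3 / 2)))%R%:E =
   (2 * C * ((1 - u) `^ (- (1 / 2)) - 1))%R%:E)%E.
Proof.
move=> /andP[u0 u1].
pose G (y : R) : R := y `^ (- (1 / 2)).
pose F (t : R) := 2 * C * G (1 - t).
rewrite [RHS](_ : _ = (F u - F 0)%:E); last first.
  by rewrite /F /G subr0 powR1; congr EFin; ring.
have cN (x : R) : {for x, continuous (fun x : R => 1 - x)}.
  by apply: cvgB; [exact: cvg_cst|exact: cvg_id].
apply: is_derive_FTC2; first exact: u0.
- move=> x /andP[x0 xu]; have x1 : 0 < 1 - x by rewrite subr_gt0 (le_lt_trans xu).
  suff h : {for x, continuous ((fun y => y `^ (- (3 / 2)) : R) \o (fun x : R => 1 - x))}.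
    by exact: cvgMr h.
  apply: continuous_comp; first exact: cN.
  apply/differentiable_continuous/derivable1_diffP.
  by apply: derivable_powR; rewrite in_itv/= x1.
- move=> x /andP[x0 xu]; have x1 : 0 < 1 - x by rewrite subr_gt0 (le_lt_trans xu).
  have h1 : is_derive (1 - x) 1 G (- (1 / 2) * (1 - x) `^ (- (1 / 2) - 1)).
    exact: is_derive1_powR.
  have h2 : is_derive x 1 (fun x : R => 1 - x) (0 - 1).
    exact: (is_deriveB (is_derive_cst (1 : R) x 1) (is_derive_id x 1)).
  have h := @is_derive1_comp R G (fun x : R => 1 - x) x _ _ h1 h2.
  have -> : C * (1 - x) `^ (- (3 / 2)) =
      (2 * C : R) *: (- (1 / 2) * (1 - x) `^ (- (1 / 2) - 1) * (0 - 1)) :> R.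
    rewrite (_ : - (1 / 2) - 1 = - (3 / 2) :> R); last by lra.
    by rewrite -[_ *: _]/(_ * _); field.
  exact: (is_deriveZ (2 * C : R) h).
Qed.

(** Integrating the bound on k gains one power of 1 - u. The elementary
    inequality used is p^-1 - 1 <= (1 - p^2) p^-1 for p = sqrt (1 - u), which
    absorbs the factor 1 / u. *)
Lemma mean_primitive_bound (u : R) : 0 < u < 1 -> `|M u| <= C * (1 - u) `^ (- (1 / 2)).
Proof.
move=> u01; rewrite /M /mean_primitive u01; move: (u01) => /andP[u0 u1].
have C0 := mean_bound_ge0.
pose p := (1 - u) `^ (1 / 2).
have u1' : 0 < 1 - u by rewrite subr_gt0.
have p0 : 0 < p by rewrite powR_gt0.
have p2 : p * p = 1 - u.
  by rewrite /p -powRD; [rewrite (_ : 1 / 2 + 1 / 2 = 1); [rewrite powRr1 ?ltW|lra]|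
     rewrite (gt_eqF u1') implybT].
have p1 : p <= 1 by rewrite leNgt; apply/negP => h; nra.
have pN : (1 - u) `^ (- (1 / 2)) = p^-1 by rewrite powRN.
have h : `|\int[mu]_(t in `[0, u]) k t| <= 2 * C * (p^-1 - 1).
  apply: (le_trans (le_normr_Rintegral _ (integrable_k u1))) => //.
  rewrite -lee_fin -pN -integral_powR32// fineK; last first.
    apply: integrable_fin_num => //.
    have := integrable_abse (integrable_k u1); exact.
  apply: ge0_le_integral => //.
  - by apply/measurable_EFinP; apply: measurable_funTS; meas.
  - apply/measurable_EFinP; apply: measurable_funTS.
    apply: measurable_funM; first exact: measurable_cst.
    by apply: (measurableT_comp (measurable_powR (R := R) _)); meas.
  - move=> x /=; rewrite in_itv/= => /andP[x0 xu]; rewrite lee_fin; apply: bk.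
    by rewrite x0 (le_lt_trans xu).
rewrite normrM normfV (gtr0_norm (_ : 0 < 2 * u)) ?mulr_gt0//.
rewrite ler_pdivrMr ?mulr_gt0// pN; apply: le_trans h _.
rewrite [leRHS](_ : _ = 2 * C * (u * p^-1)); last by ring.
rewrite ler_wpM2l ?mulr_ge0//.
rewrite -(ler_pM2r p0) mulrBl mulVf ?gt_eqF// mul1r mulfVK ?gt_eqF//.
have e : u = 1 - p * p by rewrite p2; ring.
by rewrite e; nra.
Qed.

Lemma is_derive_mean_primitive (u : R) : 0 < u < 1 ->
  is_derive u 1 M ((k u / 2 - M u) / u).
Proof.
move=> u01; move: (u01) => /andP[u0 u1].
pose r := (u + 1) / 2.
pose W x := \int[mu]_(t in `[0, x]) k t.
have r1 : r < 1 by rewrite /r; lra.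
have dW : is_derive u 1 W (k u).
  apply: (is_derive_primitive (integrable_k r1)); last exact: ck.
  by rewrite u0 /r; lra.
have d2 : is_derive u 1 (fun x : R => 2 * x) 2.
  by apply: is_derive_eq; rewrite -[_ *: _]/(2 * 1) mulr1.
have n0 : 2 * u != 0 by rewrite gt_eqF// mulr_gt0.
have dV := @is_deriveV R (fun x : R => 2 * x) u _ _ n0 d2.
have dM : is_derive u 1 (W * (fun x : R => (2 * x)^-1)) ((k u / 2 - M u) / u).
  apply: (is_derive_eq (is_deriveM dW dV)).
  rewrite /M /mean_primitive u01 -/(W u) -![_ *: _]/(_ * _).
  by field; rewrite gt_eqF.
apply: near_eq_is_derive dM.
near=> x; rewrite /M /mean_primitive ifT//.
near: x; have := @near_in_itvoo R 0 1 u; rewrite in_itv/= u01; exact.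
Unshelve. all: by end_near. Qed.

Lemma continuous_mean_primitive (u : R) : 0 < u < 1 -> {for u, continuous M}.
Proof.
move=> /is_derive_mean_primitive[dM _].
exact/differentiable_continuous/derivable1_diffP.
Qed.

Lemma measurable_mean_primitive : measurable_fun setT M.
Proof.
rewrite (_ : M = M \_ `]0, 1[); last first.
  apply/funext => u; rewrite patchE; case: ifPn => // /negP.
  by rewrite inE/= in_itv/= /M /mean_primitive; case: ifP.
apply/(measurable_restrictT _ _).1 => //.
apply: open_continuous_measurable_fun; first exact: interval_open.
by move=> u; rewrite inE/= in_itv/=; exact: continuous_mean_primitive.
Qed.

Lemma mean_primitive_derive_bound (u : R) : 0 < u < 1 ->
  `|k u / 2 - M u| <= 2 * C * (1 - u) `^ (- (3 / 2)).
Proof.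
move=> u01; have C0 := mean_bound_ge0; move: (u01) => /andP[u0 u1].
have h1 := @bk u; have h2 := mean_primitive_bound u01.
have h3 : (1 - u) `^ (- (1 / 2)) <= (1 - u) `^ (- (3 / 2)).
  have h : 0 < 1 - u <= 1 by rewrite subr_gt0 u1 gerBl ltW.
  by apply: (ger_powR h); lra.
apply: (le_trans (ler_normB _ _)).
rewrite normrM normfV normr_nat.
have h4 : `|M u| <= C * (1 - u) `^ (- (3 / 2)).
  by apply: le_trans h2 _; rewrite ler_wpM2l.
have {}h1 : `|k u| <= C * (1 - u) `^ (- (3 / 2)) by rewrite h1// u1 ltW.
have h0 := powR_ge0 (1 - u) (- (3 / 2)).
have : 0 <= C * (1 - u) `^ (- (3 / 2)) by rewrite mulr_ge0.
lra.
Qed.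

Lemma mean_primitive_eq0 : (forall u, 0 < u < 1 -> M u = 0) ->
  forall u, 0 < u < 1 -> k u = 0.
Proof.
move=> M0 u u01; have dM := is_derive_mean_primitive u01.
have : (k u / 2 - M u) / u = 0.
  rewrite -(@derive_val _ _ _ _ _ _ _ dM) -(@derive_cst _ R^o R^o (0 : R) u 1).
  apply: near_eq_derive; near=> x; apply: M0; near: x.
  by have := @near_in_itvoo R 0 1 u; rewrite in_itv/= u01; exact.
move: u01 => /andP[u0 u1].
move=> /eqP; rewrite M0 ?u0// subr0 !mulf_eq0 !invr_eq0 pnatr_eq0 (gt_eqF u0) !orbF.
by move/eqP.
Unshelve. all: by end_near. Qed.

End RadialPrimitive.

(** * Triangles inscribed in the unit circle *)

Section Triangle.
Context {R : realType}.
Notation mu := (@lebesgue_measure R).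

Definition inner (u v : R * R) : R := u.1 * v.1 + u.2 * v.2.
Definition cross (u v : R * R) : R := u.1 * v.2 - u.2 * v.1.
Definition sqn (u : R * R) : R := inner u u.
Definition sub2 (u v : R * R) : R * R := (u.1 - v.1, u.2 - v.2).

Definition tri (A B C z : R * R) : R * R :=
  (A.1 + z.1 * (B.1 - A.1) + z.2 * (C.1 - A.1),
   A.2 + z.1 * (B.2 - A.2) + z.2 * (C.2 - A.2)).

Lemma measurable_tri A B C : measurable_fun setT (tri A B C).
Proof. by rewrite /tri; meas. Qed.

Lemma measurable_sqn_tri A B C : measurable_fun setT (fun z => sqn (tri A B C z)).
Proof. by rewrite /sqn /inner /tri /=; meas. Qed.

(** The identity |sum of l_i A_i|^2 = sum of l_i |A_i|^2 - sum over i < j of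
    l_i l_j |A_i - A_j|^2 for barycentric coordinates l_i. *)
Lemma sqn_tri (A B C z : R * R) : sqn A = 1 -> sqn B = 1 -> sqn C = 1 ->
  1 - sqn (tri A B C z) = (1 - z.1 - z.2) * z.1 * sqn (sub2 B A) +
    (1 - z.1 - z.2) * z.2 * sqn (sub2 C A) + z.1 * z.2 * sqn (sub2 C B).
Proof.
move=> hA hB hC.
rewrite (_ : 1 - _ = (1 - z.1 - z.2) * sqn A + z.1 * sqn B + z.2 * sqn C
   - sqn (tri A B C z)); last by rewrite hA hB hC; ring.
by rewrite /sqn /inner /tri /sub2 /=; ring.
Qed.

(** By [sqn_tri], 1 - |y|^2 is at least the smallest squared side length times
    [bary_e2]. *)
Lemma sqn_tri_powR (A B C : R * R) : sqn A = 1 -> sqn B = 1 -> sqn C = 1 ->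
  0 < sqn (sub2 B A) -> 0 < sqn (sub2 C A) -> 0 < sqn (sub2 C B) ->
  exists2 K : R, 0 <= K & forall z, simplex z ->
    0 <= sqn (tri A B C z) < 1 /\
    (1 - sqn (tri A B C z)) `^ (- (3 / 2)) <= K * bary_e2 z `^ (- (3 / 2)).
Proof.
move=> hA hB hC dBA dCA dCB.
pose m := Num.min (sqn (sub2 B A)) (Num.min (sqn (sub2 C A)) (sqn (sub2 C B))).
have m0 : 0 < m by rewrite !lt_min dBA dCA dCB.
have m1 : m <= sqn (sub2 B A) by rewrite ge_min lexx.
have m2 : m <= sqn (sub2 C A) by rewrite !ge_min lexx orbT.
have m3 : m <= sqn (sub2 C B) by rewrite !ge_min lexx !orbT.
exists (m `^ (- (3 / 2))); first exact: powR_ge0.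
move=> [x y] /and3P[/= x0 y0 xy].
have w0 : 0 < 1 - x - y by lra.
have e20 : 0 < bary_e2 (x, y).
  by apply: addr_gt0; apply: mulr_gt0 => //; exact: addr_gt0.
have h : m * bary_e2 (x, y) <= 1 - sqn (tri A B C (x, y)).
  rewrite sqn_tri// /bary_e2 /=.
  rewrite [leLHS](_ : _ = (1 - x - y) * x * m + (1 - x - y) * y * m + x * y * m);
    last by ring.
  by rewrite !lerD// ler_wpM2l// mulr_ge0// ?(ltW w0) ?(ltW x0) ?(ltW y0).
have h0 : 0 < m * bary_e2 (x, y) by rewrite mulr_gt0.
split.
  by rewrite -subr_gt0 (lt_le_trans h0 h) andbT addr_ge0// sqr_ge0.
rewrite -(powRM _ (ltW m0) (ltW e20)).
by apply: ler_powR_opp.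
Qed.

Lemma integral_simplex_iter1 (f : R * R -> R) :
  (mu \x mu)%E.-integrable simplex (EFin \o f) ->
  (\int[mu \x mu]_(z in simplex) (f z)%:E =
   \int[mu]_(x in `]0%R, 1%R[) \int[mu]_(y in `]0%R, (1 - x)%R[) (f (x, y))%:E)%E.
Proof.
move=> /integrable_mkcond => /(_ measurable_simplex) intf.
rewrite integral_mkcond -integral12_prod_meas1; last exact: intf.
rewrite [RHS]integral_mkcond; apply: eq_integral => x _.
rewrite patchE; case: ifPn => [|/negP]; rewrite inE/= in_itv/= => x01.
  rewrite [RHS]integral_mkcond; apply: eq_integral => y _.
  rewrite !patchE; congr (if _ then _ else _); apply/idP/idP; rewrite !inE/= in_itv/=.
    by move=> /and3P[/= x0 -> h]; lra.
  move=> /andP[y0 h]; apply/and3P; split => //=; lra.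
rewrite /fubini_F integral0_eq// => y _; rewrite patchE ifN//.
apply/negP; rewrite inE => /and3P[/= x0 y0 xy].
by apply: x01; rewrite x0; lra.
Qed.

Lemma integral_simplex_iter2 (f : R * R -> R) :
  (mu \x mu)%E.-integrable simplex (EFin \o f) ->
  (\int[mu \x mu]_(z in simplex) (f z)%:E =
   \int[mu]_(y in `]0%R, 1%R[) \int[mu]_(x in `]0%R, (1 - y)%R[) (f (x, y))%:E)%E.
Proof.
move=> /integrable_mkcond => /(_ measurable_simplex) intf.
rewrite integral_mkcond -integral21_prod_meas1; last exact: intf.
rewrite [RHS]integral_mkcond; apply: eq_integral => y _.
rewrite patchE; case: ifPn => [|/negP]; rewrite inE/= in_itv/= => y01.
  rewrite [RHS]integral_mkcond; apply: eq_integral => x _.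
  rewrite !patchE; congr (if _ then _ else _); apply/idP/idP; rewrite !inE/= in_itv/=.
    by move=> /and3P[/= -> y0 h]; lra.
  move=> /andP[x0 h]; apply/and3P; split => //=; lra.
rewrite /fubini_G integral0_eq// => x _; rewrite patchE ifN//.
apply/negP; rewrite inE => /and3P[/= x0 y0 xy].
by apply: y01; rewrite y0; lra.
Qed.

End Triangle.

(** * Green's formula on an inscribed triangle *)

Section Green.
Context {R : realType}.
Notation mu := (@lebesgue_measure R).
Context (k : R -> R) (C : R).
Hypothesis mk : measurable_fun setT k.
Hypothesis ck : forall u : R, 0 < u < 1 -> {for u, continuous k}.
Hypothesis bk : forall u : R, 0 <= u < 1 -> `|k u| <= C * (1 - u) `^ (- (3 / 2)).

Let M := mean_primitive k.
Let mM : measurable_fun setT M := measurable_mean_primitive mk ck bk.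
Let C0 : 0 <= C := mean_bound_ge0 bk.

Definition mean_derivative (u : R) : R := (k u / 2 - M u) / u.
Let DM := mean_derivative.

(** The contraction with w of the primitive M(|y|^2) (y1 dy2 - y2 dy1). *)
Definition potential (w y : R * R) : R := M (sqn y) * cross y w.

(** The derivative of [potential w] in the direction v. *)
Definition potential_derive (v w y : R * R) : R :=
  DM (sqn y) * (2 * inner y v * cross y w) + M (sqn y) * cross v w.

(** The antisymmetrised derivative is the exterior derivative of the primitive.
    The terms with M' combine by the planar identity
    (y.v) (y x w) - (y.w) (y x v) = |y|^2 (v x w). *)
Lemma potential_curl (v w y : R * R) : 0 < sqn y < 1 ->
  potential_derive v w y - potential_derive w v y = k (sqn y) * cross v w.
Proof.
move=> /andP[y0 y1].
have e : inner y v * cross y w - inner y w * cross y v = sqn y * cross v w.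
  by rewrite /sqn /inner /cross; ring.
have -> : potential_derive v w y - potential_derive w v y =
  2 * DM (sqn y) * (inner y v * cross y w - inner y w * cross y v)
  + 2 * M (sqn y) * cross v w.
  by rewrite /potential_derive /cross; ring.
rewrite e /DM /mean_derivative; field.
by rewrite gt_eqF.
Qed.

Lemma cross_bound (v w : R * R) (K : R) : sqn v <= K -> sqn w <= K ->
  `|cross v w| <= K.
Proof.
move=> hv hw; have e : sqn v * sqn w = cross v w ^+ 2 + inner v w ^+ 2.
  by rewrite /sqn /inner /cross; ring.
have i0 := sqr_ge0 (inner v w).
have v0 : 0 <= sqn v by rewrite addr_ge0// -expr2 sqr_ge0.
have w0 : 0 <= sqn w by rewrite addr_ge0// -expr2 sqr_ge0.
have K0 : 0 <= K by exact: le_trans hv.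
rewrite -(ler_pXn2r (_ : 0 < 2)%N) ?nnegrE// real_normK ?num_real//.
apply: (@le_trans _ _ (sqn v * sqn w)); first by rewrite e lerDl.
by rewrite expr2 ler_pM.
Qed.

(** By Lagrange's identity (y.v)^2 + (y x v)^2 = |y|^2 |v|^2 each factor is at
    most sqrt K |y|. *)
Lemma inner_cross_bound (v w y : R * R) (K : R) : 0 <= K ->
  sqn v <= K -> sqn w <= K -> `|inner y v * cross y w| <= K * sqn y.
Proof.
move=> K0 hv hw.
have y0 : 0 <= sqn y by rewrite addr_ge0// -expr2 sqr_ge0.
have e1 : sqn y * sqn v = inner y v ^+ 2 + cross y v ^+ 2.
  by rewrite /sqn /inner /cross; ring.
have e2 : sqn y * sqn w = inner y w ^+ 2 + cross y w ^+ 2.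
  by rewrite /sqn /inner /cross; ring.
have h1 : inner y v ^+ 2 <= K * sqn y.
  apply: (@le_trans _ _ (sqn y * sqn v)); first by rewrite e1 lerDl sqr_ge0.
  by rewrite mulrC ler_wpM2r.
have h2 : cross y w ^+ 2 <= K * sqn y.
  apply: (@le_trans _ _ (sqn y * sqn w)); first by rewrite e2 lerDr sqr_ge0.
  by rewrite mulrC ler_wpM2r.
rewrite -(ler_pXn2r (_ : 0 < 2)%N) ?nnegrE ?mulr_ge0// real_normK ?num_real//.
by rewrite exprMn [leRHS]expr2 ler_pM ?sqr_ge0.
Qed.

(** The factor 1 / |y|^2 in M' is compensated by the two factors y in
    [inner_cross_bound]. *)
Lemma potential_derive_bound (v w y : R * R) : sqn v <= 4 -> sqn w <= 4 ->
  0 <= sqn y < 1 ->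
  `|potential_derive v w y| <= 20 * C * (1 - sqn y) `^ (- (3 / 2)).
Proof.
move=> hv hw /andP[y0 y1].
have h0 := powR_ge0 (1 - sqn y) (- (3 / 2)).
have CX : 0 <= C * (1 - sqn y) `^ (- (3 / 2)) by rewrite mulr_ge0.
have [y00|yn0] := eqVneq (sqn y) 0.
  rewrite /potential_derive /DM /mean_derivative /M /mean_primitive y00 ltxx/=.
  rewrite invr0 mulr0 !mul0r addr0 normr0 subr0 powR1; move: CX.
  by rewrite y00 subr0 powR1; nra.
have yp : 0 < sqn y by rewrite lt_def yn0.
have y01 : 0 < sqn y < 1 by rewrite yp.
have b1 := mean_primitive_derive_bound mk bk y01.
have b2 := mean_primitive_bound mk bk y01.
have h3 : (1 - sqn y) `^ (- (1 / 2)) <= (1 - sqn y) `^ (- (3 / 2)).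
  have h : 0 < 1 - sqn y <= 1 by rewrite subr_gt0 y1 gerBl ltW.
  by apply: (ger_powR h); lra.
have {}b2 : `|M (sqn y)| <= C * (1 - sqn y) `^ (- (3 / 2)).
  by apply: le_trans b2 _; rewrite ler_wpM2l.
have b3 : `|inner y v * cross y w| <= 4 * sqn y by exact: inner_cross_bound.
have b4 : `|cross v w| <= 4 by exact: cross_bound.
apply: (le_trans (ler_normD _ _)).
have e1 : `|DM (sqn y) * (2 * inner y v * cross y w)| <=
    16 * C * (1 - sqn y) `^ (- (3 / 2)).
  rewrite /DM /mean_derivative.
  rewrite [X in `|X|](_ : _ = 2 * ((k (sqn y) / 2 - M (sqn y)) *
    ((inner y v * cross y w) / sqn y))); last by field.
  have b3' : `|inner y v * cross y w / sqn y| <= 4.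
    by rewrite normrM normfV (gtr0_norm yp) ler_pdivrMr.
  have := ler_pM (normr_ge0 _) (normr_ge0 _) b1 b3'.
  by rewrite -normrM normrM => h; rewrite normrM normr_nat normrM; lra.
have e2 : `|M (sqn y) * cross v w| <= 4 * C * (1 - sqn y) `^ (- (3 / 2)).
  have := ler_pM (normr_ge0 _) (normr_ge0 _) b2 b4.
  by rewrite normrM; lra.
lra.
Qed.

Definition line (p v : R * R) (x : R) : R * R := (p.1 + x * v.1, p.2 + x * v.2).

Lemma is_derive_affine (a b x : R) : is_derive x 1 (fun x : R => a + x * b) b.
Proof.
have h := is_deriveD (is_derive_cst (a : R) x 1)
  (is_deriveM (is_derive_id x (1 : R)) (is_derive_cst (b : R) x 1)).
apply: (is_derive_eq h).
by rewrite scaler0 !add0r -[_ *: _]/(_ * _) mulr1.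
Qed.

Lemma is_derive_potential_line (p v w : R * R) (x : R) :
  0 < sqn (line p v x) < 1 ->
  is_derive x 1 (fun x => potential w (line p v x)) (potential_derive v w (line p v x)).
Proof.
move=> U01.
have d1 := is_derive_affine p.1 v.1 x.
have d2 := is_derive_affine p.2 v.2 x.
have dU : is_derive x 1 (fun x => sqn (line p v x)) (2 * inner (line p v x) v).
  have h := is_deriveD (is_deriveM d1 d1) (is_deriveM d2 d2).
  by apply: (is_derive_eq h); rewrite -![_ *: _]/(_ * _) /inner /line /=; ring.
have dM := is_derive_mean_primitive mk ck bk U01.
have dMU := @is_derive1_comp R M (fun x => sqn (line p v x)) x _ _ dM dU.
have dc : is_derive x 1 (fun x => cross (line p v x) w) (cross v w).
  have h := is_deriveB (is_deriveM d1 (is_derive_cst w.2 x 1))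
    (is_deriveM d2 (is_derive_cst w.1 x 1)).
  by apply: (is_derive_eq h); rewrite -![_ *: _]/(_ * _) /cross /=; ring.
have h := is_deriveM dMU dc; apply: (is_derive_eq h).
by rewrite -![_ *: _]/(_ * _) /potential_derive /DM /mean_derivative /M /=; ring.
Qed.

Lemma continuous_potential_derive_line (p v w : R * R) (x : R) :
  0 < sqn (line p v x) < 1 ->
  {for x, continuous (fun x => potential_derive v w (line p v x))}.
Proof.
move=> U01.
have cd (f : R -> R) d : is_derive x 1 f d -> {for x, continuous f}.
  by move=> [df _]; exact/differentiable_continuous/derivable1_diffP.
have d1 := is_derive_affine p.1 v.1 x.
have d2 := is_derive_affine p.2 v.2 x.
have dU := is_deriveD (is_deriveM d1 d1) (is_deriveM d2 d2).
have cU : {for x, continuous (fun x => sqn (line p v x))} by exact: cd dU.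
have c1 := cd _ _ d1.
have c2 := cd _ _ d2.
have ci : {for x, continuous (fun x => inner (line p v x) v)}.
  by apply: cvgD; apply: cvgM => //; exact: cvg_cst.
have cc : {for x, continuous (fun x => cross (line p v x) w)}.
  by apply: cvgB; apply: cvgM => //; exact: cvg_cst.
have cM : {for x, continuous (fun x => M (sqn (line p v x)))}.
  apply: (@continuous_comp _ _ _ (fun x => sqn (line p v x)) M); first exact: cU.
  exact: (continuous_mean_primitive mk ck bk U01).
have ckU : {for x, continuous (fun x => k (sqn (line p v x)))}.
  by apply: (@continuous_comp _ _ _ (fun x => sqn (line p v x)) k); [exact: cU|exact: ck].
apply: cvgD; last by apply: cvgM; [exact: cM|exact: cvg_cst].
apply: cvgM.
  apply: cvgM; last first.
    by apply: cvgV; [case/andP: U01 => U0 _; rewrite gt_eqF|exact: cU].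
  by apply: cvgB; [apply: cvgM; [exact: ckU|exact: cvg_cst]|exact: cM].
apply: cvgM; last exact: cc.
by apply: cvgM; [exact: cvg_cst|exact: ci].
Qed.

Lemma measurable_potential_derive (v w : R * R) :
  measurable_fun setT (potential_derive v w).
Proof.
have mU : measurable_fun setT (fun y : R * R => sqn y) by rewrite /sqn /inner; meas.
have mi : measurable_fun setT (fun y : R * R => inner y v) by rewrite /inner; meas.
have mc : measurable_fun setT (fun y : R * R => cross y w) by rewrite /cross; meas.
have mD : measurable_fun setT DM by rewrite /DM /mean_derivative; meas.
have mDU := measurableT_comp mD mU.
have mMU := measurableT_comp mM mU.
apply: measurable_funD; apply: measurable_funM.
- exact: mDU.
- by apply: measurable_funM; [apply: measurable_funM; [exact: measurable_cst|exact: mi]|exact: mc].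
- exact: mMU.
- exact: measurable_cst.
Qed.

Lemma potential_FTC (p v w : R * R) (c : R) : 0 < c ->
  (forall x, 0 <= x <= c -> 0 < sqn (line p v x) < 1) ->
  (\int[mu]_(x in `]0%R, c[) (potential_derive v w (line p v x))%:E =
   (potential w (line p v c) - potential w (line p v 0))%:E)%E.
Proof.
move=> c0 hU.
have md : measurable_fun setT (fun x => potential_derive v w (line p v x)).
  have ml : measurable_fun setT (line p v) by rewrite /line; meas.
  exact: (measurableT_comp (measurable_potential_derive v w) ml).
rewrite -(@integral_itv_bndoo R 0 c _ true false); last first.
  by apply/measurable_EFinP; exact: measurable_funTS.
apply: (is_derive_FTC2 (F := fun x => potential w (line p v x))); first exact: c0.
  by move=> x /hU; exact: continuous_potential_derive_line.
by move=> x /hU; exact: is_derive_potential_line.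
Qed.

Definition edge (d t : R) : R := M (1 - t * (1 - t) * d).

Definition edge_integral (d : R) : R := \int[mu]_(t in `]0, 1[) edge d t.

Lemma measurable_edge (d : R) : measurable_fun setT (edge d).
Proof. by rewrite /edge; meas. Qed.

(** Here 1 - |y|^2 = t (1 - t) d, and M is of order -1/2 in it. *)
Lemma edge_bound (d t : R) : 0 < d -> 0 < t < 1 ->
  `|edge d t| <= 2 * C * d `^ (- (1 / 2)) * psi t.
Proof.
move=> d0 t01; move: (t01) => /andP[t0 t1].
pose q := t * (1 - t).
have q0 : 0 < q by rewrite mulr_gt0// subr_gt0.
have q1 : q <= 1 by rewrite /q; nra.
have p0 := powR_ge0 d (- (1 / 2)).
have [u0|u0] := leP (1 - q * d) 0.
  rewrite /edge /M /mean_primitive -/q ltNge u0/= normr0.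
  by rewrite !mulr_ge0// psi_ge0.
have u01 : 0 < 1 - q * d < 1 by rewrite u0 gtrBl mulr_gt0.
rewrite /edge -/q; apply: le_trans (mean_primitive_bound mk bk u01) _.
rewrite subKr (powRM _ (ltW q0) (ltW d0)).
rewrite [leRHS](_ : _ = C * (2 * psi t * d `^ (- (1 / 2)))); last by ring.
rewrite ler_wpM2l// ler_wpM2r//.
apply: le_trans (powR_le_psi t01); rewrite -/q.
have h : 0 < q <= 1 by rewrite q0.
by apply: (ger_powR h); lra.
Qed.

Lemma integrable_scaled_psi (c : R) :
  mu.-integrable `]0, 1[ (fun t => (c * psi t)%:E).
Proof.
suff : mu.-integrable `]0, 1[ (fun t => (c%:E * (EFin \o psi) t)%E) by [].
by apply: integrableZl => //; exact: integrable_psi.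
Qed.

Lemma integrable_edge_scaled (d : R) (f : R -> R) : 0 < d ->
  measurable_fun setT f -> (forall t, 0 < t < 1 -> `|f t| <= 4) ->
  mu.-integrable `]0, 1[ (fun t => (edge d t * f t)%:E).
Proof.
move=> d0 mf f4; have me := measurable_edge d.
have h := integrable_scaled_psi (8 * C * d `^ (- (1 / 2))).
apply: (le_integrable _ _ _ h) => //.
  by apply/measurable_EFinP; apply: measurable_funTS; meas.
move=> t /=; rewrite in_itv/= => t01.
have p0 := powR_ge0 d (- (1 / 2)).
rewrite lee_fin !normrM (ger0_norm C0) (ger0_norm p0) (ger0_norm (psi_ge0 t)) normr_nat.
apply: (le_trans (ler_pM (normr_ge0 _) (normr_ge0 _) (edge_bound d0 t01) (f4 _ t01))).
by rewrite [leRHS](_ : _ = 2 * C * d `^ (- (1 / 2)) * psi t * 4) //; ring.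
Qed.

Lemma integrable_edge (d : R) : 0 < d -> mu.-integrable `]0, 1[ (EFin \o edge d).
Proof.
move=> d0; have := @integrable_edge_scaled d (cst 1) d0.
rewrite (_ : (fun t => _) = EFin \o edge d).
  apply; first exact: measurable_cst.
  by move=> t _; rewrite /= normr1 ler1n.
by apply/funext => t /=; rewrite mulr1.
Qed.

Lemma edge_integral_bound (d : R) : 0 < d ->
  `|edge_integral d| <= 16 * C * d `^ (- (1 / 2)).
Proof.
move=> d0; rewrite /edge_integral.
apply: (le_trans (le_normr_Rintegral _ (integrable_edge d0))); first by [].
have hpsi := @integrable_psi R.
apply: (@le_trans _ _ (\int[mu]_(t in `]0, 1[) (2 * C * d `^ (- (1 / 2)) * psi t))).
  apply: le_Rintegral => //.
  - exact: (integrable_abse (integrable_edge d0)).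
  - exact: integrable_scaled_psi.
  - by move=> t /=; rewrite in_itv/=; exact: edge_bound.
rewrite RintegralZl// [\int[mu]_(x in _) psi x](_ : _ = 8).
  by rewrite [leLHS](_ : _ = 16 * C * d `^ (- (1 / 2)))//; ring.
by rewrite /Rintegral integral_psi.
Qed.

Lemma sqn_line (A B : R * R) (t : R) : sqn A = 1 -> sqn B = 1 ->
  sqn (line A (sub2 B A) t) = 1 - t * (1 - t) * sqn (sub2 B A).
Proof.
move=> hA hB.
rewrite [in RHS](_ : 1 - t * (1 - t) * _ =
  (1 - t) * sqn A + t * sqn B - t * (1 - t) * sqn (sub2 B A)).
  by rewrite /sqn /inner /line /sub2 /=; ring.
by rewrite hA hB; ring.
Qed.

(** The two terms of the curl are integrated first along b = Q - P and along
    d = S - P respectively, where the fundamental theorem of calculus applies.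
    Fubini is legitimate since each of the two terms, not only their difference
    k, is dominated by [bary_e2] to the power -3/2. The edge QS is
    met from both sides, with weights y x d and y x b whose difference is the
    constant Q x S. The triangle avoids the centre because M is only known to
    be differentiable away from u = 0. *)
Lemma green_ideal_triangle (P Q S : R * R) :
  sqn P = 1 -> sqn Q = 1 -> sqn S = 1 ->
  0 < sqn (sub2 Q P) -> 0 < sqn (sub2 S P) -> 0 < sqn (sub2 S Q) ->
  (forall z, 0 <= z.1 -> 0 <= z.2 -> z.1 + z.2 <= 1 -> 0 < sqn (tri P Q S z)) ->
  (\int[mu \x mu]_(z in simplex) (k (sqn (tri P Q S z)))%:E = 0)%E ->
  cross P Q * edge_integral (sqn (sub2 Q P)) +
  cross Q S * edge_integral (sqn (sub2 S Q)) =
  cross P S * edge_integral (sqn (sub2 S P)).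
Proof.
move=> hP hQ hS dQP dSP dSQ hpos hk.
pose b := sub2 Q P; pose d := sub2 S P.
have sqn_ge0 (u : R * R) : 0 <= sqn u by rewrite addr_ge0// -expr2 sqr_ge0.
(* A chord has length at most 2, by the parallelogram law. *)
have le4 (u v : R * R) : sqn u = 1 -> sqn v = 1 -> sqn (sub2 u v) <= 4.
  move=> hu hv; have e : sqn (sub2 u v) + sqn (u.1 + v.1, u.2 + v.2) = 2 * sqn u + 2 * sqn v.
    by rewrite /sqn /inner /sub2 /=; ring.
  by have := sqn_ge0 (u.1 + v.1, u.2 + v.2); rewrite hu hv in e; lra.
have b4 : sqn b <= 4 by exact: le4.
have d4 : sqn d <= 4 by exact: le4.
have U01 z : 0 <= z.1 -> 0 <= z.2 -> z.1 + z.2 <= 1 ->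
    0 < (1 - z.1 - z.2) * z.1 + (1 - z.1 - z.2) * z.2 + z.1 * z.2 ->
    0 < sqn (tri P Q S z) < 1.
  move=> z1 z2 z12 e0; rewrite hpos//= -subr_gt0 sqn_tri//.
  pose m := Num.min (sqn b) (Num.min (sqn d) (sqn (sub2 S Q))).
  have m0 : 0 < m by rewrite !lt_min dQP dSP dSQ.
  have m1 : m <= sqn b by rewrite ge_min lexx.
  have m2 : m <= sqn d by rewrite !ge_min lexx orbT.
  have m3 : m <= sqn (sub2 S Q) by rewrite !ge_min lexx !orbT.
  have z0 : 0 <= 1 - z.1 - z.2 by lra.
  apply: (lt_le_trans (mulr_gt0 m0 e0)).
  rewrite [leLHS](_ : _ = (1 - z.1 - z.2) * z.1 * m + (1 - z.1 - z.2) * z.2 * m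
    + z.1 * z.2 * m); last by ring.
  by rewrite !lerD// ler_wpM2l// mulr_ge0.
have [K K0 hK] := sqn_tri_powR hP hQ hS dQP dSP dSQ.
have int_dom (f : R * R -> R) (c : R) : 0 <= c -> measurable_fun setT f ->
    (forall z, simplex z -> `|f z| <= c * (1 - sqn (tri P Q S z)) `^ (- (3 / 2))) ->
    (mu \x mu)%E.-integrable simplex (EFin \o f).
  move=> c0 mf hf.
  have h : (mu \x mu)%E.-integrable simplex
      (fun z => ((c * K)%:E * (bary_e2 z `^ (- (3 / 2)))%:E)%E).
    apply: integrableZl; first exact: measurable_simplex.
    exact: integrable_bary_e2_powR.
  apply: (le_integrable _ _ _ h); first exact: measurable_simplex.
    by apply/measurable_EFinP; exact: measurable_funTS.
  move=> z sz; rewrite lee_fin normrM (ger0_norm (powR_ge0 _ _)) (ger0_norm (mulr_ge0 c0 K0)).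
  apply: le_trans (hf _ sz) _; rewrite -mulrA ler_wpM2l//.
  by have [] := hK _ sz.
have mtri := measurable_tri P Q S.
have intD v w : sqn v <= 4 -> sqn w <= 4 -> (mu \x mu)%E.-integrable simplex
    (EFin \o (fun z => potential_derive v w (tri P Q S z))).
  move=> hv hw; apply: (int_dom _ (20 * C)); first by rewrite mulr_ge0.
    exact: (measurableT_comp (measurable_potential_derive v w) mtri).
  move=> z sz; apply: potential_derive_bound => //.
  by have [] := hK _ sz.
have int1 := intD b d b4 d4; have int2 := intD d b d4 b4.
have int3 : (mu \x mu)%E.-integrable simplex (EFin \o (fun z => k (sqn (tri P Q S z)))).
  apply: (int_dom _ C) => //; first exact: (measurableT_comp mk (measurable_sqn_tri P Q S)).
  by move=> z sz; apply: bk; have [] := hK _ sz.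
have I1 : (\int[mu \x mu]_(z in simplex) (potential_derive b d (tri P Q S z))%:E =
  \int[mu]_(t in `]0%R, 1%R[) (edge (sqn (sub2 S Q)) t * cross (line Q (sub2 S Q) t) d -
     edge (sqn (sub2 S P)) t * cross P S)%:E)%E.
  rewrite (integral_simplex_iter2 int1); apply: eq_integral => t.
  rewrite inE/= in_itv/= => /andP[t0 t1].
  have triE x : tri P Q S (x, t) = line (line P d t) b x.
    by rewrite /tri /line /sub2 /=; congr (_, _); ring.
  under eq_integral do rewrite triE.
  rewrite potential_FTC; first last.
  - move=> x /andP[x0 x1]; rewrite -triE; apply: U01 => /=; [lra|lra|lra|nra].
  - by rewrite subr_gt0.
  have -> : line (line P d t) b (1 - t) = line Q (sub2 S Q) t.
    by rewrite /line /sub2 /=; congr (_, _); ring.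
  have -> : line (line P d t) b 0 = line P d t.
    by rewrite /line /=; congr (_, _); ring.
  rewrite /potential !sqn_line// -/(edge _ _) -/(edge _ _).
  congr ((_ - _ * _)%:E).
  by rewrite /cross /line /sub2 /=; ring.
have I2 : (\int[mu \x mu]_(z in simplex) (potential_derive d b (tri P Q S z))%:E =
  \int[mu]_(t in `]0%R, 1%R[) (edge (sqn (sub2 Q S)) t * cross (line S (sub2 Q S) t) b -
     edge (sqn (sub2 Q P)) t * cross P Q)%:E)%E.
  rewrite (integral_simplex_iter1 int2); apply: eq_integral => t.
  rewrite inE/= in_itv/= => /andP[t0 t1].
  have triE y : tri P Q S (t, y) = line (line P b t) d y.
    by rewrite /tri /line /sub2 /=; congr (_, _); ring.
  under eq_integral do rewrite triE.
  rewrite potential_FTC; first last.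
  - move=> x /andP[x0 x1]; rewrite -triE; apply: U01 => /=; [lra|lra|lra|nra].
  - by rewrite subr_gt0.
  have -> : line (line P b t) d (1 - t) = line S (sub2 Q S) t.
    by rewrite /line /sub2 /=; congr (_, _); ring.
  have -> : line (line P b t) d 0 = line P b t.
    by rewrite /line /=; congr (_, _); ring.
  rewrite /potential !sqn_line// -/(edge _ _) -/(edge _ _).
  congr ((_ - _ * _)%:E).
  by rewrite /cross /line /sub2 /=; ring.
have sqnQS : sqn (sub2 Q S) = sqn (sub2 S Q) by rewrite /sqn /inner /sub2 /=; ring.
have cb (A B v : R * R) t : sqn A = 1 -> sqn B = 1 -> sqn v <= 4 -> 0 < t < 1 ->
    `|cross (line A (sub2 B A) t) v| <= 4.
  move=> hA hB hv /andP[t0 t1]; apply: cross_bound => //; rewrite sqn_line//.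
  have : 0 <= t * (1 - t) * sqn (sub2 B A) by rewrite !mulr_ge0// ?subr_ge0 ltW.
  lra.
have mcr (A v w : R * R) : measurable_fun setT (fun t => cross (line A v t) w).
  by rewrite /cross /line /=; meas.
have c4 (A B : R * R) : sqn A = 1 -> sqn B = 1 -> `|cross A B| <= 4.
  by move=> hA hB; apply: cross_bound; rewrite ?hA ?hB ler1n.
have e1 := integrable_edge_scaled dSQ (mcr Q (sub2 S Q) d) (fun t => cb Q S d t hQ hS d4).
have e1' := integrable_edge_scaled dSQ (mcr Q (sub2 S Q) b) (fun t => cb Q S b t hQ hS b4).
have dQS : 0 < sqn (sub2 Q S) by rewrite sqnQS.
have e2 := integrable_edge_scaled dQS (mcr S (sub2 Q S) b) (fun t => cb S Q b t hS hQ b4).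
have e3 := integrable_edge_scaled dSP (measurable_cst (cross P S)) (fun t _ => c4 P S hP hS).
have e4 := integrable_edge_scaled dQP (measurable_cst (cross P Q)) (fun t _ => c4 P Q hP hQ).
pose I0 := `]0 : R, 1[%classic.
have mI0 : measurable (I0 : set (measurableTypeR R)) by exact: measurable_itv.
(* The edge QS is run through in opposite directions by the two integrals. *)
have I2' : (\int[mu]_(t in I0) (edge (sqn (sub2 Q S)) t * cross (line S (sub2 Q S) t) b)%:E =
    \int[mu]_(t in I0) (edge (sqn (sub2 S Q)) t * cross (line Q (sub2 S Q) t) b)%:E)%E.
  pose g (t : R) := if (0 < t) && (t < 1) then
    edge (sqn (sub2 Q S)) t * cross (line S (sub2 Q S) t) b else 0.
  have I0E : I0 = [set t | (0 < t) && (t < 1)].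
    by apply/seteqP; split=> t; rewrite /I0 /= in_itv.
  have mg : measurable_fun setT g.
    by have me := measurable_edge (sqn (sub2 Q S)); have mc := mcr S (sub2 Q S) b; rewrite /g; meas.
  rewrite I0E !integral_guard.
  transitivity (\int[mu]_t (g t)%:E)%E.
    by apply: eq_integral => t _; rewrite /g; case: ifP.
  rewrite integral_onem//; apply: eq_integral => t _.
  rewrite /g subr_gt0 gtrBl andbC; case: ifP => // _; congr (_%:E).
  rewrite /edge subKr sqnQS [(1 - t) * t]mulrC; congr (_ * cross _ _).
  by rewrite /line /sub2 /=; congr (_, _); ring.
have R1 := RintegralB mI0 e1 e3.
have R2 := RintegralB mI0 e2 e4.
have e13 := integrableB mI0 e1 e3.
have e24 := integrableB mI0 e2 e4.
have K1 : (\int[mu]_(t in I0) (edge (sqn (sub2 S Q)) t * cross (line Q (sub2 S Q) t) d -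
     edge (sqn (sub2 S P)) t * cross P S)%:E =
   \int[mu]_(t in I0) (edge (sqn (sub2 Q S)) t * cross (line S (sub2 Q S) t) b -
     edge (sqn (sub2 Q P)) t * cross P Q)%:E)%E.
  rewrite -I1 -I2.
  have h0 : (\int[mu \x mu]_(z in simplex) ((potential_derive b d (tri P Q S z))%:E -
      (potential_derive d b (tri P Q S z))%:E) = 0)%E.
    transitivity (\int[mu \x mu]_(z in simplex)
        ((cross b d)%:E * (k (sqn (tri P Q S z)))%:E))%E.
      apply: eq_integral => -[x y]; rewrite inE => /and3P[/= x0 y0 xy].
      rewrite -EFinB -EFinM potential_curl; first by congr (_%:E); rewrite mulrC.
      have w0 : 0 < 1 - x - y by lra.
      apply: U01 => /=; [exact: ltW|exact: ltW|exact: ltW|].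
      by rewrite !addr_gt0// mulr_gt0.
    by rewrite integralZl//; [rewrite hk mule0|exact: measurable_simplex].
  have ms : measurable (simplex : set (measurableTypeR R * measurableTypeR R)).
    exact: measurable_simplex.
  have h1 := integralB_EFin ms int1 int2.
  have f1 := integrable_fin_num ms int1.
  have f2 := integrable_fin_num ms int2.
  rewrite h0 in h1; rewrite /= in f1 f2.
  rewrite -(fineK f1) -(fineK f2) -EFinB in h1 *.
  by have /esym/subr0_eq -> := congr1 fine h1.
have K2 := congr1 fine K1.
rewrite -!/(Rintegral _ _ _) R1 R2 in K2.
have R3 := congr1 fine I2'.
rewrite -!/(Rintegral _ _ _) in R3.
rewrite R3 in K2.
have R4 := RintegralB mI0 e1 e1'.
have R5 : \int[mu]_(t in I0) (edge (sqn (sub2 S Q)) t * cross (line Q (sub2 S Q) t) d -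
    edge (sqn (sub2 S Q)) t * cross (line Q (sub2 S Q) t) b) =
    cross Q S * edge_integral (sqn (sub2 S Q)).
  rewrite /edge_integral -RintegralZl//; last exact: integrable_edge.
  apply: eq_Rintegral => t _; rewrite -mulrBr mulrC; congr (_ * _).
  by rewrite /cross /line /sub2 /=; ring.
have R6 : \int[mu]_(t in I0) (edge (sqn (sub2 S P)) t * cross P S) =
    cross P S * edge_integral (sqn (sub2 S P)).
  rewrite /edge_integral -RintegralZl//; last exact: integrable_edge.
  by apply: eq_Rintegral => t _; rewrite mulrC.
have R7 : \int[mu]_(t in I0) (edge (sqn (sub2 Q P)) t * cross P Q) =
    cross P Q * edge_integral (sqn (sub2 Q P)).
  rewrite /edge_integral -RintegralZl//; last exact: integrable_edge.
  by apply: eq_Rintegral => t _; rewrite mulrC.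
rewrite R5 in R4; rewrite /= R6 R7 in K2; rewrite R4.
lra.
Qed.

End Green.

(** * Bounded additive functions of an angle *)

Section AdditiveAngle.
Context {R : realType}.

(** Let S be the supremum of |E|. Doubling gives |E(t)| <= S / 2 for t < pi / 2.
    For larger t, E(t) = E(pi - x) - E(pi - x - t), where the first term tends
    to 0 with x and the second is at most S / 2 in absolute value because
    pi - x - t < pi / 2. Hence S <= S / 2. *)
Lemma bounded_additive_eq0 (E : R -> R) (K : R) :
  (forall a b, 0 < a -> 0 < b -> a + b < pi -> E a + E b = E (a + b)) ->
  (forall t, 0 < t < pi -> E t ^+ 2 <= K * (1 + cos t)) ->
  forall t, 0 < t < pi -> E t = 0.
Proof.
move=> addE bE.
have pi0 := pi_gt0 R.
have K0 : 0 <= K.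
  have := bE (pi / 2); rewrite cos_pihalf addr0 mulr1 => h.
  apply: le_trans (sqr_ge0 (E (pi / 2))) _; apply: h.
  by apply/andP; split; lra.
pose A := [set r | exists2 t, 0 < t < pi & r = `|E t|].
have ubA : has_ubound A.
  exists (1 + 2 * K) => r [t t01 ->].
  have h := bE _ t01; have c1 := cos_le1 t.
  have h2 : `|E t| ^+ 2 <= 2 * K by rewrite real_normK ?num_real//; nra.
  have := normr_ge0 (E t); nra.
pose S := sup A.
have leS t : 0 < t < pi -> `|E t| <= S.
  by move=> t01; apply: ub_le_sup => //; exists t.
have S0 : 0 <= S.
  by apply: le_trans (leS (pi / 2) _); [exact: normr_ge0|apply/andP; split; lra].
have half1 t : 0 < t -> t < pi / 2 -> `|E t| <= S / 2.
  move=> t0 t1; have e : E t + E t = E (t + t) by apply: addE => //; lra.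
  have := leS (t + t); rewrite -e (_ : E t + E t = 2 * E t); last by ring.
  rewrite normrM normr_nat => h.
  have {}h : 2 * `|E t| <= S by apply: h; apply/andP; split; lra.
  lra.
have half t : 0 < t < pi -> `|E t| <= S / 2.
  move=> /andP[t0 t1]; have [th|th] := ltP t (pi / 2); first exact: half1.
  apply/ler_addgt0Pr => e e0.
  (* At pi - x the bound on E is K (1 - cos x). *)
  have small : \forall x \near (0 : R)^'+, K * (1 - cos x) < e ^+ 2.
    have cvg0 : K * (1 - cos x) @[x --> (0 : R)^'+] --> (0 : R).
      have h0 : 0 = K * (1 - cos 0) :> R by rewrite cos0 subrr mulr0.
      rewrite [X in _ --> X]h0; apply: cvg_at_right_filter.
      apply: cvgMr; apply: cvgB; [exact: cvg_cst|exact: continuous_cos].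
    by apply: (cvgr_lt 0 cvg0); rewrite exprn_gt0.
  near (0 : R)^'+ => x.
  have x0 : 0 < x by near: x; exact: nbhs_right_gt.
  have xt : x < pi - t by near: x; apply: nbhs_right_lt; rewrite subr_gt0.
  have hx : K * (1 - cos x) < e ^+ 2 by near: x.
  have e1 : E t + E (pi - x - t) = E (t + (pi - x - t)) by apply: addE; lra.
  have e2 : t + (pi - x - t) = pi - x by ring.
  rewrite e2 in e1.
  have b1 : `|E (pi - x)| <= e.
    have := bE (pi - x); rewrite cosB cospi sinpi mul0r addr0 mulN1r => h.
    have {}h : E (pi - x) ^+ 2 <= K * (1 - cos x).
      by apply: h; apply/andP; split; lra.
    rewrite -(ler_pXn2r (_ : 0 < 2)%N) ?nnegrE ?(ltW e0)// real_normK ?num_real//.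
    exact: le_trans h (ltW hx).
  have b2 : `|E (pi - x - t)| <= S / 2 by apply: half1; lra.
  have -> : E t = E (pi - x) - E (pi - x - t) by rewrite -e1 addrK.
  by apply: (le_trans (ler_normB _ _)); rewrite addrC lerD.
have SS : S <= S / 2.
  apply: ge_sup; first by exists `|E (pi / 2)|, (pi / 2) => //; apply/andP; split; lra.
  by move=> r [t t01 ->]; exact: half.
move=> t t01; apply/normr0_eq0; apply/eqP; rewrite eq_le normr_ge0 andbT.
by apply: le_trans (leS _ t01) _; lra.
Unshelve. all: by end_near. Qed.

End AdditiveAngle.

(** * Radial densities *)

Section RadialVanishing.
Context {R : realType}.
Notation mu := (@lebesgue_measure R).

Definition circle_point (t : R) : R * R := (cos t, sin t).

Lemma sqn_circle_point (t : R) : sqn (circle_point t) = 1.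
Proof. by rewrite /sqn /inner /= -!expr2 cos2Dsin2. Qed.

Lemma cross_circle_point (s t : R) :
  cross (circle_point s) (circle_point t) = sin (t - s).
Proof. by rewrite /cross /= sinB; ring. Qed.

Lemma sqn_sub2_circle_point (s t : R) :
  sqn (sub2 (circle_point t) (circle_point s)) = 2 - 2 * cos (t - s).
Proof.
rewrite cosB; have hs := cos2Dsin2 s; have ht := cos2Dsin2 t.
rewrite [RHS](_ : _ = (cos s ^+ 2 + sin s ^+ 2) + (cos t ^+ 2 + sin t ^+ 2)
  - 2 * (cos t * cos s + sin t * sin s)); last by rewrite hs ht; ring.
by rewrite /sqn /inner /sub2 /=; ring.
Qed.

Lemma cos_lt1_pi (t : R) : 0 < t < pi -> cos t < 1.
Proof.
move=> /sin_gt0_pi s0; have := cos2Dsin2 t; have := cos_le1 t.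
rewrite le_eqVlt => /predU1P[->|//] e.
have := exprn_gt0 2 s0; lra.
Qed.

Lemma chord_gt0 (t : R) : 0 < t < pi -> 0 < 2 - 2 * cos t.
Proof. by move=> /cos_lt1_pi; lra. Qed.

Context (k : R -> R) (C : R).
Hypothesis mk : measurable_fun setT k.
Hypothesis ck : forall u : R, 0 < u < 1 -> {for u, continuous k}.
Hypothesis bk : forall u : R, 0 <= u < 1 -> `|k u| <= C * (1 - u) `^ (- (3 / 2)).
Hypothesis ik : forall a b, 0 < a -> 0 < b -> a + b < pi ->
  (\int[mu \x mu]_(z in simplex)
    (k (sqn (tri (circle_point 0) (circle_point a) (circle_point (a + b)) z)))%:E = 0)%E.

Let E (t : R) : R := sin t * edge_integral k (2 - 2 * cos t).

(** Green's formula for the triangle with vertices at the angles 0, a and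
    a + b. It lies in the upper half plane, hence avoids the centre, as
    a + b < pi. *)
Lemma sector_additive (a b : R) : 0 < a -> 0 < b -> a + b < pi ->
  E a + E b = E (a + b).
Proof.
move=> a0 b0 ab.
have ha : 0 < a < pi by apply/andP; split; lra.
have hb : 0 < b < pi by apply/andP; split; lra.
have hab : 0 < a + b < pi by apply/andP; split; lra.
have := green_ideal_triangle mk ck bk (sqn_circle_point 0) (sqn_circle_point a)
  (sqn_circle_point (a + b)).
rewrite !sqn_sub2_circle_point !cross_circle_point.
rewrite !subr0 [a + b - a]addrC addKr; apply; try exact: chord_gt0.
- move=> z z1 z2 z12.
  have U0 (y : R * R) : 0 < y.1 ^+ 2 + y.2 ^+ 2 -> 0 < sqn y by rewrite /sqn /inner -!expr2.
  apply: U0; rewrite /tri /circle_point /= cos0 sin0 subr0 subr0 add0r.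
  have sa := sin_gt0_pi ha; have sab := sin_gt0_pi hab.
  have h1 : 0 <= z.1 * sin a by rewrite mulr_ge0// ltW.
  have h2 : 0 <= z.2 * sin (a + b) by rewrite mulr_ge0// ltW.
  have [z10|z10] := eqVneq z.1 0.
    have [z20|z20] := eqVneq z.2 0.
      by rewrite z10 z20 !mul0r !addr0 expr1n expr0n addr0.
    have h3 : 0 < z.2 * sin (a + b) by rewrite mulr_gt0// lt_def z20.
    by rewrite ltr_wpDl ?sqr_ge0// exprn_gt0// ltr_wpDl.
  have h3 : 0 < z.1 * sin a by rewrite mulr_gt0// lt_def z10.
  by rewrite ltr_wpDl ?sqr_ge0// exprn_gt0// ltr_wpDr.
- exact: ik.
Qed.

(** By the bound of order -1/2 on the edge integral, and
    sin^2 t = (1 - cos t) (1 + cos t), where 1 - cos t is half the squared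
    chord. *)
Lemma sector_bound (t : R) : 0 < t < pi ->
  E t ^+ 2 <= 128 * C ^+ 2 * (1 + cos t).
Proof.
move=> t01; have d0 := chord_gt0 t01.
have h := edge_integral_bound mk ck bk d0.
set d := 2 - 2 * cos t in d0 h *.
have C0 := mean_bound_ge0 bk.
have hd : (d `^ (- (1 / 2))) ^+ 2 = d^-1.
  rewrite -powR_mulrn ?powR_ge0// -powRrM (_ : - (1 / 2) * 2%:R = -1); last by field.
  by rewrite powR_inv1// ltW.
have hJ : edge_integral k d ^+ 2 <= 256 * C ^+ 2 * d^-1.
  rewrite -[leLHS]real_normK ?num_real//.
  rewrite [leRHS](_ : _ = (16 * C * d `^ (- (1 / 2))) ^+ 2); last first.
    by rewrite exprMn hd; ring.
  rewrite ler_pXn2r// nnegrE//.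
  by rewrite !mulr_ge0// powR_ge0.
rewrite exprMn sin2cos2.
rewrite [leRHS](_ : _ = (1 - cos t ^+ 2) * (256 * C ^+ 2 * d^-1)).
  by rewrite ler_wpM2l// -sin2cos2 sqr_ge0.
rewrite /d; field; rewrite -/d; move: d0; rewrite lt_def => /andP[]; by rewrite /d.
Qed.

Lemma edge_integral_eq0 (t : R) : 0 < t < pi -> edge_integral k (2 - 2 * cos t) = 0.
Proof.
move=> t01; have := bounded_additive_eq0 sector_additive sector_bound t01.
by move/eqP; rewrite /E mulf_eq0 gt_eqF ?sin_gt0_pi//= => /eqP.
Qed.

Let M := mean_primitive k.
Let mM : measurable_fun setT M := measurable_mean_primitive mk ck bk.

(** The point at position x on a chord with squared length 4 c satisfies
    1 - |y|^2 = c - s^2, where s = sqrt c (2 x - 1) is its signed distance to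
    the midpoint. So [edge_integral_eq0] is Abel's equation for
    v |-> M(1 - v). *)
Lemma radial_vanishing (u : R) : 0 < u < 1 -> k u = 0.
Proof.
have C0 := mean_bound_ge0 bk.
apply: (mean_primitive_eq0 mk ck bk) => {}u u01.
have mm : measurable_fun setT (fun v : R => M (1 - v)) by meas.
rewrite -[u](subKr 1); apply: (abel_injective mm _ _ _ (_ : 0 < 1 - u < 1)).
- have h : mu.-integrable `]0, 1[ (fun v => (M (1 - v))%:E).
    apply: (le_integrable _ _ _ (integrable_scaled_psi C)) => //.
      by apply/measurable_EFinP; exact: measurable_funTS.
    move=> v /=; rewrite in_itv/= => /andP[v0 v1].
    rewrite lee_fin normrM (ger0_norm C0) (ger0_norm (psi_ge0 v)).
    have v01 : 0 < 1 - v < 1 by apply/andP; split; lra.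
    apply: le_trans (mean_primitive_bound mk bk v01) _; rewrite subKr ler_wpM2l//.
    rewrite /psi ler_wpDr ?powR_ge0//.
    have hv : 0 < v <= 1 by rewrite v0 ltW.
    by apply: (ger_powR hv); lra.
  apply/integrableP; split; first by apply/measurable_EFinP; exact: measurable_funTS.
  case/integrableP : h => _; rewrite (@integral_itv_bndoo R 0 1 _ true false)//.
  by apply: measurableT_comp => //; apply/measurable_EFinP; exact: measurable_funTS.
- move=> v /andP[v0 v1].
  apply: (@continuous_comp _ _ _ (fun v : R => 1 - v) M).
    by apply: cvgB; [exact: cvg_cst|exact: cvg_id].
  by apply: (continuous_mean_primitive mk ck bk); apply/andP; split; lra.
- move=> c /andP[c0 c1].
  pose t := acos (1 - 2 * c).
  have ct : cos t = 1 - 2 * c by rewrite acosK// in_itv/=; apply/andP; split; lra.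
  have t01 : 0 < t < pi.
    by rewrite acos_gt0 ?acos_ltpi//; apply/andP; split; lra.
  have J0 := edge_integral_eq0 t01.
  have d4 : 2 - 2 * cos t = 4 * c by rewrite ct; ring.
  rewrite d4 in J0.
  have ie := integrable_edge mk ck bk (mulr_gt0 (ltr0Sn _ 3) c0 : 0 < 4 * c).
  pose q := Num.sqrt c.
  have q0 : 0 < q by rewrite sqrtr_gt0.
  have q2 : q ^+ 2 = c by rewrite sqr_sqrtr// ltW.
  (* The substitution s = 2 q x - q carries ]0, 1[ to ]- q, q[, where s^2 < c. *)
  pose g (s : R) := if s ^+ 2 < c then M (1 - (c - s ^+ 2)) else 0.
  have mg : measurable_fun setT g by rewrite /g; meas.
  have gE x : g (2 * q * x + - q) = if (0 < x) && (x < 1) then edge k (4 * c) x else 0.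
    have e : (2 * q * x + - q) ^+ 2 = c - x * (1 - x) * (4 * c).
      by rewrite -q2; ring.
    rewrite /g e gtrBl pmulr_lgt0; last by rewrite mulr_gt0.
    have -> : (0 < x * (1 - x)) = ((0 < x) && (x < 1)).
      apply/idP/idP => [h|/andP[x0 x1]]; last by rewrite mulr_gt0// subr_gt0.
      by apply/andP; split; nra.
    by case: ifP => // _; rewrite /edge subKr.
  apply: (integral_affine_eq0 (c := 2 * q) (d := - q) _ mg); first by rewrite mulr_gt0.
  + rewrite (_ : (fun x => _) = (EFin \o edge k (4 * c)) \_ `]0, 1[).
      by apply/(integrable_mkcond _ _).1.
    by apply/funext => x; rewrite gE patchE mem_setE in_itv/=; case: ifP.
  + transitivity (\int[mu]_(x in `]0%R, 1%R[) (edge k (4 * c) x)%:E)%E.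
      rewrite [RHS]integral_mkcond; apply: eq_integral => x _.
      by rewrite gE patchE mem_setE in_itv/=; case: ifP.
    have fin : (\int[mu]_(x in `]0%R, 1%R[) (edge k (4 * c) x)%:E)%E \is a fin_num.
      by apply: integrable_fin_num => //; exact: ie.
    by rewrite -(fineK fin) -[fine _]/(edge_integral k (4 * c)) J0.
- by case/andP: u01 => u0 u1; apply/andP; split; lra.
Qed.

End RadialVanishing.

(** * Interchanging dominated integrals *)

Section ProductSigmaFinite.
Context {R : realType} {d1 d2 : measure_display}.
Context {X : measurableType d1} {Y : measurableType d2}.
Context (m1 : {sigma_finite_measure set X -> \bar R}).
Context (m2 : {sigma_finite_measure set Y -> \bar R}).

Lemma sigma_finite_product : sigma_finite setT (m1 \x m2)%E.
Proof.
have /sigma_finiteP[F [TF ndF Foo]] := sigma_finiteT m1.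
have /sigma_finiteP[G [TG ndG Goo]] := sigma_finiteT m2.
exists (fun n => F n `*` G n).
  rewrite -setXTT TF TG predeqE => -[x y]; split.
    move=> [/= [n _ Fnx] [k _ Gky]]; exists (maxn n k) => //; split.
    - by move: x Fnx; exact/subsetPset/ndF/leq_maxl.
    - by move: y Gky; exact/subsetPset/ndG/leq_maxr.
  by move=> [n _ []/= ? ?]; split; exists n.
move=> k; have [? ?] := Foo k; have [? ?] := Goo k.
split; first exact: measurableX.
by rewrite product_measure1E// lte_mul_pinfty// ge0_fin_numE.
Qed.

(** The product measure bundled with its sigma-finiteness, as Fubini's theorem
    requires when one of the factors is itself a product. *)
Definition product_sigma_finite : {sigma_finite_measure set (X * Y)%type -> \bar R} :=
  HB.pack_for {sigma_finite_measure set (X * Y)%type -> \bar R} (m1 \x m2)%E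
    (Measure_isSigmaFinite.Build _ _ _ (m1 \x m2)%E sigma_finite_product).

End ProductSigmaFinite.

Section DominatedSwap.
Context {R : realType} {d1 d2 : measure_display}.
Context {X : measurableType d1} {Y : measurableType d2}.
Context (m1 : {sigma_finite_measure set X -> \bar R}).
Context (m2 : {sigma_finite_measure set Y -> \bar R}).
Local Open Scope ereal_scope.

(** Fubini for the restriction of f to the rectangle A x B, whose absolute
    integral is at most m1 A times the integral of |g|. *)
Lemma integral_dominated_swap_eq0 (A : set X) (B : set Y) (f : X * Y -> R) (g : Y -> R) :
  measurable A -> measurable B -> m1 A < +oo -> measurable_fun setT f ->
  m2.-integrable B (EFin \o g) ->
  (forall x y, A x -> B y -> `|f (x, y)| <= g y)%R ->
  (forall x, A x -> \int[m2]_(y in B) (f (x, y))%:E = 0) ->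
  \int[m2]_(y in B) \int[m1]_(x in A) (f (x, y))%:E = 0.
Proof.
move=> mA mB A_fin mf ig fg f0.
pose F := (EFin \o f) \_ (A `*` B).
have FE x y : F (x, y) = if (x \in A) && (y \in B) then (f (x, y))%:E else 0.
  rewrite /F patchE; congr (if _ then _ else _).
  by apply/idP/andP; rewrite !inE.
have mF : measurable_fun setT F.
  apply/(measurable_restrictT _ _).1; first exact: measurableX.
  by apply: measurable_funTS; apply/measurable_EFinP.
have iF : (m1 \x m2).-integrable setT F.
  apply/(integrable12ltyP _ _ mF).
  pose I := \int[m2]_(y in B) `|(g y)%:E|.
  have I0 : 0 <= I by exact: integral_ge0.
  have Iy : I \is a fin_num by apply: integrable_fin_num => //; exact: integrable_abse.
  have fI x y : A x -> B y -> `|(f (x, y))%:E| <= `|(g y)%:E|.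
    by move=> Ax By; rewrite !abse_EFin lee_fin (le_trans (fg _ _ Ax By))// ler_norm.
  apply: (@le_lt_trans _ _ (\int[m1]_(x in A) I)).
    rewrite [leRHS]integral_mkcond; apply: ge0_le_integral => //.
    - by move=> x _; exact: integral_ge0.
    - have mN : measurable_fun setT (abse \o F) by apply: measurableT_comp.
      have N0 z : 0 <= (abse \o F) z by exact: abse_ge0.
      have H := (@measurable_fun_fubini_tonelli_F _ _ X Y R m2 (abse \o F) mN N0).
      exact: H.
    - apply/(measurable_restrictT _ _).1; first exact: mA.
      exact: measurable_cst.
    - move=> x _; rewrite patchE; case: ifPn => [|/negPf] xA; last first.
        by rewrite integral0_eq// => y _; rewrite FE xA abse0.
      rewrite /I [leRHS]integral_mkcond; apply: ge0_le_integral => //.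
      + by apply: measurableT_comp => //; apply: (measurableT_comp mF); exact: measurable_pair1.
      + apply/(measurable_restrictT _ _).1 => //.
        by apply: measurableT_comp => //; exact: (measurable_int m2).
      + move=> y _; rewrite patchE FE xA/=; case: ifPn => [|_]; last by rewrite abse0.
        by rewrite inE => By; move: xA; rewrite inE => Ax; exact: fI.
  by rewrite integral_cst//= lte_mul_pinfty.
transitivity (\int[m2]_y \int[m1]_x F (x, y)).
  rewrite integral_mkcond; apply: eq_integral => y _; rewrite patchE.
  case: ifPn => [|/negPf] yB.
    rewrite integral_mkcond; apply: eq_integral => x _.
    by rewrite patchE FE yB andbT.
  by rewrite integral0_eq// => x _; rewrite FE yB andbF.
rewrite -(Fubini iF) integral0_eq// => x _.
have [xA|xA] := boolP (x \in A); last first.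
  by rewrite integral0_eq// => y _; rewrite FE (negPf xA).
rewrite -(f0 x); last by rewrite -inE.
rewrite [RHS]integral_mkcond; apply: eq_integral => y _.
by rewrite patchE FE xA.
Qed.

End DominatedSwap.

(** * Averaging over rotations *)

Section CircularMean.
Context {R : realType}.
Notation mu := (@lebesgue_measure R).

Lemma pi2_gt0 : 0 < pi *+ 2 :> R.
Proof. by rewrite pmulrn_rgt0// pi_gt0. Qed.

(** For a primitive W of G, the claim is W(p + a) - W(a) = W(p) - W(0), and both
    W(a) - W(0) and W(a + p) - W(p) are the integral of G over [0, a], by
    periodicity. *)
Lemma integral_periodic_shift (G : R -> R) (p a : R) : 0 < p -> 0 <= a ->
  continuous G -> (forall t, G (t + p) = G t) ->
  \int[mu]_(t in `[0, p]) G (t + a) = \int[mu]_(t in `[0, p]) G t.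
Proof.
move=> p0 a0 cG pG; case: (ltgtP 0 a) a0 => // [{}a0|<-] _; last first.
  by apply: eq_Rintegral => t _; rewrite addr0.
(* The base point -1 makes W differentiable at 0 too. *)
pose W (x : R) := \int[mu]_(t in `[-1, x]) G t.
have cw : {within `[(-1 : R), p + a + 1], continuous G}.
  by apply: continuous_subspaceT; exact: cG.
have iG : mu.-integrable `[(-1 : R), p + a + 1] (EFin \o G).
  by apply: continuous_compact_integrable => //; exact: segment_compact.
have dW (x : R) : 0 <= x <= p + a -> is_derive x 1 W (G x).
  move=> /andP[x0 xp]; apply: (is_derive_primitive iG); last exact: cG.
  by apply/andP; split; lra.
have dWs (b x : R) : 0 <= x + b <= p + a -> is_derive x 1 (fun t => W (t + b)) (G (x + b)).
  move=> /dW h1.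
  have h2 : is_derive x 1 (fun t : R => t + b) (1 + 0).
    exact: (is_deriveD (is_derive_id x 1) (is_derive_cst (b : R) x 1)).
  have h := @is_derive1_comp R W (fun t : R => t + b) x _ _ h1 h2.
  by apply: (is_derive_eq h); rewrite addr0 mulr1.
have cGs (b x : R) : {for x, continuous (fun t => G (t + b))}.
  apply: (@continuous_comp _ _ _ (fun t : R => t + b) G); last exact: cG.
  by apply: cvgD; [exact: cvg_id|exact: cvg_cst].
have FTC (b c : R) : 0 < c -> 0 <= b -> c + b <= p + a ->
    \int[mu]_(t in `[0, c]) G (t + b) = W (c + b) - W b.
  move=> c0 b0 cb; rewrite /Rintegral.
  have d x : 0 <= x <= c -> is_derive x 1 (fun t => W (t + b)) (G (x + b)).
    by move=> /andP[x0 xc]; apply: dWs; apply/andP; split; lra.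
  have ct x : 0 <= x <= c -> {for x, continuous (fun t => G (t + b))} by move=> _; exact: cGs.
  by rewrite (is_derive_FTC2 c0 ct d)/= add0r.
have e0 : \int[mu]_(t in `[0, p]) G t = W p - W 0.
  rewrite -[p in W p]addr0 -FTC//; [|lra].
  by apply: eq_Rintegral => t _; rewrite addr0.
have e1 : \int[mu]_(t in `[0, a]) G t = W a - W 0.
  rewrite -[a in W a]addr0 -FTC//; [|lra].
  by apply: eq_Rintegral => t _; rewrite addr0.
have e2 : \int[mu]_(t in `[0, a]) G t = W (a + p) - W p.
  rewrite -FTC//; [|lra|lra].
  by apply: eq_Rintegral => t _; rewrite pG.
rewrite FTC//; [|lra]; rewrite e0 [p + a]addrC -[W (a + p)](subrK (W p)) -e2 e1; ring.
Qed.

Lemma polar_angle (y : R * R) : exists2 a : R, 0 <= a &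
  y = (Num.sqrt (sqn y) * cos a, Num.sqrt (sqn y) * sin a).
Proof.
case: y => x y; set r := Num.sqrt _.
have r2 : r ^+ 2 = x ^+ 2 + y ^+ 2.
  by rewrite sqr_sqrtr /sqn /inner /= -!expr2// addr_ge0// sqr_ge0.
have r0 : 0 <= r by exact: sqrtr_ge0.
clearbody r.
have [rz|rn] := eqVneq r 0.
  exists 0 => //; move: r2; rewrite rz !mul0r expr0n/= => e.
  have x0 : x ^+ 2 = 0 by have := sqr_ge0 x; have := sqr_ge0 y; lra.
  have y0 : y ^+ 2 = 0 by have := sqr_ge0 x; have := sqr_ge0 y; lra.
  by congr pair; apply/eqP; rewrite -sqrf_eq0 ?x0 ?y0.
have rp : 0 < r by rewrite lt_neqAle eq_sym rn.
have xr : -1 <= x / r <= 1.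
  rewrite ler_pdivlMr// ler_pdivrMr// mul1r mulN1r -ler_norml.
  rewrite -(ler_pXn2r (n := 2)) ?nnegrE// real_normK ?num_real// r2.
  by rewrite lerDl sqr_ge0.
have ca : cos (acos (x / r)) = x / r by rewrite acosK// in_itv.
have a0 : 0 <= acos (x / r) by exact: acos_ge0.
have ap : acos (x / r) <= pi by exact: acos_lepi.
have sa : r * sin (acos (x / r)) = `|y|.
  rewrite sin_acos//; apply/eqP.
  rewrite -(eqrXn2 (n := 2)) ?mulr_ge0 ?sqrtr_ge0//.
  rewrite exprMn r2 sqr_sqrtr; last first.
    by rewrite subr_ge0 -[leRHS](expr1n R 2) -real_normK ?num_real// ler_pXn2r ?nnegrE// ler_norml.
  rewrite real_normK ?num_real//; apply/eqP.
  by rewrite -r2 (_ : y ^+ 2 = r ^+ 2 - x ^+ 2); [field|rewrite r2; ring].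
have rx : r * (x / r) = x by field.
have [y0|y0] := leP 0 y.
  by exists (acos (x / r)); rewrite ?ca ?sa ?ger0_norm ?rx.
exists (- acos (x / r) + pi *+ 2); first by have := pi_ge0 R; lra.
by rewrite sinD2pi cosD2pi cosN sinN ca mulrN sa ltr0_norm// opprK rx.
Qed.

Lemma continuous_pair_at (T : topologicalType) (f g : T -> R) (t : T) :
  {for t, continuous f} -> {for t, continuous g} ->
  {for t, continuous (fun t => (f t, g t))}.
Proof. by move=> cf cg; have := cvg_pair cf cg; exact. Qed.

Definition rot (t : R) (y : R * R) : R * R :=
  (cos t * y.1 - sin t * y.2, sin t * y.1 + cos t * y.2).

Lemma sqn_rot t y : sqn (rot t y) = sqn y.
Proof.
rewrite [RHS](_ : _ = (cos t ^+ 2 + sin t ^+ 2) * sqn y).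
  by rewrite /sqn /inner /rot/=; ring.
by rewrite cos2Dsin2 mul1r.
Qed.

Lemma rot_tri t A B D z : rot t (tri A B D z) = tri (rot t A) (rot t B) (rot t D) z.
Proof. by rewrite /rot /tri/=; congr pair; ring. Qed.

Lemma rot_sub2 t A B : sub2 (rot t A) (rot t B) = rot t (sub2 A B).
Proof. by rewrite /rot /sub2/=; congr pair; ring. Qed.

Lemma rot_polar (t a r : R) :
  rot t (r * cos a, r * sin a) = (r * cos (t + a), r * sin (t + a)).
Proof. by rewrite /rot /= cosD sinD; congr pair; ring. Qed.

Lemma sqn_polar (r t : R) : sqn (r * cos t, r * sin t) = r ^+ 2.
Proof.
rewrite [LHS](_ : _ = r ^+ 2 * (cos t ^+ 2 + sin t ^+ 2)).
  by rewrite cos2Dsin2 mulr1.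
by rewrite /sqn /inner /=; ring.
Qed.

Context (h : R * R -> R) (C : R).
Hypothesis ch : forall y, sqn y < 1 -> {for y, continuous h}.
Hypothesis bh : forall y, sqn y < 1 -> `|h y| <= C * (1 - sqn y) `^ (- (3 / 2)).

Definition circle_integral (r : R) : R :=
  \int[mu]_(t in `[0, pi *+ 2]) h (r * cos t, r * sin t).

Let pi2_pos : 0 < pi *+ 2 :> R := pi2_gt0.

Lemma continuous_polar (r t : R) : r ^+ 2 < 1 ->
  {for t, continuous (fun t => h (r * cos t, r * sin t))}.
Proof.
move=> r1; apply: (@continuous_comp _ _ _ (fun t : R => (r * cos t, r * sin t)) h).
  apply: continuous_pair_at.
    by apply: cvgM; [exact: cvg_cst|exact: continuous_cos].
  by apply: cvgM; [exact: cvg_cst|exact: continuous_sin].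
by apply: ch; rewrite sqn_polar.
Qed.

Lemma circle_integral_rot (y : R * R) : sqn y < 1 ->
  \int[mu]_(t in `[0, pi *+ 2]) h (rot t y) = circle_integral (Num.sqrt (sqn y)).
Proof.
move=> y1; have [a a0 ya] := polar_angle y.
set r := Num.sqrt (sqn y) in ya *.
have r1 : r ^+ 2 < 1.
  by rewrite sqr_sqrtr// /sqn /inner -!expr2 addr_ge0// sqr_ge0.
transitivity (\int[mu]_(t in `[0, pi *+ 2]) h (r * cos (t + a), r * sin (t + a))).
  by apply: eq_Rintegral => t _; rewrite ya rot_polar.
apply: (@integral_periodic_shift (fun t => h (r * cos t, r * sin t))) => //.
  by move=> t; exact: continuous_polar.
by move=> t; rewrite cosD2pi sinD2pi.
Qed.

Lemma planar_bound_ge0 : 0 <= C.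
Proof.
have := @bh (0, 0); rewrite /sqn /inner /= mul0r addr0 ltr01 subr0 powR1 mulr1.
by move=> /(_ isT); exact: le_trans.
Qed.

Let C_ge0 := planar_bound_ge0.

Lemma integrable_polar (r : R) : r ^+ 2 < 1 ->
  mu.-integrable `[0, pi *+ 2] (EFin \o (fun t => h (r * cos t, r * sin t))).
Proof.
move=> r1; apply: continuous_compact_integrable; first exact: segment_compact.
apply: continuous_subspaceT => t; exact: continuous_polar.
Qed.

Lemma circle_integral_bound (r : R) : r ^+ 2 < 1 ->
  `|circle_integral r| <= (pi *+ 2 * C) * (1 - r ^+ 2) `^ (- (3 / 2)).
Proof.
move=> r1; apply: (le_trans (le_normr_Rintegral _ (integrable_polar r1))) => //.
apply: (@le_trans _ _ (\int[mu]_(t in `[0, pi *+ 2]) (C * (1 - r ^+ 2) `^ (- (3 / 2))))).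
  apply: le_Rintegral => //.
  - have := integrable_abse (integrable_polar r1); exact.
  - apply: continuous_compact_integrable; first exact: segment_compact.
    by apply: continuous_subspaceT => t; exact: cvg_cst.
  - by move=> t _; rewrite -(sqn_polar r t); apply: bh; rewrite sqn_polar.
by rewrite Rintegral_cst//= lebesgue_measure_itv/= lte_fin pi2_gt0 oppr0 addr0/= mulrC mulrA.
Qed.

(** Continuity under the integral sign: h is bounded on every smaller concentric
    disc. *)
Lemma continuous_circle_integral (r : R) : r ^+ 2 < 1 -> {for r, continuous circle_integral}.
Proof.
move=> r1.
have r_lt1 : `|r| < 1.
  by rewrite -(ltr_pXn2r (n := 2)) ?nnegrE// real_normK ?num_real// expr1n.
pose s := (1 + `|r|) / 2.
have s0 : 0 < s by rewrite /s; have := normr_ge0 r; lra.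
have s1 : s < 1 by rewrite /s; lra.
have rs : `|r| < s by rewrite /s; lra.
have sI (x : R) : x \in `]- s, s[ -> x ^+ 2 <= s ^+ 2.
  rewrite in_itv/= -ltr_norml => /ltW xs.
  by rewrite -real_normK ?num_real// ler_pXn2r// nnegrE// ltW.
have s21 : s ^+ 2 < 1 by rewrite expr_lt1// ltW.
have rI : r \in (`]- s, s[ : interval R) by rewrite in_itv/= -ltr_norml.
suff : {in `]- s, s[%classic, continuous circle_integral} by apply; rewrite inE.
apply: (@continuity_under_integral R _ _ mu
    (fun r t => h (r * cos t, r * sin t)) _ _ _ _ _ _
    (fun=> C * (1 - s ^+ 2) `^ (- (3 / 2)))) => //.
- by move=> x /= xI; apply: integrable_polar; apply: le_lt_trans (sI _ xI) s21.
- apply: aeW => t /= _ x; rewrite inE/= => xI.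
  apply: (@continuous_comp _ _ _ (fun r : R => (r * cos t, r * sin t)) h).
    by apply: continuous_pair_at; (apply: cvgM; [exact: cvg_id|exact: cvg_cst]).
  by apply: ch; rewrite sqn_polar; apply: le_lt_trans (sI _ xI) s21.
- apply: continuous_compact_integrable; first exact: segment_compact.
  by apply: continuous_subspaceT => t; exact: cvg_cst.
- move=> x /= xI; apply: aeW => t /= _.
  have x1 := sI _ xI.
  apply: (le_trans (bh _)); rewrite sqn_polar; first exact: le_lt_trans x1 s21.
  by rewrite ler_wpM2l// ler_powR_opp ?subr_gt0// lerD2l lerN2.
Qed.

End CircularMean.

(** * Densities on the disc *)

Section PlanarVanishing.
Context {R : realType}.
Notation mu := (@lebesgue_measure R).
Notation plane := (measurableTypeR R * measurableTypeR R)%type.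
Context (h : R * R -> R) (C : R).
Hypothesis mh : measurable_fun [set: plane] h.
Hypothesis ch : forall y, sqn y < 1 -> {for y, continuous h}.
Hypothesis bh : forall y, sqn y < 1 -> `|h y| <= C * (1 - sqn y) `^ (- (3 / 2)).
Hypothesis ih : forall A B D : R * R, sqn A = 1 -> sqn B = 1 -> sqn D = 1 ->
  0 < sqn (sub2 B A) -> 0 < sqn (sub2 D A) -> 0 < sqn (sub2 D B) ->
  (\int[mu \x mu]_(z in simplex) (h (tri A B D z))%:E = 0)%E.

Let pi2_pos : 0 < pi *+ 2 :> R := @pi2_gt0 R.
Let C_ge0 : 0 <= C := planar_bound_ge0 bh.

(** Rotating an inscribed triangle gives an inscribed triangle, so the inner
    integral vanishes for every angle once the two integrations are
    interchanged. *)
Lemma integral_circle_integral_tri (A B D : R * R) : sqn A = 1 -> sqn B = 1 -> sqn D = 1 ->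
  0 < sqn (sub2 B A) -> 0 < sqn (sub2 D A) -> 0 < sqn (sub2 D B) ->
  (\int[mu \x mu]_(z in simplex) (circle_integral h (Num.sqrt (sqn (tri A B D z))))%:E = 0)%E.
Proof.
move=> hA hB hD dBA dDA dDB.
have [K K0 hK] := sqn_tri_powR hA hB hD dBA dDA dDB.
pose f (x : R * (R * R)) : R := h (rot x.1 (tri A B D x.2)).
have mf : measurable_fun [set: measurableTypeR R * plane] f.
  apply: (measurableT_comp mh); rewrite /rot /tri/=.
  have m1 : measurable_fun [set: measurableTypeR R * plane] (fun x => cos x.1 : R).
    by apply: measurableT_comp => //; apply: continuous_measurable_fun; exact: continuous_cos.
  have m2 : measurable_fun [set: measurableTypeR R * plane] (fun x => sin x.1 : R).
    by apply: measurableT_comp => //; apply: continuous_measurable_fun; exact: continuous_sin.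
  have m3 : measurable_fun [set: measurableTypeR R * plane] (fun x => x.2.1 : R).
    exact: measurableT_comp.
  have m4 : measurable_fun [set: measurableTypeR R * plane] (fun x => x.2.2 : R).
    exact: measurableT_comp.
  by meas.
have ms : measurable (simplex : set plane) by exact: measurable_simplex.
have ig := @integrable_bary_e2_powR R.
have swap : (\int[mu \x mu]_(z in simplex) \int[mu]_(t in `[0%R, (pi *+ 2)%R]) (f (t, z))%:E = 0)%E.
  apply: (@integral_dominated_swap_eq0 R _ _ (measurableTypeR R) plane mu
    (product_sigma_finite mu mu) `[0, pi *+ 2] simplex f
    (fun z => (C * K) * bary_e2 z `^ (- (3 / 2)))).
  - exact: measurable_itv.
  - exact: ms.
  - by rewrite /= lebesgue_measure_itv/= lte_fin pi2_gt0 ltry.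
  - exact: mf.
  - have := integrableZl ms (C * K) ig; exact.
  - move=> t z _ sz; have [/andP[z0 z1] zK] := hK _ sz.
    rewrite /f/=; apply: (le_trans (bh _)); rewrite sqn_rot//.
    by rewrite -mulrA ler_wpM2l.
  - move=> t _; rewrite /f/=; under eq_integral do rewrite rot_tri.
    by apply: ih; rewrite ?rot_sub2 sqn_rot.
rewrite -[RHS]swap.
apply: eq_integral => z; rewrite inE => sz.
have [/andP[z0 z1] _] := hK _ sz.
rewrite -(circle_integral_rot ch z1) /Rintegral fineK//.
apply: integrable_fin_num => //.
have [a a0 ->] := polar_angle (tri A B D z).
set r := Num.sqrt _.
have r1 : r ^+ 2 < 1 by rewrite sqr_sqrtr.
apply: continuous_compact_integrable; first exact: segment_compact.
apply: continuous_subspaceT => t; under eq_fun do rewrite rot_polar.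
apply: (@continuous_comp _ _ _ (fun t : R => t + a) (fun t => h (r * cos t, r * sin t))).
  by apply: cvgD; [exact: cvg_id|exact: cvg_cst].
exact: continuous_polar.
Qed.

(** The integrals over circles form a radial density satisfying the hypotheses
    of [radial_vanishing]. They therefore vanish for positive radii, hence by
    continuity at the radius 0, where the integral is 2 pi h(0). *)
Lemma planar_vanishing : h (0, 0) = 0.
Proof.
(* Cut off at 0 and 1, so that k is measurable on the whole line. *)
pose k (u : R) := if (0 < u) && (u < 1) then circle_integral h (Num.sqrt u) else 0.
have sq (u : R) : 0 < u < 1 -> Num.sqrt u ^+ 2 < 1.
  by move=> /andP[u0 u1]; rewrite sqr_sqrtr// ltW.
have ck (u : R) : 0 < u < 1 -> {for u, continuous k}.
  move=> u01.
  have c : {for u, continuous (fun u => circle_integral h (Num.sqrt u))}.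
    apply: (@continuous_comp _ _ _ (@Num.sqrt R) (circle_integral h)).
      exact: sqrt_continuous.
    exact: (continuous_circle_integral ch bh (sq u u01)).
  have e : \forall x \near u, circle_integral h (Num.sqrt x) = k x.
    near=> x; rewrite /k ifT//.
    near: x; have := @near_in_itvoo R 0 1 u; rewrite in_itv/= u01; exact.
  have c' : k x @[x --> u] --> circle_integral h (Num.sqrt u).
    by apply: cvg_trans c; exact: near_eq_cvg.
  have ku : circle_integral h (Num.sqrt u) = k u by rewrite /k u01.
  rewrite ku in c'; exact: c'.
have mk : measurable_fun setT k.
  rewrite (_ : k = k \_ `]0, 1[); last first.
    apply/funext => u; rewrite patchE; case: ifPn => // /negP.
    by rewrite inE/= in_itv/= /k; case: ifP.
  apply/(measurable_restrictT _ _).1 => //.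
  apply: open_continuous_measurable_fun; first exact: interval_open.
  by move=> u; rewrite inE/= in_itv/=; exact: ck.
have bk (u : R) : 0 <= u < 1 -> `|k u| <= pi *+ 2 * C * (1 - u) `^ (- (3 / 2)).
  move=> /andP[u0 u1]; rewrite /k; case: ifPn => [u01|_].
    by have := circle_integral_bound ch bh (sq u u01); rewrite sqr_sqrtr.
  by rewrite normr0 mulr_ge0 ?powR_ge0// mulr_ge0// ltW.
have k0 := radial_vanishing mk ck bk.
have {}k0 (u : R) : 0 < u < 1 -> k u = 0.
  apply: k0 => a b a0 b0 ab.
  have ha : 0 < a < pi by apply/andP; split; lra.
  have hb : 0 < b < pi by apply/andP; split; lra.
  have hab : 0 < a + b < pi by apply/andP; split; lra.
  have dA : 0 < sqn (sub2 (circle_point a) (circle_point 0)).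
    by rewrite sqn_sub2_circle_point subr0; exact: chord_gt0.
  have dD : 0 < sqn (sub2 (circle_point (a + b)) (circle_point 0)).
    by rewrite sqn_sub2_circle_point subr0; exact: chord_gt0.
  have dB : 0 < sqn (sub2 (circle_point (a + b)) (circle_point a)).
    by rewrite sqn_sub2_circle_point [a + b - a]addrC addKr; exact: chord_gt0.
  rewrite -(integral_circle_integral_tri (sqn_circle_point 0) (sqn_circle_point a)
    (sqn_circle_point (a + b)) dA dD dB).
  have [K K0 hK] := sqn_tri_powR (sqn_circle_point 0) (sqn_circle_point a)
    (sqn_circle_point (a + b)) dA dD dB.
  apply: eq_integral => z; rewrite inE => sz.
  have [/andP[z0 z1] _] := hK _ sz.
  rewrite /k z1 andbT ifT//.
  move: sz => /and3P[/= z10 z20 _].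
  rewrite /sqn /inner /tri /circle_point /= cos0 sin0 !subr0 add0r ltr_wpDl// -?expr2 ?sqr_ge0//.
  by rewrite exprn_gt0// addr_gt0// mulr_gt0// sin_gt0_pi.
have m0 (r : R) : 0 < r < 1 -> circle_integral h r = 0.
  move=> /andP[r0 r1].
  have h1 : 0 < r ^+ 2 < 1 by rewrite exprn_gt0// expr_lt1// ltW.
  by have := k0 _ h1; rewrite /k h1 sqrtr_sqr gtr0_norm.
have z0 : circle_integral h 0 = 0.
  have c0 : {for (0 : R), continuous (circle_integral h)}.
    by apply: (continuous_circle_integral ch bh); rewrite expr0n/=.
  have c1 : circle_integral h x @[x --> 0^'+] --> circle_integral h 0 by exact: cvg_at_right_filter.
  have c2 : circle_integral h x @[x --> (0 : R)^'+] --> (0 : R).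
    apply: cvg_near_cst; near=> x; apply: m0; apply/andP; split.
      by near: x; exact: nbhs_right_gt.
    by near: x; apply: nbhs_right_lt.
  exact: (cvg_unique _ c1 c2).
move: z0; rewrite /circle_integral.
under eq_Rintegral do rewrite !mul0r.
rewrite Rintegral_cst//= lebesgue_measure_itv/= lte_fin pi2_gt0 oppr0 addr0/=.
by move=> /eqP; rewrite mulf_eq0 (gt_eqF pi2_gt0) orbF => /eqP.
Unshelve. all: by end_near. Qed.

End PlanarVanishing.

(** * Linear algebra of the Klein metric *)

Section KleinAlgebra.
Context {R : realType} {n : nat}.
Implicit Types p q u v x y : 'rV[R]_n.

Lemma dotC u v : dot u v = dot v u.
Proof. by apply: eq_bigr => i _; rewrite mulrC. Qed.

Lemma dotDl u v x : dot (u + v) x = dot u x + dot v x.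
Proof. by rewrite -big_split; apply: eq_bigr => i _; rewrite mxE mulrDl. Qed.

Lemma dotZl (a : R) u x : dot (a *: u) x = a * dot u x.
Proof. by rewrite /dot mulr_sumr; apply: eq_bigr => i _; rewrite mxE mulrA. Qed.

Lemma dotDr u v x : dot x (u + v) = dot x u + dot x v.
Proof. by rewrite dotC dotDl ![dot _ x]dotC. Qed.

Lemma dotZr (a : R) u x : dot x (a *: u) = a * dot x u.
Proof. by rewrite dotC dotZl dotC. Qed.

Definition dotE := (dotDl, dotDr, dotZl, dotZr).

Lemma dot_ge0 u : 0 <= dot u u.
Proof. by apply: sumr_ge0 => i _; rewrite -expr2 sqr_ge0. Qed.

Lemma dot_eq0 u : (dot u u == 0) = (u == 0).
Proof.
apply/eqP/eqP => [|->]; last by rewrite /dot big1// => i _; rewrite mxE mul0r.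
move=> /eqP; rewrite psumr_eq0; last by move=> i _; rewrite -expr2 sqr_ge0.
move=> /allP h; apply/rowP => i; rewrite mxE; apply/eqP.
by have := h i (mem_index_enum i); rewrite /= mulf_eq0 orbb.
Qed.

Lemma continuous_dot_self : continuous (fun q => dot q q).
Proof.
apply: (@continuous_big R _ +%R 0 xpredT add_continuous 'rV[R]_n).
move=> i _ q; have c : {for q, continuous (fun q : 'rV[R]_n => q 0 i : R)}.
  exact: (@coord_continuous R 1 n 0 i q).
exact: (cvgM c c).
Qed.

Lemma klein_metricDl p u v x :
  klein_metric p (u + v) x = klein_metric p u x + klein_metric p v x.
Proof. by rewrite /klein_metric !dotE; ring. Qed.

Lemma klein_metricZl p (a : R) u x : klein_metric p (a *: u) x = a * klein_metric p u x.
Proof. by rewrite /klein_metric !dotE; ring. Qed.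

Lemma klein_metricC p u v : klein_metric p u v = klein_metric p v u.
Proof. by rewrite /klein_metric dotC [dot p u * _]mulrC. Qed.

Lemma klein_metricDr p u v x :
  klein_metric p x (u + v) = klein_metric p x u + klein_metric p x v.
Proof. by rewrite klein_metricC klein_metricDl ![klein_metric p _ x]klein_metricC. Qed.

Lemma klein_metricZr p (a : R) u x : klein_metric p x (a *: u) = a * klein_metric p x u.
Proof. by rewrite klein_metricC klein_metricZl klein_metricC. Qed.

Definition kleinE := (klein_metricDl, klein_metricDr, klein_metricZl, klein_metricZr).

Lemma klein_metric_ge0 p u : hyp_space p -> 0 <= klein_metric p u u.
Proof.
move=> hp; rewrite /klein_metric -expr2 addr_ge0//.
  by rewrite divr_ge0 ?dot_ge0// subr_ge0 ltW.
by rewrite divr_ge0 ?sqr_ge0.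
Qed.

Lemma klein_metric_eq0 p u : hyp_space p -> (klein_metric p u u == 0) = (u == 0).
Proof.
move=> hp; apply/eqP/eqP => [|->]; last first.
  by rewrite -[0](scale0r 0) klein_metricZl mul0r.
have h1 : 0 <= dot u u / (1 - dot p p) by rewrite divr_ge0 ?dot_ge0// subr_ge0 ltW.
have h2 : 0 <= dot p u ^+ 2 / (1 - dot p p) ^+ 2 by rewrite divr_ge0 ?sqr_ge0.
rewrite /klein_metric -expr2 => e.
have : dot u u / (1 - dot p p) == 0 by apply/eqP; lra.
by rewrite mulf_eq0 invr_eq0 subr_eq0 [1 == _]eq_sym (lt_eqF hp) orbF dot_eq0 => /eqP.
Qed.

(** The squared area of the parallelogram spanned by u and v in the metric at
    p. *)
Definition klein_gram p u v : R :=
  klein_metric p u u * klein_metric p v v - klein_metric p u v ^+ 2.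

Context (w : 'rV[R]_n -> {biscalar 'rV[R]_n}).
Hypothesis wf : is_two_form w.

Lemma formZl p (a : R) u v : w p (a *: u) v = a * w p u v.
Proof. exact: linearZl_LR. Qed.

Lemma formZr p (a : R) u v : w p u (a *: v) = a * w p u v.
Proof. exact: linearZr_LR. Qed.

Lemma form_antisym p u v : hyp_space p -> w p u v = - w p v u.
Proof.
move=> hp; apply/eqP; rewrite -addr_eq0; apply/eqP.
have := wf (u + v) hp; rewrite linearDl/= !linearDr/= !wf//.
by rewrite add0r addr0.
Qed.

Lemma form_wedge p u v (a b c d : R) : hyp_space p ->
  w p (a *: u + b *: v) (c *: u + d *: v) = (a * d - b * c) * w p u v.
Proof.
move=> hp; rewrite linearDl/= !linearDr/= !formZl !formZr !wf//.
by rewrite (form_antisym v u hp); ring.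
Qed.

(** If v is not a multiple of u, normalise u and the component of v orthogonal
    to u: the value of an alternating form is proportional to the area of the
    parallelogram. *)
Lemma gram_schmidt p u v : hyp_space p -> w p u v = 0 \/
  exists e1 e2, orthonormal_frame p e1 e2 /\
    w p u v = Num.sqrt (klein_gram p u v) * w p e1 e2.
Proof.
move=> hp; set a := klein_metric p u u; set b := klein_metric p u v.
have [u0|un] := eqVneq u 0; first by left; rewrite u0 linear0l.
have a0 : 0 < a by rewrite lt_neqAle klein_metric_ge0// andbT eq_sym klein_metric_eq0.
pose x := - (b / a) *: u + 1 *: v.
have ux : klein_metric p u x = 0.
  by rewrite /x !kleinE -/a -/b; field; rewrite gt_eqF.
have cE : klein_metric p x x = klein_gram p u v / a.
  rewrite /x !kleinE [klein_metric p v u]klein_metricC /klein_gram -/a -/b.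
  by field; rewrite gt_eqF.
have wx : w p u v = w p u x.
  have := form_wedge u v 1 0 (- (b / a)) 1 hp.
  by rewrite scale0r addr0 scale1r -/x => ->; ring.
clearbody x.
have [x0|xn] := eqVneq x 0; first by left; rewrite wx x0 linear0r.
have c0 : 0 < klein_metric p x x.
  by rewrite lt_neqAle klein_metric_ge0// andbT eq_sym klein_metric_eq0.
pose s := Num.sqrt a; pose t := Num.sqrt (klein_metric p x x).
have s0 : 0 < s by rewrite sqrtr_gt0.
have t0 : 0 < t by rewrite sqrtr_gt0.
have s2 : s ^+ 2 = a by rewrite sqr_sqrtr// ltW.
have t2 : t ^+ 2 = klein_metric p x x by rewrite sqr_sqrtr// ltW.
right; exists (s^-1 *: u), (t^-1 *: x); split.
  split; rewrite !kleinE -/a ?ux -?s2 -?t2; first by field; rewrite gt_eqF.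
    by field; rewrite gt_eqF.
  by ring.
rewrite formZl formZr wx.
have -> : klein_gram p u v = (s * t) ^+ 2.
  by rewrite exprMn s2 t2 cE; field; rewrite gt_eqF.
by rewrite sqrtr_sqr gtr0_norm ?mulr_gt0// !mulrA [s * t]mulrC mulfK ?gt_eqF// mulfV ?gt_eqF// mul1r.
Qed.

End KleinAlgebra.

(** * Geodesic planes *)

Section PlaneSection.
Context {R : realType} {n : nat}.
Context (p e1 e2 : 'rV[R]_n).
Hypothesis hp : hyp_space p.
Hypothesis orth : orthonormal_frame p e1 e2.

Let s : R := 1 - dot p p.
Let l1 : R := dot p e1 / s.
Let l2 : R := dot p e2 / s.
Let ell (y : R * R) : R := l1 * y.1 + l2 * y.2.

(** The last homogeneous coordinate of the projective chart [plane_section]. With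
    this linear part, which is p . (y1 e1 + y2 e2) / (1 - |p|^2), the boundary of
    the plane section becomes the unit circle. *)
Definition section_weight (y : R * R) : R :=
  1 + (dot p e1 * y.1 + dot p e2 * y.2) / (1 - dot p p).
Let d := section_weight.

(** The projective chart of the geodesic plane through p spanned by e1 and e2
    which identifies it with the Klein disc centred at p. *)
Definition plane_section (y : R * R) : 'rV[R]_n :=
  p + (d y)^-1 *: (y.1 *: e1 + y.2 *: e2).
Let X := plane_section.

Let s_gt0 : 0 < s. Proof. by rewrite subr_gt0. Qed.
Let s_neq0 : s != 0. Proof. by rewrite gt_eqF. Qed.

Let dE y : d y = 1 + ell y.
Proof. by rewrite /d /section_weight /ell /l1 /l2 -/s; field. Qed.

Let pe1 : dot p e1 = s * l1. Proof. by rewrite /l1; field. Qed.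
Let pe2 : dot p e2 = s * l2. Proof. by rewrite /l2; field. Qed.

Let e11 : dot e1 e1 = s * (1 - l1 ^+ 2).
Proof.
have [h _ _] := orth; by rewrite -h /klein_metric -/s /l1; field; exact: s_neq0.
Qed.

Let e22 : dot e2 e2 = s * (1 - l2 ^+ 2).
Proof. by have [_ h _] := orth; rewrite -h /klein_metric -/s /l2; field; exact: s_neq0. Qed.

Let e12 : dot e1 e2 = - s * (l1 * l2).
Proof.
have [_ _ h] := orth; transitivity (s * 0 - s * (l1 * l2)); last by ring.
by rewrite -h /klein_metric -/s /l1 /l2; field; exact: s_neq0.
Qed.

Let pp : dot p p = 1 - s. Proof. by rewrite /s; ring. Qed.

(** Writing l for the linear part of the weight and v = y1 e1 + y2 e2,
    orthonormality says l(y)^2 = |y|^2 - |v|^2 / (1 - |p|^2). If l(y) were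
    at most -1, then |v| = 0, but v = 0 forces l(y) = 0. *)
Lemma section_weight_gt0 y : sqn y <= 1 -> 0 < d y.
Proof.
move=> y1; rewrite dE -ltrBlDl sub0r.
pose v := y.1 *: e1 + y.2 *: e2.
have vv : dot v v = s * (sqn y - ell y ^+ 2).
  rewrite /v !dotE [dot e2 e1]dotC e11 e22 e12 /sqn /inner /ell; ring.
have h : ell y ^+ 2 <= sqn y.
  by have := dot_ge0 v; rewrite vv pmulr_rge0// subr_ge0.
have [l0|ln] := eqVneq (ell y) (-1); last first.
  have : ell y ^+ 2 <= 1 by exact: le_trans h y1.
  rewrite lt_neqAle eq_sym ln /=; set t := ell y => t1.
  by rewrite leNgt; apply/negP => t2; nra.
have v0 : v == 0.
  by rewrite -dot_eq0 vv eq_le pmulr_rge0// pmulr_rle0// subr_ge0 h subr_le0 l0 sqrrN expr1n y1.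
have : dot p v = s * ell y by rewrite /v !dotE pe1 pe2 /ell; ring.
rewrite (eqP v0) -[0](scale0r 0) dotZr mul0r l0 => /eqP.
by rewrite eq_sym mulrN1 oppr_eq0 (negPf s_neq0).
Qed.

(** The chart preserves the Lorentzian form up to the weights. With y = z this
    shows that the disc goes to the ball and the circle to the sphere; with
    y <> z on the circle, that the chart is injective there. *)
Lemma dot_plane_section y z : d y != 0 -> d z != 0 ->
  1 - dot (X y) (X z) = s * (1 - inner y z) / (d y * d z).
Proof.
rewrite /X /plane_section !dotE -/d [dot e1 p]dotC [dot e2 p]dotC [dot e2 e1]dotC pe1 pe2 e11 e22 e12 pp.
rewrite !dE /inner /ell => dy dz; field; by rewrite dy dz.
Qed.

Lemma plane_section_hyp y : sqn y < 1 -> hyp_space (X y).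
Proof.
move=> y1; have d0 := section_weight_gt0 (ltW y1).
rewrite /hyp_space/= -subr_gt0 dot_plane_section ?gt_eqF// divr_gt0 ?mulr_gt0//.
by rewrite subr_gt0.
Qed.

Lemma plane_section_ideal y : sqn y = 1 -> ideal_boundary (X y).
Proof.
move=> y1; have d0 : 0 < d y by apply: section_weight_gt0; rewrite y1.
have h := dot_plane_section (lt0r_neq0 d0) (lt0r_neq0 d0).
have y1' : inner y y = 1 by exact: y1.
move: h; rewrite y1' subrr mulr0 mul0r => /eqP.
by rewrite subr_eq0 => /eqP e; exact: esym e.
Qed.

Lemma plane_section_neq y z : sqn y = 1 -> sqn z = 1 -> 0 < sqn (sub2 y z) -> X y <> X z.
Proof.
move=> y1 z1 yz e.
have dy : 0 < d y by apply: section_weight_gt0; rewrite y1.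
have dz : 0 < d z by apply: section_weight_gt0; rewrite z1.
have h := dot_plane_section (lt0r_neq0 dy) (lt0r_neq0 dz).
rewrite -e (plane_section_ideal y1) subrr in h.
have yz1 : 1 - inner y z = 0.
  transitivity (d y * d z / s * (s * (1 - inner y z) / (d y * d z))).
    by field; rewrite s_neq0 !gt_eqF.
  by rewrite -h mulr0.
have : sqn (sub2 y z) = sqn y + sqn z - 2 * inner y z.
  by rewrite /sqn /inner /sub2 /=; ring.
by rewrite y1 z1 => e0; move: yz; rewrite e0; lra.
Qed.

Lemma section_weight0 : d (0, 0) = 1.
Proof. by rewrite dE /ell/= !mulr0 !addr0. Qed.

Lemma plane_section0 : X (0, 0) = p.
Proof. by rewrite /X /plane_section /= !scale0r addr0 scaler0 addr0. Qed.

(** The Klein metric pulled back by the chart is the Klein metric of the disc,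
    whose area density at y is the power -3/2 of 1 - |y|^2. The Jacobian of the
    chart with respect to (e1, e2) is d(y)^-3. *)
Lemma plane_section_gram y : sqn y < 1 ->
  klein_gram (X y) e1 e2 = d y ^+ 6 / (1 - sqn y) ^+ 3.
Proof.
move=> y1; have d0 := section_weight_gt0 (ltW y1).
have dn : d y != 0 by rewrite gt_eqF.
have dl : d y - ell y = 1 by rewrite dE addrK.
have D0 : 1 - sqn y != 0 by rewrite gt_eqF// subr_gt0.
have XX : 1 - dot (X y) (X y) = s * (1 - sqn y) / (d y * d y) by exact: dot_plane_section.
have Xe1 : dot (X y) e1 = s * (l1 + y.1) / d y.
  rewrite /X /plane_section -/d !dotE [dot e2 e1]dotC pe1 e11 e12.
  rewrite (_ : l1 + y.1 = l1 * (d y - ell y) + y.1); last by rewrite dl mulr1.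
  by rewrite /ell; field; exact: dn.
have Xe2 : dot (X y) e2 = s * (l2 + y.2) / d y.
  rewrite /X /plane_section -/d !dotE pe2 e22 e12.
  rewrite (_ : l2 + y.2 = l2 * (d y - ell y) + y.2); last by rewrite dl mulr1.
  by rewrite /ell; field; exact: dn.
rewrite /klein_gram /klein_metric XX Xe1 Xe2 e11 e22 e12.
move: dn D0; rewrite dE /ell /sqn /inner => dn D0; field.
by rewrite s_neq0 D0 dn.
Qed.

Lemma section_weight_tri A B D z : d A != 0 ->
  d (tri A B D z) = d A * (1 + (d B / d A - 1) * z.1 + (d D / d A - 1) * z.2).
Proof.
move=> dA; transitivity (d A + z.1 * (d B - d A) + z.2 * (d D - d A)); last by field.
by rewrite !dE /ell /tri /=; ring.
Qed.

(** A projective map sends barycentric coordinates to barycentric coordinates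
    multiplied by the weights of the vertices. *)
Lemma plane_section_tri A B D z : d A != 0 -> d B != 0 -> d D != 0 ->
  d (tri A B D z) != 0 ->
  triangle_param (X A) (X B) (X D) (simplex_rescale (d B / d A) (d D / d A) z) =
  X (tri A B D z).
Proof.
move=> dA dB dD dT.
have T0 : 1 + (d B / d A - 1) * z.1 + (d D / d A - 1) * z.2 != 0.
  by move: dT; rewrite section_weight_tri// mulf_eq0 negb_or => /andP[].
have w1 : d B / d A * z.1 / (1 + (d B / d A - 1) * z.1 + (d D / d A - 1) * z.2) =
    z.1 * d B / d (tri A B D z).
  by rewrite section_weight_tri//; move: T0; set t := 1 + _ + _ => T0; field; rewrite dA T0.
have w2 : d D / d A * z.2 / (1 + (d B / d A - 1) * z.1 + (d D / d A - 1) * z.2) =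
    z.2 * d D / d (tri A B D z).
  by rewrite section_weight_tri//; move: T0; set t := 1 + _ + _ => T0; field; rewrite dA T0.
rewrite /triangle_param /simplex_rescale /= w1 w2.
have dTE : d (tri A B D z) = (1 - z.1 - z.2) * d A + z.1 * d B + z.2 * d D.
  by rewrite !dE /ell /tri /=; ring.
apply/rowP => i; rewrite !mxE /tri/=.
move: dT; rewrite dTE => dT; field.
by rewrite dA dB dD dT.
Qed.

Lemma plane_section_sub A B : X B - X A =
  (B.1 / d B - A.1 / d A) *: e1 + (B.2 / d B - A.2 / d A) *: e2.
Proof. by apply/rowP => i; rewrite /X /plane_section !mxE -/d; ring. Qed.

(** Both sides are the determinant of three vectors (1, y / d(y)): these are
    (d(y), y) divided by the weights, and (d(y), y) is the image of (1, y) by a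
    linear map of determinant 1. *)
Lemma plane_section_wedge A B D : d A != 0 -> d B != 0 -> d D != 0 ->
  (B.1 / d B - A.1 / d A) * (D.2 / d D - A.2 / d A) -
  (B.2 / d B - A.2 / d A) * (D.1 / d D - A.1 / d A) =
  cross (sub2 B A) (sub2 D A) / (d A * d B * d D).
Proof.
rewrite /cross /sub2 /= !dE /ell => dA dB dD; field.
by rewrite dA dB dD.
Qed.

Lemma plane_section_jacobian A B D z : d A != 0 -> d B != 0 -> d D != 0 ->
  d (tri A B D z) != 0 ->
  simplex_jacobian (d B / d A) (d D / d A) z = d A * d B * d D / d (tri A B D z) ^+ 3.
Proof.
move=> dA dB dD dT; rewrite /simplex_jacobian.
have T0 : 1 + (d B / d A - 1) * z.1 + (d D / d A - 1) * z.2 != 0.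
  by move: dT; rewrite section_weight_tri// mulf_eq0 negb_or => /andP[].
rewrite section_weight_tri//; move: T0; set t := 1 + _ + _ => T0; field.
by rewrite dA T0.
Qed.

End PlaneSection.

(** * Measurable and null sets of the plane *)

Section OpenPlane.
Context {R : realType}.
Notation mu := (@lebesgue_measure R).
Notation plane := (measurableTypeR R * measurableTypeR R)%type.
Local Open Scope classical_set_scope.

(** An open set is the union of the boxes that it contains among those with
    rational centre and radius 1 / (k + 1), which are countably many. *)
Lemma open_measurable_plane (U : set (R * R)) : open U -> measurable (U : set plane).
Proof.
move=> oU.
pose r (i : rat * rat * nat) : R := i.2.+1%:R^-1.
pose q1 (i : rat * rat * nat) : R := ratr i.1.1.
pose q2 (i : rat * rat * nat) : R := ratr i.1.2.
pose box (i : rat * rat * nat) : set plane :=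
  [set x : R | q1 i - r i < x < q1 i + r i] `*` [set x : R | q2 i - r i < x < q2 i + r i].
have mi (a b : R) : measurable ([set x : R | a < x < b] : set (measurableTypeR R)).
  by have := @measurable_itv R (Interval (BRight a) (BLeft b)); rewrite set_itvoo; exact.
have -> : (U : set plane) = \bigcup_i (if `[< box i `<=` U >] then box i else set0).
  rewrite eqEsubset; split => [[x y] Uxy|z [i _]]; last by case: asboolP => // bU; exact: bU.
  move: oU; rewrite openE => /(_ _ Uxy) /nbhs_ballP[e/= e0 beU].
  pose k := Num.truncn (2 / e).
  have k2 : 2 / e < k.+1%:R by rewrite truncnS_gt.
  have [v vE] : exists v : R, v = k.+1%:R^-1 by exists k.+1%:R^-1.
  have v0 : 0 < v by rewrite vE invr_gt0.
  have ve : 2 * v < e.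
    by move: k2; rewrite vE ltr_pdivrMr// mulrC => k2; rewrite ltr_pdivrMr// mulrC.
  have near_rat (t : R) : exists q : rat, t - v < ratr q < t + v.
    have /rat_in_itvoo[q qI] : t - v < t + v by lra.
    by exists q; move: qI; rewrite in_itv.
  have [a /andP[a1 a2]] := near_rat x; have [b /andP[b1 b2]] := near_rat y.
  exists ((a, b), k) => //; rewrite asboolT; last first.
    move=> [x' y'] [/= /andP[x1 x2] /andP[y1 y2]]; apply: beU.
    move: x1 x2 y1 y2; rewrite /q1 /q2 /r /= -vE => x1 x2 y1 y2.
    by split; rewrite /= /ball /= ltr_norml; apply/andP; split; lra.
  by rewrite /box /q1 /q2 /r /= -vE; split => /=; apply/andP; split; lra.
apply: countable_bigcupT_measurable; first exact: countableP.
move=> i; case: asboolP => // _; apply: measurableX; exact: mi.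
Qed.

(** The extension by 0 outside U makes the function measurable on the whole
    plane, as the changes of variable require. *)
Lemma measurable_patch_open (U : set (R * R)) (f : R * R -> R) : open U ->
  (forall z, U z -> {for z, continuous f}) -> measurable_fun [set: plane] (f \_ U).
Proof.
move=> oU cf; apply/(measurable_restrictT _ _).1; first exact: open_measurable_plane.
apply: (measurability _ (RGenOpens.measurableE R)).
move=> _ [_ [a [b ->] <-]]; apply: open_measurable_plane.
rewrite openE => z [Uz fz]; apply: filterI; first by move: oU; rewrite openE; exact.
apply: (cf _ Uz); apply: open_nbhs_nbhs; split => //; exact: interval_open.
Qed.

Lemma continuous_fst_snd (z : R * R) : {for z, continuous (@fst R R)} /\ {for z, continuous (@snd R R)}.
Proof. by split; [exact: cvg_fst|exact: cvg_snd]. Qed.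

Definition closed_simplex : set (R * R) :=
  [set z | [&& 0 <= z.1, 0 <= z.2 & z.1 + z.2 <= 1]].

Lemma measurable_closed_simplex : measurable (closed_simplex : set plane).
Proof.
rewrite -[closed_simplex]setTI (_ : setT `&` closed_simplex = setT `&` (fun z : R * R =>
  [&& 0 <= z.1, 0 <= z.2 & z.1 + z.2 <= 1]) @^-1` [set true]); last first.
  by rewrite !setTI; apply/seteqP; split.
have : measurable_fun [set: plane] (fun z : R * R =>
  [&& 0 <= z.1, 0 <= z.2 & z.1 + z.2 <= 1]).
  apply: measurable_and; first by apply: measurable_fun_ler; meas.
  by apply: measurable_and; apply: measurable_fun_ler; meas.
by move=> /(_ measurableT [set true]); apply.
Qed.

(** The two domains differ by a part of the lines z1 = 0, z2 = 0 and
    z1 + z2 = 1, which are null. *)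
Lemma integral_closed_simplex (f : R * R -> R) : measurable_fun [set: plane] f ->
  (\int[mu \x mu]_(z in closed_simplex) (f z)%:E = \int[mu \x mu]_(z in simplex) (f z)%:E)%E.
Proof.
move=> mf.
have mF (D : set plane) : measurable D -> measurable_fun [set: plane] ((EFin \o f) \_ D).
  move=> mD; apply/(measurable_restrictT _ _).1 => //.
  by apply: measurable_funTS; apply/measurable_EFinP.
rewrite integral_mkcond [RHS]integral_mkcond.
apply: ae_eq_integral => //.
- exact: mF measurable_closed_simplex.
- exact: mF (@measurable_simplex R).
pose L1 : set plane := [set 0] `*` setT.
pose L2 : set plane := setT `*` [set 0].
pose L3 : set plane := [set z : R * R | z.1 + z.2 = 1].
have m1 : measurable ([set 0] : set (measurableTypeR R)) by exact: measurable_set1.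
have N1 : (mu \x mu)%E.-negligible L1.
  apply/negligibleP; first exact: measurableX.
  have := @product_measure1E _ _ (measurableTypeR R) (measurableTypeR R) R mu mu
    _ _ m1 measurableT.
  by rewrite [X in (X * _)%E](_ : _ = 0%E) ?mul0e//; exact: lebesgue_measure_set1.
have N2 : (mu \x mu)%E.-negligible L2.
  apply/negligibleP; first exact: measurableX.
  have := @product_measure1E _ _ (measurableTypeR R) (measurableTypeR R) R mu mu
    _ _ measurableT m1.
  by rewrite [X in (_ * X)%E](_ : _ = 0%E) ?mule0//; exact: lebesgue_measure_set1.
have N3 : (mu \x mu)%E.-negligible L3.
  have mL : measurable L3.
    have : measurable_fun [set: plane] (fun z : R * R => z.1 + z.2) by meas.
    by move=> /(_ measurableT [set 1]); rewrite setTI; apply; exact: measurable_set1.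
  apply/negligibleP; first exact: mL.
  apply: (@eq_trans _ _ (\int[mu]_x mu (xsection L3 x))%E); first by [].
  apply: integral0_eq => x _.
  rewrite (_ : xsection L3 x = [set 1 - x]); first exact: lebesgue_measure_set1.
  apply/seteqP; split => y; rewrite /xsection/= inE /L3/=; first by move=> <-; ring.
  by move=> ->; ring.
apply: negligibleS (negligibleU N1 (negligibleU N2 N3)) => z /= nz.
apply: contrapT => /not_orP[n1 /not_orP[n2 n3]]; apply: nz => _.
rewrite !patchE; congr (if _ then _ else _).
have z1 : z.1 != 0 by apply/eqP => z0; apply: n1; split.
have z2 : z.2 != 0 by apply/eqP => z0; apply: n2; split.
have z3 : z.1 + z.2 != 1 by apply/eqP => z0; exact: n3.
apply/idP/idP; rewrite !inE => /and3P[h1 h2 h3]; apply/and3P; split.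
- by rewrite lt_neqAle eq_sym z1.
- by rewrite lt_neqAle eq_sym z2.
- by rewrite lt_neqAle z3.
- exact: ltW.
- exact: ltW.
- exact: ltW.
Qed.

End OpenPlane.

(** * Ideal triangles as images of the simplex *)

Section IdealTriangle.
Context {R : realType} {n : nat}.
Context (a b c : 'rV[R]_n).
Hypothesis (ha : ideal_boundary a) (hb : ideal_boundary b) (hc : ideal_boundary c).
Hypothesis (ab : a <> b) (bc : b <> c) (ac : a <> c).

(** Put u = b - a and v = c - a. As a, b, c lie on the unit sphere,
    2 a . u = - |u|^2 and 2 a . v = - |v|^2. From x u + y v = 0 follow
    x |u|^2 + y |v|^2 = 0 and x^2 |u|^2 = y^2 |v|^2, hence y (x + y) = 0. The
    case y = - x <> 0 would give u = v. *)
Lemma sphere_affine_independent (x y : R) :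
  x *: (b - a) + y *: (c - a) = 0 -> x = 0 /\ y = 0.
Proof.
have [u uE] : exists u, u = b - a by exists (b - a).
have [v vE] : exists v, v = c - a by exists (c - a).
rewrite -uE -vE => e.
have half (z : 'rV[R]_n) : dot (a + z) (a + z) = 1 -> dot a z = - (dot z z / 2).
  have aa : dot a a = 1 := ha.
  by rewrite !dotE aa [dot z a]dotC; move: (dot a z) (dot z z) => s t; lra.
have au : dot a u = - (dot u u / 2).
  by apply: half; rewrite uE addrC subrK.
have av : dot a v = - (dot v v / 2).
  by apply: half; rewrite vE addrC subrK.
have u0 : 0 < dot u u.
  by rewrite lt_neqAle dot_ge0 andbT eq_sym dot_eq0 uE subr_eq0; apply/eqP => h; exact: ab.
have v0 : 0 < dot v v.
  by rewrite lt_neqAle dot_ge0 andbT eq_sym dot_eq0 vE subr_eq0; apply/eqP => h; exact: ac.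
have h1 : x * dot u u + y * dot v v = 0.
  have : dot a (x *: u + y *: v) = 0 by rewrite e -[0](scale0r 0) dotZr mul0r.
  by rewrite !dotE au av => h; lra.
have h2 : x ^+ 2 * dot u u = y ^+ 2 * dot v v.
  have xu : x *: u = - y *: v by apply/eqP; rewrite scaleNr -subr_eq0 opprK e.
  have : dot (x *: u) (x *: u) = dot (- y *: v) (- y *: v) by rewrite xu.
  by rewrite !dotE => h; rewrite !expr2 -!mulrA h; ring.
have h3 : y * (x + y) * dot v v = 0.
  have -> : y * (x + y) * dot v v = x * (x * dot u u + y * dot v v) - (x ^+ 2 * dot u u - y ^+ 2 * dot v v) by ring.
  by rewrite h1 h2; ring.
move: h3 => /eqP; rewrite !mulf_eq0 (gt_eqF v0) orbF => /orP[/eqP y0|/eqP xy].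
  split=> //; move: h1; rewrite y0 mul0r addr0 => /eqP.
  by rewrite mulf_eq0 (gt_eqF u0) orbF => /eqP.
have yx : y = - x by rewrite -[y]addr0 -[0](subrr x) addrA [y + x]addrC xy sub0r.
have [x0|xn] := eqVneq x 0; first by rewrite yx x0 oppr0.
exfalso; apply: bc; move: e; rewrite yx scaleNr -scalerBr => /eqP.
rewrite scaler_eq0 (negPf xn)/= uE vE => /eqP h.
by apply/eqP; rewrite -subr_eq0 -h; apply/eqP; rewrite opprB addrA subrK.
Qed.

(** The convex hull of the vertices is the image of the closed simplex, and the
    parametrisation is injective by [sphere_affine_independent]. The second
    condition excludes the vertices, which are mapped to ideal points. *)
Lemma ideal_triangle_param (z : R * R) :
  (triangle_param a b c @^-1` ideal_triangle a b c) z <->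
  closed_simplex z /\ hyp_space (triangle_param a b c z).
Proof.
pose T := triangle_param a b c.
suff h : smallest (@convex_set R 'rV[R]_n) [set a; b; c] (T z) <-> closed_simplex z.
  by split=> -[/h].
split=> [|/and3P[z1 z2 z12] A [cA abcA]].
  have hull : smallest (@convex_set R 'rV[R]_n) [set a; b; c] `<=` T @` closed_simplex.
    apply: smallest_sub.
      move=> x y t; rewrite !inE => -[[x1 x2] /and3P[/= x10 x20 x12] <-].
      move=> [[y1 y2] /and3P[/= y10 y20 y12] <-].
      have t0 : 0 <= t%:num by [].
      have t1 : t%:num <= 1 by [].
      exists (t%:num * x1 + (1 - t%:num) * y1, t%:num * x2 + (1 - t%:num) * y2).
        apply/and3P; split => /=.
        - by rewrite addr_ge0// mulr_ge0// subr_ge0.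
        - by rewrite addr_ge0// mulr_ge0// subr_ge0.
        - have : t%:num * (x1 + x2) + (1 - t%:num) * (y1 + y2) <= t%:num * 1 + (1 - t%:num) * 1.
            by rewrite lerD// ler_wpM2l// subr_ge0.
          by rewrite !mulrDr => h; lra.
      change (T (t%:num * x1 + (1 - t%:num) * y1, t%:num * x2 + (1 - t%:num) * y2) =
        t%:num *: T (x1, x2) + (1 - t%:num) *: T (y1, y2)).
      by rewrite /T /triangle_param/=; apply/rowP => i; rewrite !mxE; ring.
    move=> x [[->|->]|->].
    - exists (0, 0); first by apply/and3P; split; rewrite /= ?addr0.
      by rewrite /T /triangle_param /= !scale0r !addr0.
    - exists (1, 0); first by apply/and3P; split; rewrite /= ?addr0.
      by rewrite /T /triangle_param /= scale1r scale0r addr0 addrC subrK.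
    - exists (0, 1); first by apply/and3P; split; rewrite /= ?add0r.
      by rewrite /T /triangle_param /= scale1r scale0r addr0 addrC subrK.
  move=> /hull[y ys]; rewrite /T /triangle_param -!addrA => /addrI e.
  have : (y.1 - z.1) *: (b - a) + (y.2 - z.2) *: (c - a) = 0.
    by rewrite !scalerBl addrACA -opprD e subrr.
  case/sphere_affine_independent => /eqP; rewrite subr_eq0 => /eqP e1 /eqP.
  rewrite subr_eq0 => /eqP e2.
  by move: ys; rewrite /closed_simplex /= e1 e2.
have inA (x : 'rV[R]_n) (t : R) (y : 'rV[R]_n) : 0 <= t -> t <= 1 -> A x -> A y -> A (t *: x + (1 - t) *: y).
  move=> t0 t1 Ax Ay.
  have t01 : Itv.spec (@Itv.num_sem R) (Itv.Real `[0%Z, 1%Z]) t.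
    by rewrite /Itv.spec /Itv.num_sem/= num_real /= in_itv/= t0 t1.
  have := cA x y (Itv.mk t01); rewrite !inE => /(_ Ax Ay); exact.
have Aa : A a by apply: abcA; left; left.
have Ab : A b by apply: abcA; left; right.
have Ac : A c by apply: abcA; right.
have [z0|zn] := eqVneq (z.1 + z.2) 0.
  have e1 : z.1 = 0 by lra.
  have e2 : z.2 = 0 by lra.
  by rewrite /T /triangle_param e1 e2 !scale0r !addr0.
have zp : 0 < z.1 + z.2 by rewrite lt_neqAle eq_sym zn addr_ge0.
have -> : T z = (z.1 + z.2) *: ((z.1 / (z.1 + z.2)) *: b + (1 - z.1 / (z.1 + z.2)) *: c)
    + (1 - (z.1 + z.2)) *: a.
  by apply/rowP => i; rewrite /T /triangle_param !mxE; field; exact: zn.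
apply: (inA) => //; first exact: ltW.
by apply: (inA) => //; [rewrite divr_ge0// ltW|rewrite ler_pdivrMr// mul1r lerDl].
Qed.

End IdealTriangle.

(** * Restriction of a form to a geodesic plane *)

Section Chord.
Context {R : realType}.

(** The area of a triangle with circumradius 1 is the product of its sides
    divided by 4. *)
Lemma cross_unit_circle (A B D : R * R) : sqn A = 1 -> sqn B = 1 -> sqn D = 1 ->
  4 * cross (sub2 B A) (sub2 D A) ^+ 2 =
  sqn (sub2 B A) * sqn (sub2 D A) * sqn (sub2 D B).
Proof.
move=> hA hB hD.
set u := sub2 B A; set v := sub2 D A.
have Au : 2 * inner A u = - sqn u.
  have : sqn B = sqn A + 2 * inner A u + sqn u.
    by rewrite /sqn /inner /u /sub2 /=; ring.
  by rewrite hA hB; lra.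
have Av : 2 * inner A v = - sqn v.
  have : sqn D = sqn A + 2 * inner A v + sqn v.
    by rewrite /sqn /inner /v /sub2 /=; ring.
  by rewrite hA hD; lra.
have -> : sqn (sub2 D B) = sqn u + sqn v - 2 * inner u v.
  by rewrite /sqn /inner /u /v /sub2 /=; ring.
transitivity (sqn A * (4 * cross u v ^+ 2)); first by rewrite hA mul1r.
transitivity ((2 * inner A u) ^+ 2 * sqn v + (2 * inner A v) ^+ 2 * sqn u
  - 2 * (2 * inner A u) * (2 * inner A v) * inner u v).
  by clear; rewrite /sqn /inner /cross; ring.
by rewrite Au Av; ring.
Qed.

Lemma continuous_sqn : continuous (@sqn R).
Proof.
move=> y; have [c1 c2] := continuous_fst_snd y.
exact: (cvgD (cvgM c1 c1) (cvgM c2 c2)).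
Qed.

Lemma open_disc : open [set y : R * R | sqn y < 1].
Proof.
have := @open_comp _ _ (@sqn R) [set x : R | x < 1]; apply; last exact: open_lt.
by move=> y _; exact: continuous_sqn.
Qed.

End Chord.

Section Restriction.
Context {R : realType} {n : nat}.
Notation mu := (@lebesgue_measure R).
Notation plane := (measurableTypeR R * measurableTypeR R)%type.
Context (w : 'rV[R]_n -> {biscalar 'rV[R]_n}).
Hypothesis wf : is_two_form w.
Hypothesis wc : forall u v q, hyp_space q -> {for q, continuous (fun q => w q u v : R)}.
Hypothesis wb : bounded_form w.
Hypothesis wi : forall a b c : 'rV[R]_n,
  ideal_boundary a -> ideal_boundary b -> ideal_boundary c ->
  a <> b -> b <> c -> a <> c -> triangle_integral w a b c = 0%E.

(** By [gram_schmidt], w(u, v) is the area of the parallelogram times the value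
    on an orthonormal frame. *)
Lemma form_gram_bound : exists2 C : R, 0 <= C & forall q u v, hyp_space q ->
  `|w q u v : R| <= C * Num.sqrt (klein_gram q u v).
Proof.
have [C hC] := wb; exists (Num.max C 0); first by rewrite le_max lexx orbT.
move=> q u v hq; have [-> | [e1 [e2 [frame ->]]]] := gram_schmidt wf u v hq.
  by rewrite normr0 mulr_ge0 ?sqrtr_ge0// le_max lexx orbT.
rewrite normrM ger0_norm ?sqrtr_ge0// mulrC ler_wpM2r ?sqrtr_ge0//.
by rewrite le_max; apply/orP; left; apply: hC; exists q, e1, e2.
Qed.

Context (p e1 e2 : 'rV[R]_n).
Hypothesis hp : hyp_space p.
Hypothesis orth : orthonormal_frame p e1 e2.

Let d := section_weight p e1 e2.
Let X := plane_section p e1 e2.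
Let disc : set (R * R) := [set y | sqn y < 1].

(** The coefficient of the pull-back of w by the chart: d(y)^-3 is the
    Jacobian of the chart with respect to the frame (e1, e2). *)
Definition section_density : R * R -> R :=
  (fun y => (w (X y) e1 e2 : R) / d y ^+ 3) \_ disc.
Let h := section_density.

Let hE y : sqn y < 1 -> h y = w (X y) e1 e2 / d y ^+ 3.
Proof. by move=> y1; rewrite /h /section_density patchE mem_set. Qed.

Let d_gt0 y : sqn y <= 1 -> 0 < d y. Proof. exact: section_weight_gt0. Qed.

Lemma continuous_triangle_param (a b c : 'rV[R]_n) : continuous (triangle_param a b c).
Proof.
move=> z; have [c1 c2] := continuous_fst_snd z.
apply: cvgD; last by apply: cvgZ; [exact: c2|exact: cvg_cst].
by apply: cvgD; [exact: cvg_cst|apply: cvgZ; [exact: c1|exact: cvg_cst]].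
Qed.

Let continuous_weight y : {for y, continuous d}.
Proof.
have [c1 c2] := continuous_fst_snd y.
apply: cvgD; first exact: cvg_cst.
apply: cvgM; last exact: cvg_cst.
by apply: cvgD; apply: cvgM; [exact: cvg_cst|exact: c1|exact: cvg_cst|exact: c2].
Qed.

Let continuous_section y : sqn y < 1 -> {for y, continuous X}.
Proof.
move=> y1; have [c1 c2] := continuous_fst_snd y.
apply: cvgD; first exact: cvg_cst.
apply: cvgZ.
  by apply: cvgV; [rewrite gt_eqF// d_gt0// ltW|exact: continuous_weight].
by apply: cvgD; (apply: cvgZ; last exact: cvg_cst); [exact: c1|exact: c2].
Qed.

Let continuous_density_formula y : sqn y < 1 ->
  {for y, continuous (fun y => (w (X y) e1 e2 : R) / d y ^+ 3)}.
Proof.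
move=> y1; apply: cvgM.
  apply: (@continuous_comp _ _ _ X (fun q => w q e1 e2 : R)).
    exact: continuous_section.
  by apply: wc; exact: plane_section_hyp.
apply: cvgV; first by rewrite expf_neq0// gt_eqF// d_gt0// ltW.
rewrite !exprS expr0 mulr1; under eq_fun do rewrite !exprS expr0 mulr1.
have c := @continuous_weight y.
exact: (cvgM c (cvgM c c)).
Qed.

Lemma continuous_section_density y : sqn y < 1 -> {for y, continuous h}.
Proof.
move=> y1.
have e : \forall x \near y, (w (X x) e1 e2 : R) / d x ^+ 3 = h x.
  near=> x; rewrite hE//; near: x.
  by apply: open_nbhs_nbhs; split; [exact: open_disc|].
have c : h x @[x --> y] --> (w (X y) e1 e2 : R) / d y ^+ 3.
  by apply: cvg_trans (continuous_density_formula y1); exact: near_eq_cvg.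
rewrite -hE// in c; exact: c.
Unshelve. all: by end_near. Qed.

Lemma measurable_section_density : measurable_fun [set: plane] h.
Proof.
apply: measurable_patch_open; first exact: open_disc.
by move=> y; exact: continuous_density_formula.
Qed.

Lemma section_density_bound : exists C : R, forall y, sqn y < 1 ->
  `|h y| <= C * (1 - sqn y) `^ (- (3 / 2)).
Proof.
have [C C0 hC] := form_gram_bound; exists C => y y1; rewrite hE//.
have d0 : 0 < d y by rewrite d_gt0// ltW.
have D0 : 0 < 1 - sqn y by rewrite subr_gt0.
have := hC _ e1 e2 (plane_section_hyp hp orth y1).
rewrite plane_section_gram// -/X -/d.
set t := _ `^ _; have t0 : 0 <= t by exact: powR_ge0.
have -> : d y ^+ 6 / (1 - sqn y) ^+ 3 = (d y ^+ 3 * t) ^+ 2.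
  rewrite exprMn -exprM; congr (_ * _).
  rewrite /t -[in RHS]powR_mulrn ?powR_ge0// -[in RHS]powRrM -powR_mulrn ?(ltW D0)// -powRN.
  by congr (_ `^ _); lra.
rewrite sqrtr_sqr [`|d y ^+ 3 * t|]ger0_norm ?mulr_ge0 ?exprn_ge0 ?(ltW d0)// => hw.
rewrite normrM normfV (gtr0_norm (exprn_gt0 3 d0)) ler_pdivrMr ?exprn_gt0//.
by rewrite (_ : C * t * d y ^+ 3 = C * (d y ^+ 3 * t)); [exact: hw|ring].
Qed.

(** The chart maps the triangle A, B, D onto the ideal triangle with vertices
    X A, X B, X D. The affine parametrisations of the two differ by the
    projective map [simplex_rescale] of the simplex, whose Jacobian and the
    factor relating (X B - X A, X D - X A) to (e1, e2) combine to the Jacobian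
    of the chart times the constant delta, twice the signed area of the
    triangle A, B, D. *)
Lemma section_density_ideal (A B D : R * R) : sqn A = 1 -> sqn B = 1 -> sqn D = 1 ->
  0 < sqn (sub2 B A) -> 0 < sqn (sub2 D A) -> 0 < sqn (sub2 D B) ->
  (\int[mu \x mu]_(z in simplex) (h (tri A B D z))%:E = 0)%E.
Proof.
move=> hA hB hD dBA dDA dDB.
have sym (y z : R * R) : sqn (sub2 y z) = sqn (sub2 z y).
  by rewrite /sqn /inner /sub2 /=; ring.
have dA : 0 < d A by rewrite d_gt0// hA.
have dB : 0 < d B by rewrite d_gt0// hB.
have dD : 0 < d D by rewrite d_gt0// hD.
have iA : ideal_boundary (X A) by exact: plane_section_ideal.
have iB : ideal_boundary (X B) by exact: plane_section_ideal.
have iD : ideal_boundary (X D) by exact: plane_section_ideal.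
have AB : X A <> X B by apply: plane_section_neq => //; rewrite sym.
have BD : X B <> X D by apply: plane_section_neq => //; rewrite sym.
have AD : X A <> X D by apply: plane_section_neq => //; rewrite sym.
pose T := triangle_param (X A) (X B) (X D).
pose U := T @^-1` @hyp_space R n.
have oU : open U.
  apply: open_comp; first by move=> z _; exact: continuous_triangle_param.
  have := @open_comp _ _ (fun q : 'rV[R]_n => dot q q) [set x : R | x < 1].
  by apply; [move=> q _; exact: continuous_dot_self|exact: open_lt].
pose F (z : R * R) : R := w (T z) (X B - X A) (X D - X A).
have mF : measurable_fun [set: plane] (F \_ U).
  apply: measurable_patch_open; first exact: oU.
  move=> z Uz.
  apply: (@continuous_comp _ _ _ T (fun q => w q (X B - X A) (X D - X A) : R)).
    exact: continuous_triangle_param.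
  exact: wc.
have I0 : (\int[mu \x mu]_(z in simplex) ((F \_ U) z)%:E = 0)%E.
  rewrite -integral_closed_simplex// -(wi iA iB iD AB BD AD) /triangle_integral.
  rewrite integral_mkcond [RHS]integral_mkcond; apply: eq_integral => z _.
  have [TP TP'] := ideal_triangle_param iA iB iD AB BD AD z.
  rewrite [LHS]patchE [RHS]patchE; case: ifPn => zK; case: ifPn => zP //.
  - by have [_ Uz] := TP (set_mem zP); rewrite /= patchE mem_set.
  - rewrite /= patchE; case: ifPn => //; rewrite inE => Uz.
    by move: zP; rewrite mem_set//; apply: TP'; split=> //; exact: set_mem.
  - by have [zK' _] := TP (set_mem zP); move: zK; rewrite mem_set.
have c1 : 0 < d B / d A by rewrite divr_gt0.
have c2 : 0 < d D / d A by rewrite divr_gt0.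
move: I0; rewrite (integral_simplex_rescale c1 c2 mF).
pose delta := cross (sub2 B A) (sub2 D A).
have [K K0 hK] := sqn_tri_powR hA hB hD dBA dDA dDB.
have [C hC] := section_density_bound.
have ms : measurable (simplex : set plane) by exact: measurable_simplex.
have mh : measurable_fun [set: plane] (fun z => h (tri A B D z)).
  by apply: (measurableT_comp measurable_section_density); exact: measurable_tri.
have ih : (mu \x mu)%E.-integrable simplex (EFin \o (fun z => h (tri A B D z))).
  have ig := integrableZl ms (`|C| * K) (@integrable_bary_e2_powR R).
  apply: (le_integrable ms _ _ ig).
    by apply/measurable_EFinP; exact: measurable_funTS.
  move=> z sz /=; have [/andP[z0 z1] zK] := hK _ sz.
  rewrite lee_fin; apply: (le_trans (hC _ z1)).
  apply: le_trans (ler_norm _); rewrite -mulrA.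
  apply: (@le_trans _ _ (`|C| * (1 - sqn (tri A B D z)) `^ (- (3 / 2)))).
    by rewrite ler_wpM2r ?powR_ge0// ler_norm.
  by rewrite ler_wpM2l.
have -> : (\int[mu \x mu]_(z in simplex) (`|simplex_jacobian (d B / d A) (d D / d A) z| *
      (F \_ U) (simplex_rescale (d B / d A) (d D / d A) z))%:E =
    delta%:E * \int[mu \x mu]_(z in simplex) (h (tri A B D z))%:E)%E.
  rewrite -integralZl//; apply: eq_integral => z; rewrite inE => sz.
  have [/andP[_ z1] _] := hK _ sz.
  have dT : 0 < d (tri A B D z) by rewrite d_gt0// ltW.
  have [dAn dBn dDn dTn] : [/\ d A != 0, d B != 0, d D != 0 & d (tri A B D z) != 0].
    by split; rewrite gt_eqF.
  have hT : hyp_space (X (tri A B D z)) by exact: plane_section_hyp.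
  have TE : T (simplex_rescale (d B / d A) (d D / d A) z) = X (tri A B D z).
    exact: plane_section_tri.
  rewrite plane_section_jacobian// -/d patchE mem_set; last by rewrite /U/= TE.
  rewrite /F TE !plane_section_sub// form_wedge// plane_section_wedge// -/d -/delta hE//.
  rewrite gtr0_norm; last by rewrite divr_gt0 ?exprn_gt0// !mulr_gt0.
  rewrite -EFinM; congr EFin; rewrite -/X; field.
  by rewrite dAn dBn dDn dTn.
move=> /eqP; rewrite mule_eq0 => /orP[|/eqP//].
rewrite eqe => /eqP d0; exfalso.
have := cross_unit_circle hA hB hD; rewrite -/delta d0 expr0n mulr0 => e.
by have := mulr_gt0 (mulr_gt0 dBA dDA) dDB; rewrite -e ltxx.
Qed.

Lemma form_orthonormal_eq0 : w p e1 e2 = 0.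
Proof.
have [C hC] := section_density_bound.
have := planar_vanishing measurable_section_density continuous_section_density hC
  section_density_ideal.
rewrite hE; last by rewrite /sqn /inner /= mulr0 addr0.
have d0 : d (0, 0) = 1 by exact: section_weight0.
have X0 : X (0, 0) = p by exact: plane_section0.
by rewrite d0 X0 expr1n divr1.
Qed.

End Restriction.

Theorem theorem3 (R : realType) (n : nat) (n_ge2 : (2 <= n)%N)
    (w : 'rV[R]_n -> {biscalar 'rV[R]_n})
    (w_form : is_two_form w)
    (w_smooth : smooth_form w)
    (w_closed : closed_form w)
    (w_bounded : bounded_form w)
    (w_ideal : forall a b c : 'rV[R]_n,
      ideal_boundary a -> ideal_boundary b -> ideal_boundary c ->
      a <> b -> b <> c -> a <> c ->
      triangle_integral w a b c = 0%E) :
  forall p u v : 'rV[R]_n, hyp_space p -> w p u v = 0.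
Proof.
move=> p u v hp.
have wc x y q : hyp_space q -> {for q, continuous (fun q => w q x y : R)}.
  by move=> hq; exact: differentiable_continuous (w_smooth x y [::] q hq).
have [// | [e1 [e2 [orth ->]]]] := gram_schmidt w_form u v hp.
by rewrite (form_orthonormal_eq0 w_form wc w_bounded w_ideal hp orth) mulr0.
Qed.
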